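(* Let $\Phi$ be the base process, $\mathbb M'$ the mark space and $\xi$ the score function, and assume that $\xi$ admits a family $\{R^\varepsilon\}_{\varepsilon>0}$ of internally and externally stabilizing radii. Assume that either (1) $\xi$ takes values in $\{-\infty\}\cup[0,\infty)$ and admits a neutral mark and an integrable majorant $\overline\xi$, or (2) $\xi$ takes values in $[-\infty,0]$ and admits some score difference majorant $\overline\xi$, such that $\mathbb E^0[\overline\xi^{\,p}]<\infty$ and $\mathbb E^0[(R_0^\varepsilon)^{dp/(p-1)}]<\infty$ for some $p>1$, every $\varepsilon>0$ and every admissible marking $\Psi\in\mathcal T_{\mathsf{adm}}(\Phi)$. Then every locally optimal admissible stationary marking of $\Phi$ is intensity-optimal.
   Context: Spaces. $\mathbb M,\mathbb M'$ are locally compact, second countable, Hausdorff spaces. For such a space $\mathbb K$, $\mathbb N_{\mathbb K}$ is the set of locally finite subsets of $\mathbb R^d\times\mathbb K$ containing at most one element of each $\{x\}\times\mathbb K$, with the evaluation $\sigma$-algebra. Put $\mathbb N^0_{\mathbb M\times\mathbb M'}=\{\psi\in\mathbb N_{\mathbb M\times\mathbb M'}:\psi(\{o\}\times\mathbb M\times\mathbb M')=1\}$ ($o$ the origin), similarly $\mathbb N^0_{\mathbb M}$. $\pi:\mathbb N_{\mathbb M\times\mathbb M'}\to\mathbb N_{\mathbb M}$ forgets the $\mathbb M'$-marks. $S_y$ shifts atoms $(x,m)\mapsto(x-y,m)$, resp. $(x,m,m')\mapsto(x-y,m,m')$. $\psi\in\mathbb N_{\mathbb M\times\mathbb M'}$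 is a marking of $\varphi\in\mathbb N_{\mathbb M}$ if $\pi(\psi)=\varphi$. Abusing notation, $\psi\cap B$, $\psi\setminus B$ for $B\subset\mathbb R^d$ denote the restrictions of $\psi$ to atoms located in $B$, resp. outside $B$, and $x\in\varphi$ also denotes the location of an atom. Processes. $\Phi=\{(X_i,M_i)\}_i$ is a given stationary random element of $\mathbb N_{\mathbb M}$ with intensity $\lambda=\mathbb E[\Phi([0,1]^d\times\mathbb M)]\in(0,\infty)$. $\mathcal T(\Phi)$ is the set of (laws of) stationary markings of $\Phi$: stationary random elements $\Psi=\{(X_i,M_i,M_i')\}_i$ of $\mathbb N_{\mathbb M\times\mathbb M'}$, possibly on a new probability space, such that $\pi(\Psi)$ has the law of $\Phi$ (one then re-defines $\Phi:=\pi(\Psi)$). $\mathbb P^0,\mathbb E^0$ denote Palm probability and expectation with respect to the points $X_i$; under it there is a point $X_0=o$. Scores. The score function $\xi$ is a measurable map from $\mathbb N^0_{\mathbb M\times\mathbb M'}$ either to $[0,\infty)\cup\{-\infty\}$ or to $[-\infty,0]$. A marking $\psi=\{(x_i,m_i,m'_i)\}$ is admissible if $\xi(S_{x_i}\psi)\ne-\infty$ for all $i$; $\mathcal T_{\mathsf{adm}}(\Phi)$ is the set of $\Psi\in\mathcal T(\Phi)$ that are almost surely admissible. The $\xi$-intensity is $\gamma_\xi(\Psi)=\mathbb E[\sum_{X_i\in\Psi\cap[0,1]^d}\xi(S_{X_i}\Psi)]=\lambda\mathbb E^0[\xi(\Psi)]$ (equal to $-\infty$ if scores taking values in $[0,\infty)\cup\{-\infty\}$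 equal $-\infty$ with positive Palm probability), $\gamma_{\xi,\mathsf{opt}}=\sup_{\Psi\in\mathcal T(\Phi)}\gamma_\xi(\Psi)$, and $\Psi\in\mathcal T(\Phi)$ is intensity-optimal if $\gamma_\xi(\Psi)=\gamma_{\xi,\mathsf{opt}}$. Local optimality. For markings $\psi,\psi'$ of the same $\varphi$ and $x\in\varphi$ put $\psi'\Delta_{\xi,x}\psi=\xi(S_x\psi')-\xi(S_x\psi)$, with the convention that there is no score difference ($-\infty-(-\infty)=0$) when both scores are $-\infty$, and $\psi'\Delta_\xi\psi=\sum_{x\in\varphi}\psi'\Delta_{\xi,x}\psi$, which is well defined when $\sum_{x\in\varphi}(\psi'\Delta_{\xi,x}\psi)_+<\infty$, $(a)_+=\max(0,a)$. A marking $\psi$ is locally optimal if $\psi'\Delta_\xi\psi\le0$ for every marking $\psi'$ with $\pi(\psi')=\pi(\psi)$, $\#(\psi'\setminus\psi)<\infty$ and $\sum_{x\in\pi(\psi)}(\psi'\Delta_{\xi,x}\psi)_+<\infty$. A stationary marking is locally optimal if this holds almost surely. Stabilization. $Q_r=[-r/2,r/2]^d$. A family of internally and externally stabilizing radii consists of measurable $R^\varepsilon:\mathbb N^0_{\mathbb M\times\mathbb M'}\to[0,\infty)$, $\varepsilon>0$, such that for $\mathbb P^0$-almost every realization $\varphi$ of $\Phi$: for any marking $\psi$ of $\varphi$, $R^\varepsilon(\psi)<\infty$ and $R^\varepsilon(\psi)$ depends only on $\varphi$ and the mark $m_0'\in\mathbb M'$ of $o$; (internal) $|\xi(\psi)-\xi(\psi')|\le\varepsilon$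 for any two markings $\psi,\psi'$ of $\varphi$ with $\psi\cap Q_{R^\varepsilon(\psi)}=\psi'\cap Q_{R^\varepsilon(\psi)}$; (external) $\sum_{x_i\in\varphi,\,x_i\in\mathbb R^d\setminus Q_{R^\varepsilon(\psi)}}|\psi'\Delta_{\xi,x_i}\psi|\le\varepsilon$ for every two markings $\psi,\psi'$ of $\varphi$ with $\psi\setminus\{o\}=\psi'\setminus\{o\}$. For $\Psi\in\mathcal T(\Phi)$, $R_0^\varepsilon=R^\varepsilon(\Psi)$ under the Palm probability of $\Psi$. Neutral mark. $m_o'\in\mathbb M'$ is a neutral mark if, whenever $\psi=\{(x_i,m_i,m_i')\}_i$ is a marking of $\varphi=\{(x_i,m_i)\}_i$ and $\psi^*$ is obtained from $\psi$ by replacing some $m_i'$ by $m_o'$, one has $\xi(S_{x_i}\psi^* )\ge0$ and $\psi^*\Delta_{\xi,x_j}\psi\ge0$ for every $j\ne i$. Majorants. A measurable $\overline\xi:\mathbb N^0_{\mathbb M}\to[0,\infty)$ is an integrable majorant of $\xi$ if $\mathbb E^0[\overline\xi(\Phi)]<\infty$ and, for $\mathbb P^0$-almost all $\varphi$, $|\xi(\psi)|\le\overline\xi(\varphi)$ for every admissible marking $\psi$ of $\varphi$. A measurable $\overline\xi:\mathbb N^0_{\mathbb M}\to[0,\infty)$ is a score difference majorant if for $\mathbb P$-almost every realization $\varphi$ of $\Phi$, $|\psi\,\Delta_{\xi,x_i}((\psi\cap B)\cup(\psi'\setminus B))|\le\overline\xi(S_{x_i}\varphi)$ for any two admissible markings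 $\psi,\psi'$ of $\varphi$, any Borel set $B\subset\mathbb R^d$ and any $x_i\in\varphi\cap B$ (in particular, $(\psi\cap B)\cup(\psi'\setminus B)$ is then admissible). $\mathbb E^0[\overline\xi^{\,p}]$ means $\mathbb E^0[\overline\xi(\Phi)^p]$. *)

(* Defs.v *)
From HB Require Import structures.
From mathcomp Require Import all_boot all_order all_algebra.
From mathcomp Require Import all_classical all_reals all_analysis.
From mathcomp Require Import measurable_realfun.

Set Implicit Arguments.
Unset Strict Implicit.
Unset Printing Implicit Defensive.

Import Order.TTheory GRing.Theory Num.Theory.
Import numFieldNormedType.Exports.

Local Open Scope classical_set_scope.
Local Open Scope ring_scope.

Section Configurations.
Context (R : realType) (d : nat).

(* Local finiteness is meant with respect to the locations: a bounded set of
   locations carries finitely many atoms, whatever their marks.  This makes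
   forgetting a mark component well defined when that component ranges over a
   non-compact space. *)
Record config (K : topologicalType) := Config {
  atoms : set ('rV[R]_d * K) ;
  config_locfin : forall B : set 'rV[R]_d,
    bounded_set B -> finite_set (atoms `&` fst @^-1` B) ;
  config_ground : forall x k k', atoms (x, k) -> atoms (x, k') -> k = k' }.

Definition config0 (K : topologicalType) : config K.
Proof. by exists set0 => [B _|//]; rewrite set0I. Defined.

HB.instance Definition _ (K : topologicalType) := gen_eqMixin (config K).
HB.instance Definition _ (K : topologicalType) := gen_choiceMixin (config K).
HB.instance Definition _ (K : topologicalType) :=
  isPointed.Build (config K) (config0 K).

(* The sets {psi | psi(B) = n}, B Borel; they generate the sigma-algebra of the
   evaluation maps psi |-> psi(B) with values in {0, 1, ..., +oo}. *)
Definition evaluation_sets (K : topologicalType) : set (set (config K)) :=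
  [set A | exists (B : set ('rV[R]_d * K)) (n : nat),
     <<s @open ('rV[R]_d * K)%type >> B /\
     A = [set psi | (atoms psi `&` B #= `I_n)%card] ].

HB.instance Definition _ (K : topologicalType) :=
  @isMeasurable.Build (sigma_display (@evaluation_sets K)) (config K)
    <<s @evaluation_sets K >>
    (@sigma_algebra0 _ setT (@evaluation_sets K))
    (@sigma_algebraC _ (@evaluation_sets K))
    (@sigma_algebra_bigcup _ setT (@evaluation_sets K)).

Definition locations (K : topologicalType) (psi : config K) : set 'rV[R]_d :=
  fst @` atoms psi.

Definition restriction (K : topologicalType) (psi : config K)
    (B : set 'rV[R]_d) : set ('rV[R]_d * K) :=
  atoms psi `&` fst @^-1` B.

(* Maps on N^0 are represented by maps on all configurations; only their values
   on this set are ever used. *)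
Definition configs_at0 (K : topologicalType) : set (config K) :=
  [set psi | (restriction psi [set 0%R] #= `I_1)%card].

Lemma bounded_set_shift (y : 'rV[R]_d) (B : set 'rV[R]_d) :
  bounded_set B -> bounded_set ((fun x => x - y) @^-1` B).
Proof.
move=> [r [r_real Br]]; exists (r + `|y|); split; first exact: num_real.
move=> N rN x /= Bx; rewrite -[x in `|x|](subrK y).
rewrite (le_trans (ler_normD _ _))// -lerBrDr.
by apply: Br Bx; rewrite ltrBrDr.
Qed.

Definition shift (K : topologicalType) (y : 'rV[R]_d) (psi : config K) :
  config K.
Proof.
exists ((fun a => (a.1 - y, a.2)) @` atoms psi).
- move=> B bB.
  have bB' : bounded_set ((fun x => x - y) @^-1` B).
    exact: bounded_set_shift.
  apply: sub_finite_set (finite_image (fun a => (a.1 - y, a.2))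
    (config_locfin psi bB')).
  by move=> _ [[[x k] /= xk <-] /= Bx]; exists (x, k).
- move=> x k k' [[z l] zl [<- <-]] [[z' l'] zl' [/addIr zz' <-]].
  by apply: (config_ground zl); rewrite -zz'.
Defined.

Definition splice (K : topologicalType) (B : set 'rV[R]_d)
  (psi psi' : config K) : config K.
Proof.
exists (restriction psi B `|` restriction psi' (~` B)).
- move=> C bC; rewrite setIUl finite_setU; split.
    by apply: sub_finite_set (config_locfin psi bC) => a [[]].
  by apply: sub_finite_set (config_locfin psi' bC) => a [[]].
- move=> x k k' [[xk Bx]|[xk Bx]] [[xk' Bx']|[xk' Bx']] //.
    exact: config_ground xk xk'.
  exact: config_ground xk xk'.
Defined.

Definition forget (M M' : topologicalType) (psi : config (M * M')%type) :
  config M.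
Proof.
exists ((fun a => (a.1, a.2.1)) @` atoms psi).
- move=> B bB.
  apply: sub_finite_set (finite_image (fun a => (a.1, a.2.1))
    (config_locfin psi bB)).
  by move=> _ [[[x k] /= xk <-] /= Bx]; exists (x, k).
- move=> x k k' [[z l] zl [/= zx <-]] [[z' l'] zl' [/= zx' <-]].
  by subst z z'; rewrite (config_ground zl zl').
Defined.

Definition marking (M M' : topologicalType) (phi : config M)
    (psi : config (M * M')%type) : Prop :=
  forget psi = phi.

End Configurations.

Arguments config R d K : clear implicits.
Arguments configs_at0 {R d K}.

Section Cubes.
Context (R : realType) (d : nat).

Definition unit_cube : set 'rV[R]_d :=
  [set x | forall i, 0 <= x ord0 i <= 1].

Definition cube (r : R) : set 'rV[R]_d :=
  [set x | forall i, - (r / 2) <= x ord0 i <= r / 2].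

End Cubes.

Section Palm.
Context (R : realType) (d : nat) (K : topologicalType).
Local Open Scope ereal_scope.

Implicit Type mu : probability (config R d K) R.

Definition stationary mu : Prop :=
  forall (y : 'rV[R]_d) (A : set (config R d K)), measurable A ->
    pushforward mu (shift y) A = mu A.

Definition intensity mu : \bar R :=
  \int[mu]_psi counting (restriction psi (@unit_cube R d)).

(* The sum ranges over a finite set, by local finiteness. *)
Definition point_sum (f : config R d K -> \bar R) (psi : config R d K) :
    \bar R :=
  \sum_(x \in locations psi `&` @unit_cube R d) f (shift x psi).

(* Palm expectation of a stationary law through the refined Campbell formula,
   E^0[f] = lambda^-1 E[sum_{X_i in [0,1]^d} f(S_{X_i} Phi)]; palm is the
   corresponding set function P^0. *)
Definition palm_expectation mu (f : config R d K -> \bar R) : \bar R :=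
  ((fine (intensity mu))^-1)%:E * \int[mu]_psi point_sum f psi.

Definition palm mu (A : set (config R d K)) : \bar R :=
  palm_expectation mu (fun psi => (\1_A psi)%:E).

End Palm.

Section Scores.
Context (R : realType) (d : nat) (M M' : topologicalType).
Local Open Scope ereal_scope.

Local Notation NM := (config R d M).
Local Notation NMM := (config R d (M * M')%type).

Implicit Types (xi : NMM -> \bar R) (psi : NMM) (phi : NM).

(* The difference a - b, with (-oo) - (-oo) = 0. *)
Definition score_sub (a b : \bar R) : \bar R :=
  if (a == -oo) && (b == -oo) then 0 else a - b.

Definition score_diff xi (x : 'rV[R]_d) (psi' psi : NMM) : \bar R :=
  score_sub (xi (shift x psi')) (xi (shift x psi)).

Definition diff_pos xi (psi' psi : NMM) : \bar R :=
  \esum_(x in locations psi) Order.max 0 (score_diff xi x psi' psi).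

Definition diff_neg xi (psi' psi : NMM) : \bar R :=
  \esum_(x in locations psi) Order.max 0 (- score_diff xi x psi' psi).

(* Only used when diff_pos is finite. *)
Definition total_diff xi (psi' psi : NMM) : \bar R :=
  diff_pos xi psi' psi - diff_neg xi psi' psi.

Definition nonneg_or_ninfty_score xi : Prop :=
  forall psi, configs_at0 psi -> xi psi = -oo \/ 0 <= xi psi < +oo.

Definition nonpos_score xi : Prop :=
  forall psi, configs_at0 psi -> xi psi <= 0.

Definition admissible xi psi : Prop :=
  forall x, locations psi x -> xi (shift x psi) <> -oo.

Definition locally_optimal xi psi : Prop :=
  forall psi', forget psi' = forget psi ->
    finite_set (atoms psi' `\` atoms psi) ->
    diff_pos xi psi' psi < +oo ->
    total_diff xi psi' psi <= 0.

Definition neutral_mark xi (mo : M') : Prop :=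
  forall psi psi' x m m',
    atoms psi (x, (m, m')) ->
    atoms psi' = (x, (m, mo)) |` (atoms psi `\ (x, (m, m'))) ->
    0 <= xi (shift x psi') /\
    (forall y, locations psi y -> y <> x -> 0 <= score_diff xi y psi' psi).

(* mu is the law of Phi in the definitions below. *)
Implicit Type mu : probability NM R.

Definition stabilizing_radii mu xi (Rad : R -> NMM -> R) : Prop :=
  forall eps : R, (0 < eps)%R ->
  [/\ measurable_fun (@configs_at0 R d (M * M')%type) (Rad eps),
      (forall psi, configs_at0 psi -> (0 <= Rad eps psi)%R) &
      {ae palm mu, forall phi,
        [/\ (forall psi psi', marking phi psi -> marking phi psi' ->
               restriction psi [set 0%R] = restriction psi' [set 0%R] ->
               Rad eps psi = Rad eps psi'),
            (forall psi psi', marking phi psi -> marking phi psi' ->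
               restriction psi (cube (Rad eps psi)) =
                 restriction psi' (cube (Rad eps psi)) ->
               `|score_sub (xi psi) (xi psi')| <= eps%:E) &
            (forall psi psi', marking phi psi -> marking phi psi' ->
               restriction psi (~` [set 0%R]) =
                 restriction psi' (~` [set 0%R]) ->
               \esum_(x in locations phi `\` cube (Rad eps psi))
                 `|score_diff xi x psi' psi| <= eps%:E)]}].

Definition majorant_function (xib : NM -> R) : Prop :=
  measurable_fun (@configs_at0 R d M) xib /\
  (forall phi, configs_at0 phi -> (0 <= xib phi)%R).

Definition integrable_majorant mu xi (xib : NM -> R) : Prop :=
  [/\ majorant_function xib,
      palm_expectation mu (fun phi => (xib phi)%:E) < +oo &
      {ae palm mu, forall phi, forall psi,
         marking phi psi -> admissible xi psi -> `|xi psi| <= (xib phi)%:E}].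

Definition score_difference_majorant mu xi (xib : NM -> R) : Prop :=
  majorant_function xib /\
  {ae mu, forall phi, forall psi psi' (B : set 'rV[R]_d) x,
     marking phi psi -> marking phi psi' ->
     admissible xi psi -> admissible xi psi' ->
     <<s @open 'rV[R]_d >> B -> (locations phi `&` B) x ->
     `|score_diff xi x psi (splice B psi psi')| <= (xib (shift x phi))%:E}.

(* Laws of the stationary markings of a process with law mu. *)
Definition stationary_markings mu : set (probability NMM R) :=
  [set Q | stationary Q /\
     (forall A : set NM, measurable A ->
        pushforward Q (@forget R d M M') A = mu A)].

Definition admissible_markings mu xi : set (probability NMM R) :=
  [set Q | stationary_markings mu Q /\
     {ae Q, forall psi, admissible xi psi}].

(* For scores in [0, +oo) or -oo, the integral is -oo as soon as the score is
   -oo with positive Palm probability, because +oo - +oo = -oo in \bar R. *)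
Definition xi_intensity xi (Q : probability NMM R) : \bar R :=
  \int[Q]_psi point_sum xi psi.

Definition optimal_intensity mu xi : \bar R :=
  ereal_sup [set xi_intensity xi Q | Q in stationary_markings mu].

Definition intensity_optimal mu xi (Q : probability NMM R) : Prop :=
  stationary_markings mu Q /\ xi_intensity xi Q = optimal_intensity mu xi.

End Scores.

(* Main.v *)
(** Compare a locally optimal marking [psi] with an admissible marking [psi'] of
the same [phi] through a competitor that agrees with [psi'] on a large cube and
with [psi] outside a slightly larger one. If all stabilization radii in the
larger cube are at most twice the width [k] of the transition layer, local
optimality bounds the total score of [psi'] over the inner cube by that of [psi]
over the outer cube, up to [2 eps] per point and a contribution of the layer. That
contribution can be dropped when the competitor has neutral marks in the layer,
and is bounded by the score difference majorant when scores are nonpositive.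

The two stationary markings need not be coupled: if [f psi' <= g psi] whenever
[psi] and [psi'] have the same base configuration, then [E f <= E g], because an
event of markings is, up to a null set, contained in the preimage of a measurable
event of base configurations included in its projection. Integrating the
deterministic bound, truncating the score of each unit cell at [t], and estimating the event of a large
radius by Markov's inequality with the moment of order [d p / (p - 1) > d], one
divides by the volume of the inner cube of side [j k] and lets [k], then [j], then
[1 / eps], then [t] tend to infinity. *)

From Pilot Require Import Defs.
From HB Require Import structures.
From mathcomp Require Import all_boot all_order all_algebra finmap.
From mathcomp Require Import all_classical all_reals all_analysis.
From mathcomp Require Import measurable_realfun zify ring lra.

Set Implicit Arguments.
Unset Strict Implicit.
Unset Printing Implicit Defensive.

Import Order.TTheory GRing.Theory Num.Theory.
Import numFieldNormedType.Exports.

Local Open Scope classical_set_scope.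
Local Open Scope ring_scope.

(* MathComp's own [shift] would otherwise take precedence. *)
Local Notation shift := Pilot.Defs.shift.

(** Two obstacles shape the proof. Changing marks in a cube alters the scores of infinitely many
    points, whereas external stabilization controls the effect of one mark only. The cube is
    therefore modified point by point at a cost of [eps] each, which works because the radius at a
    point depends on its own mark alone, once the base configuration is fixed. The second obstacle
    is to compare two laws that share only their base process. Marks are coded by countably many
    bits, so that the fibres of the projection lie in a compact code space; projections of countable
    intersections of cylinder events are then measurable, and inner regularity extends this to
    general events up to null sets. Constants: cubes are centred, so a radius of at most [2 * k]
    reaches at distance at most [k]. Two gaps of width [k] on each side separate the inner from the
    outer cube, whence the volume ratio [(1 + 4 / j) ^+ d]. Truncation bounds the loss on the event
    of a large radius by a multiple of its probability; per unit volume it is of order [k] to the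
    power [- d / (p - 1)]. *)

Lemma dynkin_class (T : Type) (G P : set_system T) :
  setI_closed G -> P setT -> G `<=` P ->
  (forall S, <<s G >> S -> P S -> P (~` S)) ->
  (forall F : (set T)^nat, (forall n, <<s G >> (F n)) -> trivIset setT F ->
    (forall n, P (F n)) -> P (\bigcup_k F k)) ->
  <<s G >> `<=` P.
Proof.
move=> GI PT GP PC PU.
suff: <<s G >> `<=` [set A | <<s G >> A /\ P A] by move=> sub A /sub[].
have [s0 sC sU] := smallest_sigma_algebra setT G.
apply: lambda_system_subset => //.
- apply/dynkin_lambda_system; split.
  + by split => //; have := sC _ s0; rewrite setD0.
  + by move=> B [sB PB]; split; [have := sC _ sB; rewrite setTD | exact: PC].
  + move=> F tF FP; split; first by apply: sU => n; case: (FP n).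
    by apply: PU => // n; case: (FP n).
- by move=> B GB; split; [exact: sub_gen_smallest | exact: GP].
Qed.

Lemma sigma_algebra_setC (T : Type) (G : set_system T) (A : set T) :
  <<s G >> A -> <<s G >> (~` A).
Proof. by move=> GA; case: (smallest_sigma_algebra setT G) => _ /(_ A GA); rewrite setTD. Qed.

Lemma sigma_algebra_setI (T : Type) (G : set_system T) (A B : set T) :
  <<s G >> A -> <<s G >> B -> <<s G >> (A `&` B).
Proof.
move=> GA GB; rewrite -(setCK (A `&` B)) setCI; apply: sigma_algebra_setC.
rewrite -bigcup2E; case: (smallest_sigma_algebra setT G) => s0 _; apply => -[|[|n]] //=;
  exact: sigma_algebra_setC.
Qed.

(** * Counting atoms, and measurability of configuration-valued maps *)

Section Cardinality.
Context {R : realType}.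
Local Open Scope ereal_scope.

(** Cardinality as a sum, so that additivity over countable partitions is that of [esum]. *)
Definition card_sum {T : choiceType} (A : set T) : \bar R := \esum_(a in A) 1.

Lemma card_sum_ge0 (T : choiceType) (A : set T) : 0 <= card_sum A.
Proof. exact: esum_ge0. Qed.

Lemma card_sum_fset (T : choiceType) (A : set T) : finite_set A ->
  card_sum A = (#|` fset_set A|)%:R%:E.
Proof.
move=> fA; rewrite /card_sum esum_fset// fsbig_finite//=.
by rewrite sumEFin big_const_seq count_predT iter_addr_0.
Qed.

Lemma card_sum_fin_num (T : choiceType) (A : set T) : finite_set A ->
  card_sum A \is a fin_num.
Proof. by move=> /card_sum_fset ->. Qed.

Lemma card_sumP (T : choiceType) (A : set T) (n : nat) : finite_set A ->
  (card_sum A = n%:R%:E) <-> (A #= `I_n)%card.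
Proof.
move=> fA; rewrite card_sum_fset//; split => [[/eqP]|/card_fset_set -> //].
rewrite eqr_nat => /eqP <-; rewrite -{1}(fset_setK fA).
exact/card_eq_fsetP.
Qed.

Lemma card_sumID (T : choiceType) (A B : set T) :
  card_sum A = card_sum (A `&` B) + card_sum (A `&` ~` B).
Proof. by rewrite /card_sum (esumID B). Qed.

Lemma card_sum_subset (T : choiceType) (A B : set T) : A `<=` B ->
  card_sum A <= card_sum B.
Proof.
by move=> AB; rewrite (card_sumID B A) setIidr// leeDl// card_sum_ge0.
Qed.

Lemma card_sum_bigcup (T : choiceType) (F : (set T)^nat) : trivIset setT F ->
  card_sum (\bigcup_n F n) = \sum_(0 <= n <oo) card_sum (F n).
Proof. by move=> tF; rewrite /card_sum nneseries_sum_bigcup. Qed.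

Lemma card_sum_image (T U : choiceType) (f : T -> U) (A : set T) :
  set_inj A f -> card_sum (f @` A) = card_sum A.
Proof. by move=> fA; rewrite /card_sum esum_image. Qed.

Lemma card_sum_gt0 (T : choiceType) (A : set T) : finite_set A ->
  1 <= card_sum A <-> A !=set0.
Proof.
move=> fA; rewrite card_sum_fset// lee_fin ler1n cardfs_gt0; split.
  by move=> /fset0Pn[x]; rewrite in_fset_set// inE; exists x.
by move=> [x Ax]; apply/fset0Pn; exists x; rewrite in_fset_set// inE.
Qed.

Lemma measurable_fun_nat_valued d (T : measurableType d) (g : T -> \bar R) :
  (forall t, exists n : nat, g t = n%:R%:E) ->
  (forall n : nat, measurable [set t | g t = n%:R%:E]) ->
  measurable_fun setT g.
Proof.
move=> gn mg _ Y mY; rewrite setTI.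
have -> : g @^-1` Y = \bigcup_n (if `[< Y n%:R%:E >] then [set t | g t = n%:R%:E] else set0).
  apply/seteqP; split => [t Yt|t [n _]].
    have [n gt] := gn t; exists n => //; case: asboolP => //.
    by rewrite -gt.
  by case: asboolP => // Yn gt; rewrite /= gt.
by apply: bigcupT_measurable => n; case: ifP.
Qed.

End Cardinality.

Lemma config_ext (R : realType) (d : nat) (K : topologicalType)
  (psi psi' : config R d K) : atoms psi = atoms psi' -> psi = psi'.
Proof.
case: psi psi' => [A lA gA] [B lB gB] /= AB; subst B.
by rewrite (Prop_irrelevance lA lB) (Prop_irrelevance gA gB).
Qed.

Lemma open_setX (T U : topologicalType) (A : set T) (B : set U) :
  open A -> open B -> open (A `*` B).
Proof.
move=> oA oB; have -> : A `*` B = fst @^-1` A `&` snd @^-1` B by [].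
by apply: openI; apply: open_comp => // -[x y] _; [exact: cvg_fst|exact: cvg_snd].
Qed.

Section Window.
Context {R : realType} {d : nat}.
Local Notation V := 'rV[R]_d.

Definition window (N : nat) : set V := [set x | `|x| < N%:R].

Lemma window_bounded N : bounded_set (window N).
Proof.
exists N%:R; split; first exact: num_real.
by move=> M NM x /= xN; rewrite (le_trans (ltW xN)) ?ltW.
Qed.

Lemma windowE N : window N = ball (0 : V) N%:R.
Proof. by apply/seteqP; split => x; rewrite -ball_normE /window /= sub0r normrN. Qed.

Lemma open_window N : open (window N).
Proof. by rewrite windowE; exact: ball_open. Qed.

Lemma window_exists x : exists N, window N x.
Proof. by exists (Num.trunc `|x|).+1; rewrite /window /= truncnS_gt. Qed.

Lemma window_mono M N : (M <= N)%N -> window M `<=` window N.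
Proof. by move=> MN x /= xM; rewrite /window /= (lt_le_trans xM)// ler_nat. Qed.

End Window.

Section Measurability.
Context {R : realType} {d : nat}.
Local Notation V := 'rV[R]_d.

(** Cutting off by a bounded window makes every count finite, so that complements can be treated by
    subtraction. *)
Definition windowed {K : topologicalType} (N : nat) (B : set (V * K)) :=
  B `&` (window N `*` setT).

Lemma finite_windowed (K : topologicalType) (psi : config R d K) N B :
  finite_set (atoms psi `&` windowed N B).
Proof.
apply: sub_finite_set (config_locfin psi (window_bounded N)).
by move=> a [pa [_ [wa _]]].
Qed.

Lemma open_windowed (K : topologicalType) N (B : set (V * K)) :
  open B -> open (windowed N B).
Proof.
move=> oB; apply: openI => //; apply: open_setX; [exact: open_window|exact: openT].
Qed.

Local Open Scope ereal_scope.

Definition count {K : topologicalType} (psi : config R d K) N (B : set (V * K))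
  : \bar R := card_sum (atoms psi `&` windowed N B).

Lemma count_nat (K : topologicalType) (psi : config R d K) N B :
  exists n : nat, count psi N B = n%:R%:E.
Proof. by eexists; rewrite /count card_sum_fset//; exact: finite_windowed. Qed.

Lemma measurable_count (K : topologicalType) N (B : set (V * K)) :
  <<s open >> B -> measurable_fun setT (fun psi : config R d K => count psi N B).
Proof.
move=> mB; apply: measurable_fun_nat_valued => [psi|n]; first exact: count_nat.
apply: sub_gen_smallest; exists (windowed N B), n; split.
  apply: sigma_algebra_setI => //; apply: sub_gen_smallest.
  by apply: open_setX; [exact: open_window|exact: openT].
apply/seteqP; split => psi; first by move=> /(card_sumP n (finite_windowed _ _ _)).
by move=> /(card_sumP (R := R) n (finite_windowed _ _ _)).
Qed.

(** Dynkin's argument passes from open to Borel sets for windowed counts, which are finite; the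
    evaluation sets are then recovered by letting the window grow. *)
Lemma measurable_config_fun disp (T : measurableType disp) (K : topologicalType)
  (f : T -> config R d K) :
  (forall N U, open U -> measurable_fun setT (fun t => count (f t) N U)) ->
  measurable_fun setT f.
Proof.
move=> mf.
have mfB N (B : set (V * K)) : <<s open >> B ->
    measurable_fun setT (fun t => count (f t) N B).
  apply: (@dynkin_class _ _ (fun B => measurable_fun setT (fun t => count (f t) N B))).
  - exact: openI.
  - by apply: mf; exact: openT.
  - by move=> U; exact: mf.
  - move=> S _ mS.
    have -> : (fun t => count (f t) N (~` S)) =
              (fun t => count (f t) N setT - count (f t) N S).
      apply/funext => t; rewrite {2}/count (card_sumID _ S).
      have -> : atoms (f t) `&` windowed N setT `&` S = atoms (f t) `&` windowed N S.
        by rewrite /windowed setTI -setIA (setIC _ S).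
      have -> : atoms (f t) `&` windowed N setT `&` ~` S = atoms (f t) `&` windowed N (~` S).
        by rewrite /windowed setTI -setIA (setIC _ (~` S)).
      by rewrite addeAC subee ?add0e//; apply: card_sum_fin_num; exact: finite_windowed.
    by apply: emeasurable_funB => //; apply: mf; exact: openT.
  - move=> F _ tF mF.
    have -> : (fun t => count (f t) N (\bigcup_k F k)) =
              (fun t => \sum_(0 <= k <oo) count (f t) N (F k)).
      apply/funext => t; rewrite /count -card_sum_bigcup.
        by rewrite /windowed setI_bigcupl setI_bigcupr.
      apply: trivIset_setIl; apply: trivIset_setIr => //.
    by apply: ge0_emeasurable_sum => // k *; exact: card_sum_ge0.
apply: (@measurability _ _ _ _ _ _ (evaluation_sets (K := K))) => //.
move=> _ [_ [B [n [mB ->]] <-]]; rewrite setTI.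
(* The total count is [n] exactly when the windowed counts are eventually equal to [n]. *)
rewrite [X in measurable X](_ : _ = \bigcup_N0 \bigcap_(N in [set N | (N0 <= N)%N])
    [set t | count (f t) N B = n%:R%:E]); last first.
  apply/seteqP; split => t /=.
  - move=> /= An; have fA : finite_set (atoms (f t) `&` B).
      by apply/finite_setP; exists n.
    have [N0 AN0] : exists N0, atoms (f t) `&` B `<=` window N0 `*` setT.
      move: fA => /finite_fsetP[X ->].
      exists (\max_(x <- X) xget 0%N [set N | window N x.1])%N => x /= xX; split => //.
      have wx := xgetPex 0%N (window_exists x.1).
      by apply: window_mono wx; rewrite (big_rem x)//= leq_maxl.
    exists N0 => // N /= N0N; apply/card_sumP; first exact: finite_windowed.
    rewrite /windowed setIA setIidl// => x /AN0[wx _]; split => //.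
    exact: window_mono wx.
  - move=> [N0 _ AN].
    (* An atom of [B] beyond the window [N0] would raise the count in some larger window. *)
    suff <- : atoms (f t) `&` windowed N0 B = atoms (f t) `&` B.
      by have /(card_sumP (R := R) n (finite_windowed _ _ _)) := AN N0 (leqnn N0).
    apply/seteqP; split => [x [fx [Bx _]]//|x [fx Bx]].
    have [N wx] := window_exists x.1.
    pose N1 := maxn N0 N.
    have sub : atoms (f t) `&` windowed N0 B `<=` atoms (f t) `&` windowed N1 B.
      move=> y [fy [By [wy _]]]; do !split => //=.
      by apply: window_mono wy; exact: leq_maxl.
    have := AN N1 (leq_maxl _ _); have := AN N0 (leqnn _); rewrite /= /count.
    rewrite !card_sum_fset; do ?exact: finite_windowed.
    move=> <- [/eqP]; rewrite eqr_nat => /eqP eqc.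
    have : fset_set (atoms (f t) `&` windowed N0 B) = fset_set (atoms (f t) `&` windowed N1 B).
      apply/eqP; rewrite eqEfcard eqc leqnn andbT.
      by rewrite -fset_set_sub//; exact: finite_windowed.
    move=> /(congr1 (fun X => [set` X])); rewrite !fset_setK; do ?exact: finite_windowed.
    move=> eqA; suff: (atoms (f t) `&` windowed N0 B) x by [].
    by rewrite eqA; do !split => //=; apply: window_mono wx; exact: leq_maxr.
apply: bigcupT_measurable => N0; apply: bigcap_measurable; first by exists N0 => /=.
move=> N _; rewrite -[X in measurable X]setTI.
exact: (mfB N B mB measurableT [set n%:R%:E] (emeasurable_set1 _)).
Qed.

End Measurability.

(** * Comparison of expectations along a projection *)

Section CompactFibers.
Context {dY : measure_display} {Y : measurableType dY} {J : choiceType}.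
Local Notation code := (J -> bool).

Definition finitely_decided (S : set (Y * code)) : Prop := exists s : seq J,
  (forall y c c', {in s, c =1 c'} -> S (y, c) -> S (y, c')) /\
  (forall c, measurable [set y | S (y, c)]).

Lemma finitely_decidedC S : finitely_decided S -> finitely_decided (~` S).
Proof.
move=> [s [Ss mS]]; exists s; split => [y c c' cc' nS /= Sc'|c].
  by apply/nS/(Ss _ c') => // i si; rewrite cc'.
by have := measurableC (mS c).
Qed.

Lemma finitely_decidedI S S' :
  finitely_decided S -> finitely_decided S' -> finitely_decided (S `&` S').
Proof.
move=> [s [Ss mS]] [s' [Ss' mS']]; exists (s ++ s'); split => [y c c' cc' []|c].
  move=> Sc Sc'; split; [apply: Ss Sc|apply: Ss' Sc'] => i si; apply: cc';
  by rewrite mem_cat si ?orbT.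
exact: measurableI (mS c) (mS' c).
Qed.

Lemma finitely_decidedU S S' :
  finitely_decided S -> finitely_decided S' -> finitely_decided (S `|` S').
Proof.
move=> hS hS'; rewrite -(setCK (S `|` S')) setCU; apply/finitely_decidedC.
by apply: finitely_decidedI; exact: finitely_decidedC.
Qed.

Lemma finitely_decidedT : finitely_decided setT.
Proof. by exists [::]; split => // c; exact: measurableT. Qed.

Lemma finitely_decided_bit i : finitely_decided [set p : Y * code | p.2 i].
Proof.
exists [:: i]; split => [y c c' cc' /=|c].
  by rewrite cc' ?mem_head.
case: (boolP (c i)) => ci.
  by rewrite (_ : mkset _ = setT)//; apply/seteqP; split.
by rewrite (_ : mkset _ = set0)//; apply/seteqP; split => // y /=; rewrite (negbTE ci).
Qed.

Lemma finitely_decided_base A : measurable A ->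
  finitely_decided [set p : Y * code | A p.1].
Proof. by move=> mA; exists [::]; split => [y c c' _ //|c]. Qed.

Lemma measurable_proj_finitely_decided S : finitely_decided S ->
  measurable [set y | exists c, S (y, c)].
Proof.
move=> [s [Ss mS]].
rewrite (_ : mkset _ = \bigcup_(t : (size s).-tuple bool)
  [set y | S (y, fun i => nth false t (index i s))]).
  by apply: fin_bigcup_measurable => // t _; exact: mS.
apply/seteqP; split => [y [c Sc]|y [t _ Sy]]; last by eexists; exact: Sy.
exists (map_tuple c (in_tuple s)) => //=; apply: Ss Sc => i si /=.
by rewrite (nth_map i) ?nth_index// index_mem.
Qed.

(* Compactness of the code space: this is what makes projections of countable
   intersections measurable. *)
Lemma finitely_decided_compact (S : nat -> set (Y * code)) y :
  (forall n, finitely_decided (S n)) -> (forall n, S n.+1 `<=` S n) ->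
  (forall n, exists c, S n (y, c)) -> exists c, forall n, S n (y, c).
Proof.
move=> fS dS /choice[f Sf].
have dS' m n : (m <= n)%N -> S n `<=` S m.
  by move=> /subnKC <-; elim: (n - m)%N => [|k IH]; rewrite ?addn0// addnS => p /dS/IH.
(* The bitwise limit of the codes [f m] along an ultrafilter finer than [\oo]: on the finitely many
   bits that decide [S n] it agrees with some [f m] such that [n <= m]. *)
have [U [UU oU]] := ultraFilterLemma (eventually_filter).
exists (fun i => `[< U [set m | f m i] >]) => n.
have [s [Ss _]] := fS n.
have : U (\bigcap_(i in [set` s]) [set m | f m i = `[< U [set m | f m i] >]]).
  have : finite_set [set` s] by exact: finite_seq.
  move=> /finite_fsetP[X ->].
  apply: filter_bigI => i _.
  case: asboolP => [Ui|nUi]; first by apply: filterS Ui.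
  have [//|] := in_ultra_setVsetC [set m | f m i] UU.
  by apply: filterS => m /= /negP/negbTE.
have Un : U [set m | (n <= m)%N] by apply: oU; exists n.
move=> /(filterI Un)/filter_ex[m [nm fm]].
by apply: (Ss _ (f m)) => [i si|]; [exact: fm|exact: dS' (Sf m)].
Qed.

(** The compact class used for inner approximation. The sequence is decreasing so that compactness
    of the code space applies fibre by fibre. *)
Definition decided_delta (K : set (Y * code)) : Prop :=
  exists S : nat -> set (Y * code), [/\ forall n, finitely_decided (S n),
    forall n, S n.+1 `<=` S n & K = \bigcap_n S n].

Lemma decided_delta_finitely S : finitely_decided S -> decided_delta S.
Proof.
move=> fS; exists (fun=> S); split => // [_ //|].
by apply/seteqP; split => [p Sp n _ //|p /(_ 0%N I)].
Qed.

Lemma decided_deltaU K K' :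
  decided_delta K -> decided_delta K' -> decided_delta (K `|` K').
Proof.
move=> [S [fS dS ->]] [S' [fS' dS' ->]]; exists (fun n => S n `|` S' n); split.
- by move=> n; exact: finitely_decidedU.
- by move=> n p [/dS|/dS']; [left|right].
- apply/seteqP; split => [p [Sp|Sp] n _|p SS']; [left; exact: Sp|right; exact: Sp|].
  have mono (F : nat -> set (Y * code)) : (forall n, F n.+1 `<=` F n) ->
      forall m n, (m <= n)%N -> F n `<=` F m.
    move=> dF m n /subnKC <-; elim: (n - m)%N => [|k IH]; rewrite ?addn0// addnS.
    by move=> q /dF/IH.
  have [|/existsNP[n nS]] := pselect (forall n, S n p); first by left.
  right => m _; have [Sn|] := SS' (maxn n m) I.
    by case: nS; exact: (mono _ dS _ _ (leq_maxl n m)).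
  exact: (mono _ dS' _ _ (leq_maxr n m)).
Qed.

(** Diagonal choice: stage [N] takes level [N] of the first [N + 1] sequences. Each stage is then a
    finite intersection, and the stages decrease. *)
Lemma decided_delta_bigcap (K : nat -> set (Y * code)) :
  (forall i, decided_delta (K i)) -> decided_delta (\bigcap_i K i).
Proof.
move=> /choice[S SK].
exists (fun N => [set p | forall i, (i < N.+1)%N -> S i N p]); split.
- move=> N; suff: forall M, finitely_decided [set p | forall i, (i < M)%N -> S i N p] by exact.
  elim=> [|n IH].
    by rewrite (_ : mkset _ = setT); [exact: finitely_decidedT|apply/seteqP; split].
  rewrite (_ : mkset _ = [set p | forall i, (i < n)%N -> S i N p] `&` S n N).
    by apply: finitely_decidedI => //; case: (SK n).
  apply/seteqP; split => [p Sp|p [Sp Snp] i].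
    by split => [i iN|]; apply: Sp => //; rewrite ltnS ltnW.
  by rewrite ltnS leq_eqVlt => /predU1P[->//|]; exact: Sp.
- by move=> N p Sp i iN; have [_ + _] := SK i; apply; apply: Sp; exact: ltnW.
- apply/seteqP; split => [p Kp N _ i _|p Sp i _].
    by have [_ _ KS] := SK i; have := Kp i I; rewrite KS; exact.
  have [_ dS ->] := SK i => n _.
  have mono m k : (m <= k)%N -> S i k `<=` S i m.
    move=> /subnKC <-; elim: (k - m)%N => [|l IH]; rewrite ?addn0// addnS.
    by move=> q /dS/IH.
  by apply: (mono _ _ (leq_maxl n i)); apply: (Sp _ I); rewrite ltnS leq_maxr.
Qed.

Lemma measurable_proj_decided_delta K : decided_delta K ->
  measurable [set y | exists c, K (y, c)].
Proof.
move=> [S [fS dS ->]].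
rewrite (_ : mkset _ = \bigcap_n [set y | exists c, S n (y, c)]).
  by apply: bigcapT_measurable => n; exact: measurable_proj_finitely_decided.
apply/seteqP; split => [y [c Sc] n _|y Sy]; first by exists c; exact: Sc.
have [|c Sc] := finitely_decided_compact fS dS (y := y).
  by move=> n; exact: Sy.
by exists c => n _; exact: Sc.
Qed.

End CompactFibers.

Section Separation.
Context {dX dY : measure_display} {X : measurableType dX} {Y : measurableType dY}.
Context {R : realType} {J : choiceType}.
Local Notation code := (J -> bool).
Variables (proj : X -> Y) (bit : X -> code).
Hypothesis mproj : measurable_fun setT proj.
Hypothesis mbit : forall i, measurable [set x | bit x i].
Local Notation coded := (fun x => (proj x, bit x)).
Variable Q : {finite_measure set X -> \bar R}.
Local Notation decided := <<s @finitely_decided _ Y J >>.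

Lemma measurable_coded_finitely_decided S : finitely_decided S ->
  measurable (coded @^-1` S).
Proof.
move=> [s [Ss mS]].
rewrite (_ : _ @^-1` S = \bigcup_(t : (size s).-tuple bool)
  ((\bigcap_(i in [set` s]) [set x | bit x i = nth false t (index i s)]) `&`
   (proj @^-1` [set y | S (y, fun i => nth false t (index i s))]))).
  apply: fin_bigcup_measurable => // t _; apply: measurableI.
    apply: fin_bigcap_measurable; first exact: finite_seq.
    move=> i _; case: (nth _ _ _); first exact: mbit.
    rewrite (_ : mkset _ = ~` [set x | bit x i]); first exact/measurableC/mbit.
    by apply/seteqP; split => x /=; [move=> ->|move/negP/negbTE].
  by rewrite -[X in measurable X]setTI; apply: mproj => //; exact: mS.
apply/seteqP; split => [x Sx|x [t _ [/= tx Sx]]].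
  exists (map_tuple (bit x) (in_tuple s)) => //; split => [i si /=|/=].
    by rewrite (nth_map i) ?nth_index// index_mem.
  apply: Ss Sx => i si /=.
  by rewrite (nth_map i) ?nth_index// index_mem.
by apply: Ss Sx => i si; rewrite tx.
Qed.

Lemma measurable_coded S : decided S -> measurable (coded @^-1` S).
Proof.
suff : decided `<=` [set S | measurable (coded @^-1` S)] by exact.
apply: smallest_sub; last exact: measurable_coded_finitely_decided.
split => [|A mA|F mF] /=; first exact: measurable0.
  by rewrite setTD; exact: measurableC mA.
by rewrite preimage_bigcup; exact: bigcupT_measurable.
Qed.

Local Open Scope ereal_scope.

(** Inner regularity, by the compact class, of the image of [Q] under the coding map. *)
Let inner (S : set (Y * code)) := forall e : R, (0 < e)%R -> exists K,
  [/\ decided_delta K, K `<=` S & Q (coded @^-1` (S `\` K)) <= e%:E].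

Lemma decided_delta_decided K : decided_delta K -> decided K.
Proof.
move=> [S [fS _ ->]]; rewrite -(setCK (\bigcap_n S n)) setC_bigcap.
apply: sigma_algebra_setC; have [_ _] := smallest_sigma_algebra setT (@finitely_decided _ Y J).
by apply => n; apply: sigma_algebra_setC; exact: sub_gen_smallest.
Qed.

Let innerU (F : nat -> set (Y * code)) : (forall n, decided (F n)) ->
  (forall n, inner (F n)) -> inner (\bigcup_n F n).
Proof.
move=> dF iF e e0.
(* Half of [e] pays for approximating the sets [F n], the other half for stopping the union of the
   [K n] at a finite stage, which keeps it in the compact class. *)
have e20 : (0 < e / 2)%R by rewrite divr_gt0.
have pos n : (0 < (e / 2) / (2 ^ n.+1)%:R)%R by rewrite divr_gt0// ltr0n expn_gt0.
have /choice[K KF] := fun n => iF n _ (pos n).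
have dK n : decided_delta (K n) by case: (KF n).
pose KU N := \big[setU/set0]_(i < N.+1) K i.
have dKU N : decided_delta (KU N).
  rewrite /KU; elim: N => [|N IH]; first by rewrite big_ord_recl big_ord0 setU0.
  by rewrite big_ord_recr/=; exact: decided_deltaU.
pose D N := coded @^-1` (\bigcup_n K n `\` KU N).
have mK n : measurable (coded @^-1` (K n)).
  exact: measurable_coded (decided_delta_decided (dK n)).
have mKU N : measurable (coded @^-1` (KU N)).
  exact: measurable_coded (decided_delta_decided (dKU N)).
have mUK : measurable (coded @^-1` (\bigcup_n K n)).
  by rewrite preimage_bigcup; exact: bigcupT_measurable.
have mF n : measurable (coded @^-1` (F n)) by exact: measurable_coded (dF n).
have mUF : measurable (coded @^-1` (\bigcup_n F n)).
  by rewrite preimage_bigcup; exact: bigcupT_measurable.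
have KUE N : KU N = \bigcup_(i in [set i | (i < N.+1)%N]) K i.
  by rewrite /KU -bigcup_mkord.
have mD N : measurable (D N) by exact: measurableD mUK (mKU N).
have D0 : \bigcap_N D N = set0.
  apply/seteqP; split => // x Dx; have [[n _ Kn] _] := Dx 0%N I.
  by have [_] := Dx n I; apply; rewrite /= KUE; exists n => /=.
have : Q \o D @ \oo --> Q (\bigcap_N D N).
  apply: nonincreasing_cvg_mu => //.
  - by rewrite ltey_eq; apply/orP; left; exact: fin_num_measure.
  - by rewrite D0.
  - move=> m n mn; apply/subsetPset => x [Kx nKx]; split => //; apply: contra_not nKx.
    by rewrite /= !KUE => -[k /= km Kk]; exists k => //=; exact: leq_trans km _.
rewrite D0 measure0 => QD.
have [N QDN] : exists N, Q (D N) <= (e / 2)%:E.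
  have /QD[N _ QN] := nbhs_open_ereal_lt (f := cst (e / 2)%R) e20.
  by exists N; apply/ltW; exact: QN (leqnn N).
exists (KU N); split => //.
  rewrite KUE => p [i _ Kp]; exists i => //; have [_ + _] := KF i; exact.
have sub : coded @^-1` (\bigcup_n F n `\` KU N) `<=`
    D N `|` \bigcup_n (coded @^-1` (F n `\` K n)).
  move=> x [[n _ Fn] nK]; have [Kn|nKn] := pselect (K n (coded x)).
    by left; split => //; exists n.
  by right; exists n.
have mFK n : measurable (coded @^-1` (F n `\` K n)) by exact: measurableD (mF n) (mK n).
have mUFK : measurable (\bigcup_n (coded @^-1` (F n `\` K n))).
  exact: bigcupT_measurable.
apply: (@le_trans _ _ (Q (D N) + Q (\bigcup_n (coded @^-1` (F n `\` K n))))).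
  apply: le_trans (measureU2 _ _ _) => //; apply: le_measure; rewrite ?inE//.
    exact: measurableD mUF (mKU N).
  exact: measurableU.
rewrite [e in leRHS]splitr EFinD leeD//.
apply: le_trans (epsilon_trick0 xpredT (ltW e20)).
apply: (le_trans (measure_sigma_subadditive Q mFK mUFK (@subset_refl _ _))).
by apply: lee_nneseries => // n _; case: (KF n).
Qed.

(** The compact class is closed under countable intersections, so all of [e] is spent on the
    approximations. *)
Let innerC (F : nat -> set (Y * code)) : (forall n, decided (F n)) ->
  (forall n, inner (~` F n)) -> inner (~` \bigcup_n F n).
Proof.
move=> dF iF e e0.
have pos n : (0 < e / (2 ^ n.+1)%:R)%R by rewrite divr_gt0// ltr0n expn_gt0.
have /choice[K KF] := fun n => iF n _ (pos n).
have dK n : decided_delta (K n) by case: (KF n).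
have mK n : measurable (coded @^-1` (K n)).
  exact: measurable_coded (decided_delta_decided (dK n)).
have mF n : measurable (coded @^-1` (~` F n)).
  exact: measurable_coded (sigma_algebra_setC (dF n)).
have mFK n : measurable (coded @^-1` (~` F n `\` K n)) by exact: measurableD (mF n) (mK n).
exists (\bigcap_n K n); split; first exact: decided_delta_bigcap.
  by rewrite setC_bigcup => p Kp n _; have [_ + _] := KF n; apply; exact: Kp.
have sub : coded @^-1` ((~` \bigcup_n F n) `\` \bigcap_n K n) `<=`
    \bigcup_n (coded @^-1` ((~` F n) `\` K n)).
  move=> x [nF /existsNP[n /not_implyP[_ nK]]]; exists n => //; split => //.
  by apply: contra_not nF => Fn; exists n.
apply: le_trans (epsilon_trick0 xpredT (ltW e0)).
apply: (le_trans (measure_sigma_subadditive Q mFK _ sub)); last first.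
  by apply: lee_nneseries => // n _; case: (KF n).
rewrite setC_bigcup; apply: (measurableD (A := coded @^-1` (\bigcap_n ~` F n)) (B := coded @^-1` (\bigcap_n K n)));
  rewrite preimage_bigcap; exact: bigcapT_measurable.
Qed.

(** Regularity of a set and of its complement are carried together: this makes the class a
    sigma-algebra. *)
Let decided_inner S : decided S -> inner S.
Proof.
suff : decided `<=` [set S | [/\ decided S, inner S & inner (~` S)]] by move=> sub /sub[].
have innerfd A : finitely_decided A -> inner A.
  move=> fA e e0; exists A; split => //; first exact: decided_delta_finitely.
  by rewrite setDv preimage_set0 measure0 lee_fin ltW.
have [s0 sC sU] := smallest_sigma_algebra setT (@finitely_decided _ Y J).
apply: smallest_sub => [|A fA]; last first.
  split; [exact: sub_gen_smallest|exact: innerfd|].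
  exact/innerfd/finitely_decidedC.
split.
- split => //; last by rewrite setC0; apply: innerfd; exact: finitely_decidedT.
  by rewrite -setCT; apply: innerfd; apply: finitely_decidedC; exact: finitely_decidedT.
- move=> A [dA iA iCA]; rewrite setTD; split => //; last by rewrite setCK.
  exact: sigma_algebra_setC.
- move=> F FP; split.
  + by apply: sU => n; case: (FP n).
  + by apply: innerU => n; case: (FP n).
  + by apply: innerC => n; case: (FP n).
Qed.

(** [Z] is the range of the coding map. Intersecting with it ensures that every point of an inner
    approximation is the code of an element of [X]. *)
Variable Z : set (Y * code).
Hypothesis Z_decided : decided Z.
Hypothesis Z_coded : forall x, Z (coded x).
Hypothesis Z_range : forall p, Z p -> exists x, coded x = p.
Hypothesis measurable_coded_preimage : forall B : set X, measurable B ->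
  exists2 S, decided S & B = coded @^-1` S.

(** Take inner approximations whose defect is at most [1 / (n + 1)]. Their projections are
    measurable by compactness and contained in the projection of [B], and the union of these
    projections misses only a null part of [B]. *)
Lemma measurable_projection_core (B : set X) : measurable B ->
  exists E : set Y, [/\ measurable E, E `<=` proj @` B &
    Q (B `\` proj @^-1` E) = 0].
Proof.
move=> mB; have [S dS BS] := measurable_coded_preimage mB.
have iSZ := decided_inner (sigma_algebra_setI dS Z_decided).
have pos n : (0 < n.+1%:R^-1 :> R)%R by rewrite invr_gt0.
have /choice[K KP] := fun n => iSZ _ (pos n).
pose E n := [set y | exists c, K n (y, c)].
have mE n : measurable (E n).
  by apply: measurable_proj_decided_delta; case: (KP n).
exists (\bigcup_n E n); split; first exact: bigcupT_measurable.
  move=> y [n _ [c Kyc]]; have [_ KSZ _] := KP n; have [Sy Zy] := KSZ _ Kyc.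
  by have [x xE] := Z_range Zy; exists x; [rewrite BS /= xE|case: xE].
have mBE : measurable (B `\` proj @^-1` (\bigcup_n E n)).
  apply: measurableD => //; rewrite -[X in measurable X]setTI.
  by apply: mproj => //; exact: bigcupT_measurable.
apply/eqP; rewrite eq_le measure_ge0 andbT; apply/lee_addgt0Pr => e e0.
rewrite add0e.
have [n ne] : exists n, (n.+1%:R^-1 < e)%R.
  exists (Num.trunc e^-1); rewrite invf_plt ?posrE//; exact: truncnS_gt.
have [dK _ QK] := KP n.
apply: le_trans (ltW _ : n.+1%:R^-1%:E <= e%:E); last by rewrite lte_fin.
apply: le_trans QK; apply: le_measure; rewrite ?inE//.
  apply: measurable_coded; rewrite setDE; apply: sigma_algebra_setI.
    exact: sigma_algebra_setI.
  by apply: sigma_algebra_setC; exact: (decided_delta_decided dK).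
move=> x [Bx nE]; split; first by split; [move: Bx; rewrite BS|exact: Z_coded].
by apply: contra_not nE => Kx; exists n => //; exists (bit x).
Qed.

(* No coupling of the two laws is needed: the events [f > q] project onto
   measurable cores [E q], and [g > q] holds above [E q]. *)
Lemma integral_le_fiberwise (Q' : {measure set X -> \bar R}) (f g : X -> \bar R)
    (A A' : set X) :
  measurable_fun setT f -> measurable_fun setT g ->
  (forall x, 0 <= f x) -> (forall x, 0 <= g x) ->
  (forall E, measurable E -> Q (proj @^-1` E) = Q' (proj @^-1` E)) ->
  {ae Q, forall x, A x} -> {ae Q', forall x, A' x} ->
  (forall x x', proj x = proj x' -> A x -> A' x' -> f x <= g x') ->
  \int[Q]_x f x <= \int[Q']_x g x.
Proof.
move=> mf mg f0 g0 QQ' [N [mN QN AN]] aeA' fg.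
(* An enumeration of the nonnegative rationals. Negative rationals and indices that code nothing are
   sent to 0, a harmless level for nonnegative functions. *)
pose q (n : nat) : R := if choice.unpickle n is Some r then Num.max 0%R (ratr (r : rat)) else 0%R.
have q_ge0 n : (0 <= q n)%R.
  by rewrite /q; case: choice.unpickle => [r|]//; rewrite le_max lexx.
have q_dense (a b : \bar R) : 0 <= a -> a < b -> exists n, a < (q n)%:E < b.
  move: a b => [a| |] [b| |]//; rewrite ?lte_fin ?lee_fin => a0 ab.
  - have [r] := rat_in_itvoo ab; rewrite in_itv/= => /andP[ar rb].
    exists (choice.pickle r); rewrite /q choice.pickleK max_r ?lte_fin ?ar//.
    exact: le_trans a0 (ltW ar).
  - have a1 : (a < a + 1)%R by rewrite ltrDl.
    have [r] := rat_in_itvoo a1; rewrite in_itv/= => /andP[ar _].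
    exists (choice.pickle r); rewrite /q choice.pickleK max_r ?lte_fin ?ar ?ltry//.
    exact: le_trans a0 (ltW ar).
(* Removing the null set [N] ensures that the points found above [E n] satisfy [A]. *)
pose B n := [set x | (q n)%:E < f x] `\` N.
have mB n : measurable (B n).
  by apply: measurableD => //; rewrite -[X in measurable X]setTI; exact: emeasurable_fun_o_infty.
have /choice[E EP] := fun n => measurable_projection_core (mB n).
have mE n : measurable (E n) by case: (EP n).
(* A function of the base point that separates [f] from [g]: [f] is at most [h \o proj] almost
   everywhere for [Q], which is at most [g] almost everywhere for [Q'], and both laws give
   [h \o proj] the same integral. *)
pose h y := ereal_sup (range (fun n => (q n * \1_(E n) y)%:E)).
have mh : measurable_fun setT h.
  rewrite (_ : h = fun y => esups (fun n => (q n * \1_(E n) y)%:E) 0%N); last first.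
    apply/funext => y; rewrite /h /esups /sdrop; congr ereal_sup.
    by apply/seteqP; split => _ [n _ <-]; exists n.
  apply: (measurable_fun_esups (f := fun n y => (q n * \1_(E n) y)%:E)) => n.
  by apply/measurable_EFinP; apply: measurable_funM => //; exact: measurable_indic.
have h0 y : 0 <= h y.
  apply: ereal_sup_ge; exists (q 0%N * \1_(E 0%N) y)%:E; first by exists 0%N.
  by rewrite lee_fin mulr_ge0.
have mhp : measurable_fun setT (h \o proj) by exact: measurableT_comp.
have fh : \int[Q]_x f x <= \int[Q]_x (h \o proj) x.
  apply: ae_ge0_le_integral => //=.
  have Qnull : Q.-negligible (N `|` \bigcup_n (B n `\` proj @^-1` E n)).
    apply: negligibleU; first by exists N; split.
    apply: negligible_bigcup => n; exists (B n `\` proj @^-1` E n); split => //.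
      apply: measurableD => //; rewrite -[X in measurable X]setTI; exact: mproj.
    by case: (EP n).
  apply: negligibleS Qnull => x /= /not_implyP[_ /negP]; rewrite -ltNge => hf.
  have [Nx|nNx] := pselect (N x); [by left|right].
  have [n /andP[hq qf]] := q_dense _ _ (h0 _) hf.
  exists n => //; split => // Ex; move: hq; apply/negP; rewrite -leNgt.
  apply: ereal_sup_ubound; exists n => //; rewrite indicE mem_set ?mulr1//.
apply: (le_trans fh).
have -> : \int[Q]_x (h \o proj) x = \int[Q']_x (h \o proj) x.
  have pushE (m : {measure set X -> \bar R}) :
      \int[m]_x (h \o proj) x = \int[pushforward m proj]_y h y.
    by rewrite (ge0_integral_pushforward mproj) ?preimage_setT.
  rewrite !pushE.
  by apply: eq_measure_integral => C mC _; exact: QQ'.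
apply: ae_ge0_le_integral => //=.
apply: filterS aeA' => x A'x _.
apply: ge_ereal_sup => _ [n _ <-]; rewrite indicE.
have [/set_mem Ex|_] := boolP (proj x \in E n); last by rewrite mulr0.
rewrite mulr1; have [_ EB _] := EP n; have [x' [qf nN] xx'] := EB _ Ex.
apply/ltW/(lt_le_trans qf)/fg => //.
by apply: contra_notP nN => nA; exact: AN.
Qed.

End Separation.

(** * Coding the marks *)

Lemma second_countable_seq (T : topologicalType) : @second_countable T ->
  exists V : nat -> set T, (forall k, open (V k)) /\
    (forall x U, nbhs x U -> exists2 k, V k x & V k `<=` U).
Proof.
move=> [B /countable_injP[f injf] [oB bB]].
exists (fun k => \bigcup_(A in [set A | B A /\ f A = k]) A); split => [k|x U xU].
  by apply: bigcup_open => A [BA _]; exact: oB.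
have [A [BA Ax] AU] := bB x U xU.
exists (f A); first by exists A.
move=> y [A' [BA' ff] A'y]; apply: AU.
by rewrite -(injf _ _ _ _ ff) ?inE.
Qed.

(** Compactness of the closures later yields a mark as a cluster point; inclusions of closures keep
    this cluster point inside the basic sets. *)
Lemma locally_compact_regular_base (T : topologicalType) (V : nat -> set T) :
  hausdorff_space T -> locally_compact [set: T] ->
  (forall x U, nbhs x U -> exists2 k, V k x & V k `<=` U) ->
  forall x U, nbhs x U ->
    exists k, [/\ V k x, closure (V k) `<=` U & compact (closure (V k))].
Proof.
move=> hT lcT bV x U xU.
have [C xC [cC clC]] := lcT x I.
have {}xC : nbhs x C by move: xC; rewrite /within/= => xC; apply: filterS xC => y /(_ I).
have [W xW WU] := compact_regular hT cC xC (filterI xU xC).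
have [k Vx VW] := bV x W xW; exists k.
have clV : closure (V k) `<=` U `&` C by apply: subset_trans WU; exact: closureS.
split => //; first by move=> y /clV[].
apply: subclosed_compact cC _; first exact: closed_closure.
by move=> y /clV[].
Qed.

Section RationalBalls.
Context {R : realType} {d : nat}.
Local Notation V := 'rV[R]_d.
Local Notation ballname := ('rV[rat]_d * nat)%type.

Definition center (b : ballname) : V := map_mx (ratr : rat -> R) b.1.
Definition radius (b : ballname) : R := b.2.+1%:R^-1.
Definition rball b : set V := [set x | `|center b - x| < radius b].
Definition cball b : set V := [set x | `|center b - x| <= radius b].

Lemma open_rball b : open (rball b).
Proof.
have -> : rball b = ball (center b) (radius b) by rewrite -ball_normE.
exact: ball_open.
Qed.

Lemma closed_cball b : closed (cball b).
Proof. by apply: closed_closed_ball_; rewrite invr_gt0. Qed.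

Lemma rball_cball b : rball b `<=` cball b.
Proof. by move=> x /ltW. Qed.

Lemma bounded_cball b : bounded_set (cball b).
Proof.
exists (`|center b| + radius b); split; first exact: num_real.
move=> r br x /= xb; rewrite (le_trans _ (ltW br))//.
rewrite -[x](subKr (center b)) (le_trans (ler_normB _ _))// lerD2l//.
Qed.

Lemma rball_base x W : nbhs x W -> exists2 b, rball b x & cball b `<=` W.
Proof.
move=> /nbhs_ballP[e /= e0 xeW].
(* The diameter [2 * r] is below [e], so a closed ball of radius [r] that contains [x] stays in the
   ball of radius [e] around [x]. *)
pose n := Num.trunc (2 / e); pose r : R := n.+1%:R^-1.
have r0 : 0 < r by rewrite invr_gt0.
have re : 2 * r < e.
  rewrite -ltr_pdivlMl// -invf_plt ?posrE ?mulr_gt0 ?invr_gt0//.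
  by rewrite invfM invrK; exact: truncnS_gt.
have /choice[q qx] : forall i : 'I_d, exists q : rat, `|(ratr q : R) - x ord0 i| < r.
  move=> i; have : x ord0 i - r < x ord0 i + r by rewrite ltrBlDr -addrA ltrDl addr_gt0.
  move=> /rat_in_itvoo[q]; rewrite in_itv/= => /andP[q1 q2]; exists q.
  by rewrite ltr_distl q1 q2.
exists (\row_i q i, n) => [|y].
  suff : ball (center (\row_i q i, n)) r x by rewrite -ball_normE.
  by split => // i j; rewrite ord1 !mxE -ball_normE /=; exact: qx.
move=> cy; apply: xeW; rewrite -ball_normE /=.
have cx : `|center (\row_i q i, n) - x| < r.
  suff : ball (center (\row_i q i, n)) r x by rewrite -ball_normE.
  by split => // i j; rewrite ord1 !mxE -ball_normE /=; exact: qx.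
apply: le_lt_trans re; rewrite -[x - y](subrKA (center (\row_i q i, n))).
rewrite (le_trans (ler_normD _ _))// mulr_natl mulr2n lerD//.
by rewrite distrC ltW.
Qed.

End RationalBalls.

Section GeneratedCountable.
Variables (T : Type) (G : set_system T).

(** With its companions, this lets membership of a set in a generated sigma-algebra be read off the
    shape of the formula defining it, here that of [code_range]. *)
Lemma sigma_algebra_exists (J : countType) (F : J -> set T) :
  (forall i, <<s G >> (F i)) -> <<s G >> [set p | exists i, F i p].
Proof.
move=> GF; have [s0 _ sU] := smallest_sigma_algebra setT G.
rewrite (_ : mkset _ = \bigcup_n (if choice.unpickle n is Some i then F i else set0)).
  by apply: sU => n; case: choice.unpickle => // i; exact: GF.
apply/seteqP; split => [p [i Fp]|p [n _]].
  by exists (choice.pickle i) => //; rewrite choice.pickleK.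
by case: choice.unpickle => // i Fp; exists i.
Qed.

Lemma sigma_algebra_forall (J : countType) (F : J -> set T) :
  (forall i, <<s G >> (F i)) -> <<s G >> [set p | forall i, F i p].
Proof.
move=> GF; rewrite (_ : mkset _ = ~` [set p | exists i, (~` F i) p]).
  apply: sigma_algebra_setC; apply: sigma_algebra_exists => i.
  exact: sigma_algebra_setC.
apply/seteqP; split => [p Fp [i]|p nF i]; first exact.
by apply: contrapT => nFi; apply: nF; exists i.
Qed.

Lemma sigma_algebra_imply (A B : set T) :
  <<s G >> A -> <<s G >> B -> <<s G >> [set p | A p -> B p].
Proof.
move=> GA GB; rewrite (_ : mkset _ = ~` (A `&` ~` B)).
  apply: sigma_algebra_setC; apply: sigma_algebra_setI => //.
  exact: sigma_algebra_setC.
apply/seteqP; split => [p AB [Ap nB]|p nAB Ap]; first exact/nB/AB.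
by apply: contrapT => nB; apply: nAB.
Qed.

Lemma sigma_algebra_or (A B : set T) :
  <<s G >> A -> <<s G >> B -> <<s G >> [set p | A p \/ B p].
Proof.
move=> GA GB; rewrite (_ : mkset _ = [set p | (~` A) p -> B p]).
  by apply: sigma_algebra_imply => //; exact: sigma_algebra_setC.
apply/seteqP; split => [p [Ap /(_ Ap)//|Bp _ //]|p AB].
by have [|nA] := pselect (A p); [left|right; exact: AB].
Qed.

Lemma sigma_algebra_const (P : Prop) : <<s G >> [set _ | P].
Proof.
have [s0 _ _] := smallest_sigma_algebra setT G.
have [p|np] := pselect P.
  rewrite (_ : mkset _ = ~` set0); first exact: sigma_algebra_setC.
  by apply/seteqP; split => // x _ [].
by rewrite (_ : mkset _ = set0)//; apply/seteqP; split.
Qed.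

End GeneratedCountable.

Section LocationEvents.
Context {R : realType} {d : nat}.
Local Notation V := 'rV[R]_d.

Lemma card_eq1P (T : choiceType) (A : set T) :
  (A #= `I_1)%card <-> exists a, A = [set a].
Proof.
split=> [A1|[a ->]]; last exact: card_set1.
have fA : finite_set A by apply/finite_setP; exists 1%N.
have /eqP/cardfs1P[a Aa] := card_fset_set A1.
by exists a; rewrite -(fset_setK fA) Aa set_fset1.
Qed.

Lemma card_eq0P (T : Type) (A : set T) : (A #= `I_0)%card <-> A = set0.
Proof. by rewrite II0 card_eq0; split => /eqP. Qed.

Lemma measurable_atoms_meet (K : topologicalType) (B : set (V * K)) :
  <<s open >> B -> measurable [set psi : config R d K | atoms psi `&` B !=set0].
Proof.
move=> mB; rewrite (_ : mkset _ = ~` [set psi | (atoms psi `&` B #= `I_0)%card]).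
  by apply: measurableC; apply: sub_gen_smallest; exists B, 0%N.
apply/seteqP; split => psi /=; first by move=> /set0P/eqP + /card_eq0P.
by move=> n0; apply/set0P/eqP => /card_eq0P.
Qed.

Definition single (K : topologicalType) (W : set V) (phi : config R d K) : Prop :=
  (restriction phi W #= `I_1)%card.

Lemma singleP (K : topologicalType) W (phi : config R d K) :
  single W phi <-> exists a, [/\ atoms phi a, W a.1 & forall a', atoms phi a' -> W a'.1 -> a' = a].
Proof.
rewrite /single card_eq1P; split => [[a aE]|[a [pa Wa ua]]]; exists a.
  have : restriction phi W a by rewrite aE.
  move=> [pa Wa]; split => // a' pa' Wa'.
  by have : restriction phi W a' by []; rewrite aE.
by apply/seteqP; split => [a' [pa' Wa']|a' ->]; [exact: ua|].
Qed.

Lemma measurable_single (K : topologicalType) (W : set V) : open W ->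
  measurable [set phi : config R d K | single W phi].
Proof.
move=> oW; apply: sub_gen_smallest; exists (W `*` setT), 1%N; split.
  by apply: sub_gen_smallest; apply: open_setX => //; exact: openT.
by apply/seteqP; split => phi; rewrite /= /single /restriction;
  rewrite (_ : fst @^-1` W = W `*` setT)//; apply/seteqP; split => // a [].
Qed.

(** A bounded ball holds finitely many atoms, so the locations of the others form a closed set
    avoiding [a.1]. The closed ball is isolating too: counting arguments delete an atom by passing
    to the open complement of that ball. *)
Lemma atom_isolated (K : topologicalType) (phi : config R d K) a W :
  atoms phi a -> nbhs a.1 W -> exists b, [/\ rball b a.1, cball b `<=` W &
    forall a', atoms phi a' -> cball b a'.1 -> a' = a].
Proof.
move=> pa aW; have [b0 ab0 _] := rball_base aW.
have fin : finite_set ([set a' | atoms phi a' /\ cball b0 a'.1] `\ a).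
  apply: sub_finite_set (config_locfin phi (bounded_cball b0)).
  by move=> a' [[pa' ba'] _].
pose F := [set a'.1 | a' in [set a' | atoms phi a' /\ cball b0 a'.1] `\ a].
have nF : nbhs a.1 (~` F).
  apply: open_nbhs_nbhs; split.
    apply: closed_openC; apply: (iffLR accessible_finite_set_closed).
      exact: hausdorff_accessible.
    exact: finite_image.
  move=> [[x k] [[/= pxk _] ne] /= xa]; apply: ne; move: pa pxk.
  case: a xa {aW ab0 fin F} => [y k'] /= ->; move=> p1 p2.
  by rewrite /= (config_ground p1 p2).
have ab0n : nbhs a.1 (rball b0) by apply: open_nbhs_nbhs; split => //; exact: open_rball.
have [b ab bW] := rball_base (filterI aW (filterI nF ab0n)).
exists b; split => //; first by move=> x /bW[].
move=> a' pa' /bW[_ [nF' b0a']]; apply: contrapT => ne; apply: nF'.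
by exists a' => //; split => //; split => //; exact: rball_cball.
Qed.

End LocationEvents.

Section Forget.
Context {R : realType} {d : nat} {M M' : topologicalType}.
Local Notation NM := (config R d M).
Local Notation NMM := (config R d (M * M')%type).

Definition drop_mark (a : 'rV[R]_d * (M * M')) : 'rV[R]_d * M := (a.1, a.2.1).

Lemma forget_atoms (psi : NMM) a : atoms psi a -> atoms (forget psi) (drop_mark a).
Proof. by move=> pa; exists a. Qed.

Lemma forget_atomsP (psi : NMM) x m : atoms (forget psi) (x, m) ->
  exists m', atoms psi (x, (m, m')).
Proof. by move=> [[y [k m']] pa [<- <-]]; exists m'. Qed.

(** An atom is determined by its location, so a map that retains the location is injective on
    atoms. *)
Lemma set_inj_atoms (K : topologicalType) (psi : config R d K) (T : Type)
    (A : set ('rV[R]_d * K)) (f : 'rV[R]_d * K -> T) (g : T -> 'rV[R]_d) :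
  (forall a, g (f a) = a.1) -> set_inj (atoms psi `&` A) f.
Proof.
move=> gf [x k] [y l] /set_mem[px _] /set_mem[py _] /(congr1 g).
by rewrite !gf /= => xy; subst y; rewrite (config_ground px py).
Qed.

Lemma measurable_forget : measurable_fun setT (@forget R d M M').
Proof.
apply: measurable_config_fun => N U oU.
have cE (psi : NMM) : count (R := R) (forget psi) N U = count psi N (drop_mark @^-1` U).
  rewrite /count -(card_sum_image (f := drop_mark)); last first.
    exact: (set_inj_atoms (g := fst)).
  congr card_sum; apply/seteqP; split => [_ [[a pa <-] [Ua [wa _]]]|_ [a [pa [Ua [wa _]]] <-]].
    by exists a.
  by split; [exact: forget_atoms|].
rewrite (_ : (fun t => _) = fun psi => count psi N (drop_mark @^-1` U)); last exact/funext.
apply: measurable_count; apply: sub_gen_smallest.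
rewrite openE => -[x [m m']] Ux.
have [[A B] [/= Ax Bm] AB] : nbhs (x, m) U by exact: open_nbhs_nbhs.
exists (A, B `*` setT) => /=; last by move=> [y [l l']] [/= Ay [Bl _]]; exact: AB.
by split => //; exists (B, setT) => //=; split => //; exact: filterT.
Qed.

End Forget.

Section Coding.
Context {R : realType} {d : nat} {M M' : topologicalType}.
Local Notation NM := (config R d M).
Local Notation NMM := (config R d (M * M')%type).
Local Notation name := ('rV[rat]_d * nat)%type.
Local Notation code := (name * nat -> bool).
Variables (VM : nat -> set M) (V : nat -> set M').
Hypothesis oVM : forall k, open (VM k).
Hypothesis bVM : forall x U, nbhs x U -> exists2 k, VM k x & VM k `<=` U.
Hypothesis oV : forall k, open (V k).
Hypothesis bV : forall x U, nbhs x U ->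
  exists k, [/\ V k x, closure (V k) `<=` U & compact (closure (V k))].
Hypothesis hM' : hausdorff_space M'.
Local Notation decided := (<<s @finitely_decided _ NM (name * nat)%type >>).

(* The marks are read off countably many bits [(b, k)]: the rational ball [b]
   holds exactly one point of the base configuration and its mark is in [V k]. *)
Definition mark_code (psi : NMM) : code := fun i =>
  `[< single (rball i.1) (forget psi) /\
      atoms psi `&` (rball i.1 `*` (setT `*` V i.2)) !=set0 >].

Lemma measurable_mark_code i : measurable [set psi | mark_code psi i].
Proof.
rewrite (_ : mkset _ = (@forget R d M M') @^-1` [set phi | single (rball i.1) phi] `&`
  [set psi | atoms psi `&` (rball i.1 `*` (setT `*` V i.2)) !=set0]).
  apply: measurableI.
    rewrite -[X in measurable X]setTI; apply: measurable_forget => //.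
    by apply: measurable_single; exact: open_rball.
  apply: measurable_atoms_meet; apply: sub_gen_smallest; apply: open_setX.
    exact: open_rball.
  by apply: open_setX => //; exact: openT.
by apply/seteqP; split => psi /asboolP.
Qed.

(* A code comes from a marking of [p.1] when, at each isolated point, the indices
   [k] with bit 1 form a filter base with a compact member that decides each
   inclusion [closure (V l) `<=` V k], so that they converge to one mark. *)
Definition code_range : set (NM * code) := [set p : NM * code |
  (forall b k, p.2 (b, k) -> single (rball b) p.1) /\
  (forall b, single (rball b) p.1 ->
     exists k, p.2 (b, k) /\ compact (closure (V k))) /\
  (forall b k, p.2 (b, k) -> V k !=set0 /\
     exists l, p.2 (b, l) /\ closure (V l) `<=` V k) /\
  (forall b k l, p.2 (b, k) -> p.2 (b, l) ->
     exists h, p.2 (b, h) /\ V h `<=` V k `&` V l) /\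
  (forall b k l, single (rball b) p.1 -> closure (V l) `<=` V k ->
     p.2 (b, k) \/ exists h, p.2 (b, h) /\ V h `&` V l = set0) /\
  (forall b b' k, single (rball b) p.1 -> single (rball b') p.1 ->
     single (rball b `&` rball b') p.1 -> p.2 (b, k) -> p.2 (b', k))].

Lemma decided_code_range : decided code_range.
Proof.
have dbit i : decided [set p : NM * code | p.2 i].
  by apply: sub_gen_smallest; exact: finitely_decided_bit.
have dsingle W : open W -> decided [set p : NM * code | single W p.1].
  by move=> oW; apply: sub_gen_smallest; apply: (finitely_decided_base (measurable_single oW)).
have drb b := dsingle _ (@open_rball R d b).
have rb2 b b' := dsingle _ (openI (@open_rball R d b) (@open_rball R d b')).
have fA (J : countType) (F : J -> NM * code -> Prop) : (forall i, decided [set p | F i p]) ->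
    decided [set p | forall i, F i p] by exact: sigma_algebra_forall.
have eA (J : countType) (F : J -> NM * code -> Prop) : (forall i, decided [set p | F i p]) ->
    decided [set p | exists i, F i p] by exact: sigma_algebra_exists.
have iA (A B : NM * code -> Prop) : decided [set p | A p] -> decided [set p | B p] ->
    decided [set p | A p -> B p] by exact: sigma_algebra_imply.
have aA (A B : NM * code -> Prop) : decided [set p | A p] -> decided [set p | B p] ->
    decided [set p | A p /\ B p] by exact: sigma_algebra_setI.
have oA (A B : NM * code -> Prop) : decided [set p | A p] -> decided [set p | B p] ->
    decided [set p | A p \/ B p] by exact: sigma_algebra_or.
have cA (P : Prop) : decided [set _ | P] by exact: sigma_algebra_const.
repeat (first [exact: dbit | exact: drb | exact: rb2 | exact: cA |
  apply: (aA) | apply: (fA) => ? | apply: (eA) => ? | apply: (iA) | apply: (oA)]).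
Qed.

Lemma code_range_coded (psi : NMM) : code_range (forget psi, mark_code psi).
Proof.
(* The bits of a ball that isolates a point list the basic sets containing its mark; each clause of
   [code_range] then becomes a statement about neighbourhoods of this mark. *)
have key b : single (rball b) (forget psi) -> exists x m m',
    [/\ atoms psi (x, (m, m')), rball b x &
    forall b' k, rball b' x -> single (rball b') (forget psi) ->
      (mark_code psi (b', k) <-> V k m')].
  move=> /singleP[[x m] [/forget_atomsP[m' pa] bx ux]]; exists x, m, m'; split => //.
  move=> b' k b'x sb'; split => [/asboolP[_ [[y [l l']] [pa' [/= b'y [_ Vl']]]]]|Vm'].
    move: sb' => /singleP[a [_ _ ua]].
    have e1 := ua _ (forget_atoms pa) b'x; have e2 := ua _ (forget_atoms pa') b'y.
    have /= xy : (drop_mark (x, (m, m'))).1 = (drop_mark (y, (l, l'))).1 by rewrite e1 e2.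
    by subst y; have [_ ->] := config_ground pa pa'.
  by apply/asboolP; split => //; exists (x, (m, m')); split => //; split.
do !split => /=.
- by move=> b k /asboolP[].
- move=> b sb; have [x [m [m' [_ bx mk]]]] := key b sb.
  have [k [Vk _ ck]] := bV (filterT : nbhs m' setT).
  by exists k; split => //; apply/mk.
- by move: H => /asboolP[_ [a [_ [_ [_ Va]]]]]; exists a.2.2.
- have /asboolP[sb _] := H; have [x [m [m' [_ bx mk]]]] := key b sb.
  have Vk : V k m' by apply/(mk b).
  have [l [Vl lk _]] := bV (open_nbhs_nbhs (conj (oV k) Vk)).
  by exists l; split => //; apply/mk.
- move=> b k l bk bl; have /asboolP[sb _] := bk; have [x [m [m' [_ bx mk]]]] := key b sb.
  have Vk : V k m' by apply/(mk b).
  have Vl : V l m' by apply/(mk b).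
  have [h [Vh hkl _]] := bV (open_nbhs_nbhs (conj (openI (oV k) (oV l)) (conj Vk Vl))).
  by exists h; split; [apply/mk|move=> y Vy; apply/hkl/subset_closure].
- move=> b k l sb lk; have [x [m [m' [_ bx mk]]]] := key b sb.
  have [Vk|nVk] := pselect (V k m'); [left; exact/mk|right].
  have nl : nbhs m' (~` closure (V l)).
    apply: open_nbhs_nbhs; split; first by apply: closed_openC; exact: closed_closure.
    by move=> /lk.
  have [h [Vh hl _]] := bV nl; exists h; split; first exact/mk.
  apply/seteqP; split => // y [/subset_closure/hl nVl Vl]; apply: nVl; exact: subset_closure.
- move=> b b' k sb sb' sbb' bk.
  have [x [m [m' [pa bx mk]]]] := key b sb.
  have b'x : rball b' x.
    move: sbb' => /singleP[a [pa' [ba b'a] _]]; move: sb => /singleP[a0 [_ _ u0]].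
    have e1 := u0 _ pa' ba; have e2 := u0 _ (forget_atoms pa) bx.
    by move: b'a; rewrite e1 -e2.
  by apply/mk => //; exact/(mk b).
Qed.

Lemma code_range_exists p : code_range p -> exists psi, (forget psi, mark_code psi) = p.
Proof.
case: p => phi c [/= c1 [c2 [c3 [c4 [c5 c6]]]]].
(* The basic sets with bit 1 generate a proper filter with a member of compact closure. A cluster
   point lies in all of them because each contains the closure of another one; conversely, a basic
   set that contains it has bit 1 by the clause that decides inclusions. *)
have key b : single (rball b) phi -> exists m', forall k, c (b, k) <-> V k m'.
  move=> sb.
  pose F := filter_from [set k | c (b, k)] V.
  have FF : ProperFilter F.
    apply: filter_from_proper; last by move=> k /c3[].
    apply: filter_from_filter; first by have [k [ck _]] := c2 _ sb; exists k.
    by move=> k l /= ck cl; have [h [ch hkl]] := c4 _ _ _ ck cl; exists h.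
  have [k0 [ck0 cpt]] := c2 _ sb.
  have [|m' [_ clm']] := cpt F FF.
    by exists k0 => //; exact: subset_closure.
  have inV k : c (b, k) -> V k m'.
    move=> /c3[_ [l [cl lk]]]; apply: lk => B mB.
    by apply: clm' => //; exists l.
  exists m' => k; split => [|Vk]; first exact: inV.
  have [l [Vl lk _]] := bV (open_nbhs_nbhs (conj (oV k) Vk)).
  have [//|[h [/inV Vh hl]]] := c5 _ _ _ sb lk.
  by have : (V h `&` V l) m' by []; rewrite hl.
(* All marks compatible with the bits of every isolating ball. Since [M'] is Hausdorff, at most one
   is compatible at each point. *)
pose A : set ('rV[R]_d * (M * M')) := [set a | atoms phi (drop_mark a) /\
  forall b, rball b a.1 -> single (rball b) phi -> forall k, c (b, k) <-> V k a.2.2].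
have has_ball x m : atoms phi (x, m) -> exists b, rball b x /\ single (rball b) phi.
  move=> pa; have [b [bx _ ub]] := atom_isolated pa (filterT : nbhs x setT).
  exists b; split => //; apply/singleP; exists (x, m); split => // a' pa' ba'.
  by apply: ub => //; exact: rball_cball.
have Aground x k k' : A (x, k) -> A (x, k') -> k = k'.
  case: k k' => [m m'] [l l'] [/= pa ua] [/= pa' ua'].
  have /= ml := config_ground pa pa'; subst l; congr (_, _).
  have [b [bx sb]] := has_ball _ _ pa.
  apply: hM' => B B' mB lB'.
  have [k [Vk kB _]] := bV mB; have [k' [Vk' k'B _]] := bV lB'.
  exists m'; split; first exact: nbhs_singleton.
  by apply/k'B/subset_closure/(ua b bx sb k')/(ua' b bx sb k').
have Afin B : bounded_set B -> finite_set (A `&` fst @^-1` B).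
  move=> bB; have fin := config_locfin phi bB.
  apply: sub_finite_set (bigcup_finite fin (F := fun a => A `&` [set a' | drop_mark a' = a]) _).
    by move=> a [Aa Ba]; exists (drop_mark a) => //; split => //; case: Aa.
  move=> a _; have [->|/set0P[[x k] [Aa xa]]] := eqVneq (A `&` [set a' | drop_mark a' = a]) set0.
    exact: finite_set0.
  apply: (@sub_finite_set _ _ [set (x, k)]); last exact: finite_set1.
  move=> [y l] [Ay ya] /=.
  have yx : y = x by move: xa ya => /= <- [].
  by subst y; rewrite (Aground _ _ _ Aa Ay).
pose psi := Config Afin Aground.
have fpsi : forget psi = phi.
  apply: config_ext; apply/seteqP; split => [_ [a [pa _] <-] //|[x m] pa].
  have [b [bx sb]] := has_ball _ _ pa; have [m' mb] := key _ sb.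
  exists (x, (m, m')) => //; split => // b' b'x sb' k.
  rewrite /= in b'x *.
  (* The mark was found from one isolating ball [b]; the last clause of [code_range] transfers its
     bits to any other ball isolating the same point. *)
  have sbb' : single (rball b `&` rball b') phi.
    apply/singleP; exists (x, m); split => // a' pa' [ba' _].
    move: sb => /singleP[a0 [_ _ u0]].
    by rewrite (u0 _ pa' ba') (u0 _ pa bx).
  split => [cb'|Vk].
    by apply/mb; apply: (c6 b' b) => //; rewrite setIC.
  by apply: (c6 b b') => //; apply/mb.
exists psi; rewrite fpsi; congr (_, _).
apply/funext => -[b k]; rewrite /mark_code fpsi /=.
apply/asboolP/idP => [[sb [[x [m m']] [[pa ua] [/= bx [_ Vk]]]]]|cbk].
  by apply/(ua b).
have sb := c1 _ _ cbk; split => //.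
have /singleP[[x m] [pa bx _]] := sb.
have : atoms (forget psi) (x, m) by rewrite fpsi.
move=> /forget_atomsP[m' [pa' ua]]; exists (x, (m, m')); split; first by split.
by split => //; split => //; apply/(ua b).
Qed.

(** Preimages of decided sets form a sigma-algebra [G]. It contains every event because the
    identity, from configurations equipped with [G], is measurable by the counting criterion. *)
Lemma mark_code_generates (B : set NMM) : measurable B ->
  exists2 S, decided S & B = (fun psi => (forget psi, mark_code psi)) @^-1` S.
Proof.
pose coded (psi : NMM) := (forget psi, mark_code psi).
pose G : set_system NMM := [set coded @^-1` S | S in decided].
have sG : sigma_algebra setT G.
  have [s0 sC sU] := smallest_sigma_algebra setT (@finitely_decided _ NM (name * nat)%type).
  split; first by exists set0 => //; rewrite preimage_set0.
    by move=> _ [S dS <-]; exists (~` S); [exact: sigma_algebra_setC|rewrite setTD].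
  move=> F GF; have /choice[S SF] : forall n, exists S, decided S /\ coded @^-1` S = F n.
    by move=> n; have [S dS SF] := GF n; exists S.
  exists (\bigcup_n S n); first by apply: sU => n; case: (SF n).
  by rewrite preimage_bigcup; apply: eq_bigcupr => n _; case: (SF n).
pose X' := g_sigma_algebraType G.
have X'_measurable S : decided S -> measurable (coded @^-1` S : set X').
  by move=> dS; apply: sub_gen_smallest; exists S.
have X'single (W : set 'rV[R]_d) : open W ->
    measurable ([set psi | single W (forget psi)] : set X').
  move=> oW; apply: (X'_measurable [set p | single W p.1]); apply: sub_gen_smallest.
  exact: (finitely_decided_base (measurable_single oW)).
(* An atom lies in an open set exactly when some basic box inside that set contains it, with a ball
   that isolates it. The bit then tests its [M']-mark and the base configuration its [M]-mark. *)
have X'meet (O : set ('rV[R]_d * (M * M'))) : open O ->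
    measurable ([set psi | atoms psi `&` O !=set0] : set X').
  move=> oO.
  pose I := (name * (nat * nat))%type.
  pose box (i : I) : set ('rV[R]_d * (M * M')) := rball i.1 `*` (VM i.2.1 `*` V i.2.2).
  rewrite (_ : mkset _ = \bigcup_(i : I) (if `[< box i `<=` O >] then
     [set psi | single (rball i.1) (forget psi)] `&`
     ([set psi | atoms (forget psi) `&` (rball i.1 `*` VM i.2.1) !=set0] `&`
      [set psi | mark_code psi (i.1, i.2.2)]) else set0)).
    apply: countable_bigcupT_measurable; first exact: countableP.
    move=> i; case: ifP => // _; apply: measurableI; first exact: X'single (@open_rball _ _ _).
    apply: measurableI.
      apply: (X'_measurable [set p | atoms p.1 `&` (rball i.1 `*` VM i.2.1) !=set0]).
      apply: sub_gen_smallest.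
      have mA : measurable [set phi : NM | atoms phi `&` (rball i.1 `*` VM i.2.1) !=set0].
        apply: measurable_atoms_meet; apply: sub_gen_smallest; apply: open_setX => //.
        exact: open_rball.
      exact: (finitely_decided_base mA).
    apply: (X'_measurable [set p : NM * code | p.2 (i.1, i.2.2)]).
    by apply: sub_gen_smallest; exact: finitely_decided_bit.
  apply/seteqP; split => [psi [[x [m m']] [pa Oa]]|psi [i _]].
    have [[W1 W2] [/= xW1 [[A1 A2] [/= mA1 mA2] A12]] W12] : nbhs (x, (m, m')) O.
      exact: open_nbhs_nbhs.
    have [l ml lA1] := bVM mA1; have [k [mk kA2 _]] := bV mA2.
    have [b [xb bW1 ub]] := atom_isolated (forget_atoms pa) xW1.
    have sb : single (rball b) (forget psi).
      apply/singleP; exists (x, m); split => //; first exact: (forget_atoms pa).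
      by move=> a' pa' ba'; apply: ub => //; exact: rball_cball.
    exists (b, (l, k)) => //; rewrite asboolT.
      split => //=; split; first by exists (x, m); split => //; exact: (forget_atoms pa).
      by apply/asboolP; split => //; exists (x, (m, m')).
    move=> [y [n n']] [/= by_ [ln kn']]; apply: W12; split => /=.
      exact/bW1/rball_cball.
    by apply: A12; split => /=; [exact: lA1|exact/kA2/subset_closure].
  case: asboolP => // boxO [sb [[[x m] [pa [/= bx Vm]]] /asboolP[_ [[y [l l']] [pa' [/= b'y [_ Vl']]]]]]].
  exists (y, (l, l')); split => //; apply: boxO; split => //; split => //=.
  move: sb => /singleP[a0 [_ _ u0]].
  have := u0 _ (forget_atoms pa') b'y; rewrite -(u0 _ pa bx) => -[_ ml].
  by rewrite ml.
(* Induction by deleting an atom: there are at least [n + 1] atoms in [U] when some ball meets them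
   and at least [n] remain outside its closed ball; for the converse, the ball is chosen to isolate
   one atom. *)
have X'ge n : forall U N, open U -> U `<=` window N `*` setT ->
    measurable ([set psi | (n%:R%:E <= card_sum (R := R) (atoms psi `&` U))%E] : set X').
  elim: n => [|n IH] U N oU UN.
    by rewrite (_ : mkset _ = setT)//; apply/seteqP; split => // psi _; exact: card_sum_ge0.
  have fin (psi : NMM) W : finite_set (atoms psi `&` (U `&` W)).
    by apply: sub_finite_set (config_locfin psi (window_bounded N)) => a [pa [/UN[]]].
  rewrite (_ : mkset _ = \bigcup_(b : name)
    ([set psi | atoms psi `&` (U `&` (rball b `*` setT)) !=set0] `&`
     [set psi | (n%:R%:E <= card_sum (R := R) (atoms psi `&` (U `&` (~` cball b `*` setT))))%E])).
    apply: countable_bigcupT_measurable; first exact: countableP.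
    move=> b; apply: measurableI.
      apply: X'meet; apply: openI => //; apply: open_setX; last exact: openT.
      exact: open_rball.
    apply: (IH _ N); last by move=> a [/UN].
    apply: openI => //; apply: open_setX; last exact: openT.
    by apply: closed_openC; exact: closed_cball.
  have split_card b (psi : NMM) : card_sum (R := R) (atoms psi `&` U) =
     (card_sum (R := R) (atoms psi `&` (U `&` (cball b `*` setT))) +
      card_sum (R := R) (atoms psi `&` (U `&` (~` cball b `*` setT))))%E.
    rewrite (card_sumID _ (cball b `*` setT)) -!setIA; congr (_ + card_sum (_ `&` (_ `&` _)))%E.
    by apply/seteqP; split => [a na|a [na _] [/= ca _]//]; split => // ca; apply: na.
  apply/seteqP; split => [psi /= nA|psi [b _ [meet nA]]] /=.
    have finU : finite_set (atoms psi `&` U) by rewrite -(setIT U); exact: fin.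
    have /(card_sum_gt0 finU)[a [pa Ua]] : (1 <= card_sum (R := R) (atoms psi `&` U))%E.
      by apply: le_trans nA; rewrite lee_fin ler1n.
    have [b [ab _ ub]] := atom_isolated pa (filterT : nbhs a.1 setT).
    exists b => //; split; first by exists a; do !split.
    have := split_card b psi.
    have -> : atoms psi `&` (U `&` (cball b `*` setT)) = [set a].
      apply/seteqP; split => [a' [pa' [_ [ca' _]]]|_ ->]; first exact: ub.
      by do !split => //; exact: rball_cball.
    rewrite {2}/card_sum esum_set1// => cE; move: nA; rewrite /= cE.
    by rewrite -natr1 EFinD addeC leeD2lE.
  rewrite (split_card b) -natr1 EFinD addeC leeD//.
  apply/card_sum_gt0; first exact: fin.
  by move: meet => [a [pa [Ua [ba _]]]]; exists a; do !split => //; exact: rball_cball.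
have mid : measurable_fun setT (id : X' -> NMM).
  apply: measurable_config_fun => N U oU; apply: measurable_fun_nat_valued => [psi|n].
    exact: count_nat.
  have oW : open (windowed N U) by exact: open_windowed.
  have WN : windowed N U `<=` window N `*` setT by move=> a [].
  rewrite (_ : mkset _ = [set psi | (n%:R%:E <= card_sum (R := R) (atoms psi `&` windowed N U))%E] `\`
     [set psi | (n.+1%:R%:E <= card_sum (R := R) (atoms psi `&` windowed N U))%E]).
    by apply: measurableD; exact: (X'ge _ _ N).
  apply/seteqP; split => psi /=; rewrite /count.
    by move=> ->; rewrite !lee_fin lexx ler_nat ltnn.
  have [k kE] := count_nat psi N U; rewrite /count in kE; rewrite kE !lee_fin !ler_nat.
  by move=> [nk /negP]; rewrite -ltnNge ltnS => kn; congr (_%:R%:E); apply/eqP; rewrite eqn_leq nk kn.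
move=> mB; have : measurable (B : set X') by have := mid measurableT B mB; rewrite setTI.
suff : <<s G >> `<=` G by move=> /[apply] -[S dS SB]; exists S.
exact: smallest_sub.
Qed.

End Coding.

(** * Measurability of shifts and point sums *)

Section ShiftMeasurability.
Import HBSimple HBNNSimple.
Context {R : realType} {d : nat} {K : topologicalType}.
Local Notation V := 'rV[R]_d.
Local Notation borel := (g_sigma_algebraType (@open V)).
Local Notation conf := (config R d K).
Local Open Scope ereal_scope.

Lemma atoms_shift (x : V) (psi : conf) z k :
  atoms (shift x psi) (z, k) <-> atoms psi (z + x, k)%R.
Proof.
split => [[[y l] pa [<- <-]]|pa]; first by rewrite subrK.
by exists (z + x, k)%R => //=; rewrite addrK.
Qed.

Lemma shift_shift (x y : V) (psi : conf) : shift x (shift y psi) = shift (x + y) psi.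
Proof.
apply: config_ext; apply/seteqP; split => -[z k] /atoms_shift.
  by move=> /atoms_shift pa; apply/atoms_shift; rewrite addrA.
by rewrite addrA => pa; apply/atoms_shift/atoms_shift.
Qed.

Lemma locations_shift (x : V) (psi : conf) z :
  locations (shift x psi) z <-> locations psi (z + x)%R.
Proof.
split => [[[y k] /atoms_shift pa /= <-]|[[y k] pa /= yz]]; first by exists (y + x, k)%R.
by exists (z, k) => //; apply/atoms_shift; rewrite -yz.
Qed.

Lemma card_shift (x : V) (psi : conf) (W : set (V * K)) :
  card_sum (R := R) (atoms (shift x psi) `&` W) =
  card_sum (atoms psi `&` [set a | W (a.1 - x, a.2)%R]).
Proof.
rewrite -[RHS](card_sum_image (f := fun a => (a.1 - x, a.2)%R)) /=; last first.
  by move=> [z k] [y l] _ _ [/addIr -> ->].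
congr card_sum; apply/seteqP; split => [_ [[a pa <-] Wa]|_ [a [pa Wa] <-]].
  by exists a.
by split => //; exists a.
Qed.

(** Joint measurability from a countable union of rectangles. Finitely many atoms that the shift by
    [x] puts in the open set [W] are still put there by all shifts in a small rational ball around
    [x]; [Wb b] is the open set of atoms with this property for all shifts in [b]. *)
Lemma measurable_ge_card_shift (W : set (V * K)) N n : open W -> W `<=` window N `*` setT ->
  measurable ([set p : borel * conf |
    n%:R%:E <= card_sum (R := R) (atoms (shift p.1 p.2) `&` W)]).
Proof.
move=> oW WN.
pose Wb (b : 'rV[rat]_d * nat) := interior [set a : V * K | forall u, rball b u -> W (a.1 - u, a.2)%R].
(* A ball contains its own centre, so an atom of [Wb b] is a translate by this centre of an atom
   position in the window [N]. *)
pose Nb (b : 'rV[rat]_d * nat) := (N + (Num.trunc `|@center R d b|).+1)%N.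
have cb (b : 'rV[rat]_d * nat) : rball b (@center R d b).
  by rewrite /rball /= subrr normr0 invr_gt0.
have WbN b : Wb b `<=` window (Nb b) `*` setT.
  move=> a /interior_subset/(_ _ (cb b))/WN[/= aN _]; split => //=.
  rewrite /window /= -[a.1](subrK (center b)) (le_lt_trans (ler_normD _ _))//.
  by rewrite natrD ltrD//; exact: truncnS_gt.
rewrite (_ : mkset _ = \bigcup_(b : 'rV[rat]_d * nat)
   ((rball b : set borel) `*`
    [set psi : conf | n%:R%:E <= count psi (Nb b) (Wb b)])).
  apply: countable_bigcupT_measurable; first exact: countableP.
  move=> b; apply: measurableX; first by apply: sub_gen_smallest; exact: open_rball.
  rewrite -[X in measurable X]setTI; apply: emeasurable_fun_c_infty => //.
  by apply: measurable_count; apply: sub_gen_smallest; exact: open_interior.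
have countE psi b : count psi (Nb b) (Wb b) = card_sum (R := R) (atoms psi `&` Wb b).
  by rewrite /count /windowed (setIidl (@WbN b)).
apply/seteqP; split => [[x psi] /= nc|[x psi] [b _ [/= bx]]]; last first.
  rewrite countE card_shift => /le_trans; apply; apply: card_sum_subset.
  by move=> a [pa /interior_subset/(_ _ bx) Wa].
move: nc; rewrite card_shift.
set A := atoms psi `&` _ => nA.
have fA : finite_set A.
  have bB : bounded_set ((fun z => z - x)%R @^-1` window N).
    by apply: bounded_set_shift; exact: window_bounded.
  by apply: sub_finite_set (config_locfin psi bB) => a [pa /WN[]].
(* One half of the tolerance of each atom is for moving the atom, since [Wb] is an interior, the
   other half for varying the shift. *)
have /choice[e eP] : forall a, exists e : R, (0 < e)%R /\ (A a ->
    forall b, rball b `<=` ball x e -> Wb b a).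
  move=> [z k]; have [[pa Wa]|nA'] := pselect (A (z, k)); last by exists 1%R.
  have [[U1 U2] [/= zU1 kU2] U12] : nbhs (z - x, k)%R W by exact: open_nbhs_nbhs.
  have [e /= e0 eU1] := (nbhs_ballP _ _).1 zU1.
  have e20 : (0 < e / 2)%R by rewrite divr_gt0.
  exists (e / 2)%R; split => // _ b bxe.
  exists (ball z (e / 2), U2) => [|[y l] [/= yz lU2] u /bxe xu]; first by split => //; exact: nbhsx_ballx.
  apply: U12; split => //=; apply: eU1; move: yz xu; rewrite -!ball_normE /=.
  have -> : (z - x - (y - u) = (z - y) - (x - u))%R.
    by rewrite !opprB addrACA [RHS]addrACA; congr (_ + _)%R; rewrite addrC.
  by move=> yz xu; rewrite [e]splitr (le_lt_trans (ler_normB _ _))// ltrD.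
have xA : nbhs x (\bigcap_(a in A) ball x (e a)).
  have /finite_fsetP[X ->] := fA; apply: filter_bigI => a _.
  by apply: nbhsx_ballx; case: (eP a).
have [b bx bA] := rball_base xA.
exists b => //; split => //=; rewrite countE.
rewrite (_ : atoms psi `&` Wb b = A)//.
apply/seteqP; split => [a [pa /interior_subset/(_ _ bx)//]|a Aa].
split; first by case: Aa.
have [_] := eP a; apply => // y /rball_cball/bA; exact.
Qed.

Lemma measurable_shift_joint :
  measurable_fun setT (fun p : borel * conf => shift p.1 p.2).
Proof.
apply: measurable_config_fun => N U oU; apply: measurable_fun_nat_valued => [p|n].
  exact: count_nat.
have oW : open (windowed N U) by exact: open_windowed.
have WN : windowed N U `<=` window N `*` setT by move=> a [].
rewrite (_ : mkset _ = [set p : borel * conf |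
     n%:R%:E <= card_sum (R := R) (atoms (shift p.1 p.2) `&` windowed N U)] `\`
   [set p : borel * conf |
     n.+1%:R%:E <= card_sum (R := R) (atoms (shift p.1 p.2) `&` windowed N U)]).
  by apply: measurableD; exact: (measurable_ge_card_shift _ oW WN).
apply/seteqP; split => p /=; rewrite /count.
  by move=> ->; rewrite !lee_fin lexx ler_nat ltnn.
have [k kE] := count_nat (R := R) (shift p.1 p.2) N U; rewrite /count in kE.
rewrite kE !lee_fin !ler_nat => -[nk /negP]; rewrite -ltnNge ltnS => kn.
by congr (_%:R%:E); apply/eqP; rewrite eqn_leq nk kn.
Qed.

Lemma measurable_shift (x : V) : measurable_fun setT (shift x : conf -> conf).
Proof.
rewrite (_ : shift x = (fun p : borel * conf => shift p.1 p.2) \o (pair x))//.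
apply: measurableT_comp; first exact: measurable_shift_joint.
exact: measurable_pair1.
Qed.

Definition location_sum (W : set V) (F : V -> conf -> \bar R) (psi : conf) : \bar R :=
  \esum_(x in locations psi `&` W) F x psi.

Lemma finite_locations (W : set V) (psi : conf) : bounded_set W -> finite_set (locations psi `&` W).
Proof.
move=> bW; apply: sub_finite_set (finite_image fst (config_locfin psi bW)).
by move=> x [[a pa <-] Wa]; exists a.
Qed.

Lemma card_locations (W : set V) (psi : conf) :
  card_sum (R := R) (locations psi `&` W) = card_sum (atoms psi `&` (W `*` setT)).
Proof.
rewrite -(card_sum_image (A := atoms psi `&` (W `*` setT)) (f := fst)).
  congr card_sum; apply/seteqP; split => [x [[a pa <-] Wa]|_ [a [pa [Wa _]] <-]].
    by exists a.
  by split => //; exists a.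
exact: (set_inj_atoms (g := id)).
Qed.

(** Dynkin's argument over rectangles; the bounded window keeps the counts finite, so that
    complements amount to subtraction. *)
Lemma measurable_card_locations_in (W : set V) (E : set (borel * conf)) N :
  <<s open >> W -> W `<=` window N -> measurable E ->
  measurable_fun setT (fun psi : conf =>
    card_sum (R := R) (locations psi `&` W `&` [set x | E (x, psi)])).
Proof.
move=> mW WN; have bW : bounded_set W.
  have [r [rr rW]] := window_bounded (R := R) (d := d) N.
  by exists r; split => // M rM x /WN; exact: rW.
have mcount (A : set V) : <<s open >> A ->
    measurable_fun setT (fun psi : conf => card_sum (R := R) (locations psi `&` (W `&` A))).
  move=> mA; rewrite (_ : (fun psi : conf => _) = fun psi => count psi N ((W `&` A) `*` setT)).
    apply: measurable_count.
    have -> : (W `&` A) `*` [set: K] = fst @^-1` (W `&` A) by apply/seteqP; split => // a [].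
    suff : <<s @open V >> `<=` [set B | <<s @open (V * K)%type >> (fst @^-1` B)].
      by apply; exact: sigma_algebra_setI.
    have [s0 sC sU] := smallest_sigma_algebra setT (@open (V * K)%type).
    apply: smallest_sub => [|B oB]; last first.
      apply: sub_gen_smallest; apply: open_comp oB => -[x k] _; exact: cvg_fst.
    split => [|B mB|F mF] /=; first by rewrite preimage_set0.
      by rewrite setTD; exact: sigma_algebra_setC mB.
    by rewrite preimage_bigcup; exact: sU.
  apply/funext => psi; rewrite card_locations /count; congr (card_sum (_ `&` _)).
  by apply/seteqP; split => [a [[Wa Aa] _]|a [[]]] //; do !split => //; exact: WN.
rewrite (_ : measurable E = <<s [set A `*` B | A in @measurable _ borel & B in @measurable _ conf] >> E); last first.
  by rewrite measurable_prod_measurableType.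
move: E; apply: dynkin_class.
- move=> _ _ [A1 mA1 [B1 mB1 <-]] [A2 mA2 [B2 mB2 <-]]; exists (A1 `&` A2); first exact: measurableI.
  by exists (B1 `&` B2); [exact: measurableI|rewrite setXI].
- rewrite (_ : (fun psi => _) = fun psi : conf => card_sum (R := R) (locations psi `&` (W `&` setT))).
    by apply: mcount; apply: sub_gen_smallest; exact: openT.
  by apply/funext => psi; rewrite setIT; congr card_sum; apply/seteqP; split => // x [].
- move=> _ [A mA [B mB <-]].
  rewrite (_ : (fun psi => _) = fun psi : conf => (\1_B psi)%:E * card_sum (R := R) (locations psi `&` (W `&` A))).
    apply: emeasurable_funM; last exact: mcount.
    by apply/measurable_EFinP; exact: measurable_indic.
  apply/funext => psi; rewrite indicE.
  have [/set_mem Bpsi|/negP nB] := boolP (psi \in B); rewrite ?mul1e ?mul0e.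
    by congr card_sum; rewrite setIA; apply/seteqP; split => [x [Wx []]|x [Wx Ax]].
  rewrite (_ : _ `&` _ = set0) ?/card_sum ?esum_set0//; apply/seteqP; split => // x [_ [_ /= Bx]].
  by case: nB; rewrite inE.
- move=> S _ mS.
  rewrite (_ : (fun psi => _) = fun psi : conf => card_sum (R := R) (locations psi `&` (W `&` setT)) -
     card_sum (R := R) (locations psi `&` W `&` [set x | S (x, psi)])).
    apply: emeasurable_funB => //.
    by apply: mcount; apply: sub_gen_smallest; exact: openT.
  apply/funext => psi; rewrite setIT [in RHS](card_sumID _ [set x | S (x, psi)]).
  rewrite addeAC subee ?add0e//; apply: card_sum_fin_num.
  by apply: sub_finite_set (finite_locations psi bW) => x [].
- move=> F _ tF mF.
  rewrite (_ : (fun psi => _) = fun psi : conf => \sum_(0 <= k <oo) card_sum (R := R) (locations psi `&` W `&` [set x | F k (x, psi)])).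
    by apply: ge0_emeasurable_sum => // k *; exact: card_sum_ge0.
  apply/funext => psi; rewrite -card_sum_bigcup.
    by congr card_sum; rewrite -setI_bigcupr.
  by move=> i j _ _ [x [[_ Fi] [_ Fj]]]; apply: (tF i j) => //; exists (x, psi).
Qed.

Lemma location_sum_indic (W : set V) (E : set (V * conf)) (psi : conf) :
  location_sum W (fun x psi => (\1_E (x, psi))%:E) psi =
  card_sum (R := R) (locations psi `&` W `&` [set x | E (x, psi)]).
Proof.
rewrite /card_sum [RHS]esum_mkcondr; apply: eq_esum => x _; rewrite indicE.
by case: (boolP ((x, psi) \in E)) => [/set_mem|/negP] xE; [rewrite mem_set|rewrite memNset// => /= Ex; apply: xE; rewrite inE].
Qed.

Lemma measurable_location_sum (W : set V) (F : borel * conf -> \bar R) N :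
  <<s open >> W -> W `<=` window N ->
  measurable_fun setT F -> (forall p, 0 <= F p) ->
  measurable_fun setT (location_sum W (fun x psi => F (x, psi))).
Proof.
move=> mW WN mF F0; have bW : bounded_set W.
  have [r [rr rW]] := window_bounded (R := R) (d := d) N.
  by exists r; split => // M rM x /WN; exact: rW.
pose F_ := nnsfun_approx measurableT mF.
have sumE (G : V * conf -> \bar R) psi : (forall p, 0 <= G p) ->
    location_sum W (fun x psi => G (x, psi)) psi =
    \sum_(x <- fset_set (locations psi `&` W)) G (x, psi).
  by move=> G0; rewrite /location_sum esum_fset ?fsbig_finite//; exact: finite_locations.
have mlim n : measurable_fun setT (location_sum W (fun x psi => (F_ n (x, psi))%:E)).
  rewrite (_ : location_sum _ _ = fun psi => \sum_(y <- fset_set (range (F_ n)))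
     (y%:E * location_sum W (fun x psi => (\1_(F_ n @^-1` [set y]) (x, psi))%:E) psi)).
    apply: emeasurable_sum => y; apply: emeasurable_funM => //.
    rewrite (_ : location_sum _ _ = fun psi => card_sum (R := R) (locations psi `&` W `&` [set x | (F_ n @^-1` [set y]) (x, psi)])); last first.
      by apply/funext => psi; rewrite location_sum_indic.
    apply: (measurable_card_locations_in (E := F_ n @^-1` [set y]) mW WN).
    by rewrite -[X in measurable X]setTI; apply: measurable_funPT.
  apply/funext => psi; rewrite (sumE (EFin \o F_ n)) /=; last by move=> q; rewrite lee_fin.
  under eq_bigr do rewrite fimfunE fsbig_finite//= -sumEFin.
  rewrite exchange_big/=; apply: eq_big_seq => y; rewrite in_fset_set// inE => -[p _ <-].
  under eq_bigr do rewrite EFinM.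
  rewrite (sumE (fun q => (\1_(F_ n @^-1` [set F_ n p]) q)%:E)); last by move=> q; rewrite lee_fin.
  by rewrite ge0_sume_distrr// => q _; rewrite lee_fin.
refine (emeasurable_fun_cvg _ _ mlim _).
move=> psi _; rewrite sumE//.
rewrite (_ : (fun n => _) = fun n => \sum_(x <- fset_set (locations psi `&` W)) (F_ n (x, psi))%:E); last first.
  by apply/funext => n; rewrite (sumE (EFin \o F_ n))// => q; rewrite lee_fin.
apply: cvg_nnesum => [x _|x _]; first by apply: nearW => n; rewrite lee_fin.
exact: cvg_nnsfun_approx.
Qed.

Lemma measurable_sum_shift (W : set V) (h : conf -> \bar R) N :
  <<s open >> W -> W `<=` window N ->
  measurable_fun setT h -> (forall psi, 0 <= h psi) ->
  measurable_fun setT (location_sum W (fun x psi => h (shift x psi))).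
Proof.
move=> mW WN mh h0.
apply: (measurable_location_sum (F := fun p => h (shift p.1 p.2)) mW WN) => //.
by apply: measurableT_comp => //; exact: measurable_shift_joint.
Qed.

End ShiftMeasurability.

(** * Local optimality and stabilization *)

Section ScoreSub.
Context {R : realType}.
Local Open Scope ereal_scope.
Implicit Types a b c : \bar R.

Lemma score_subxx a : a <> +oo -> score_sub a a = 0.
Proof. by case: a => [r| |]//= _; rewrite /score_sub ?eqxx//= subee. Qed.

Lemma score_sub_fin (r s : R) : score_sub r%:E s%:E = (r - s)%:E.
Proof. by []. Qed.

Lemma score_sub_ge0 a b : 0 <= score_sub b a -> a <= b.
Proof.
case: a b => [r| |] [s| |]//=; rewrite /score_sub/= ?leNye ?leey//.
by rewrite lee_fin subr_ge0.
Qed.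

Lemma score_sub_triangle a b c :
  `|score_sub a c| <= `|score_sub a b| + `|score_sub b c|.
Proof.
case: a b c => [r| |] [s| |] [t| |]; rewrite /score_sub//= ?leey ?abse0 ?add0e ?addr0//.
rewrite -EFinD lee_fin.
by rewrite (le_trans _ (ler_normD _ _))// addrA subrK.
by rewrite normr0 adde0.
Qed.

(** A finite distance to a finite score excludes [-oo]. This is how majorants and stabilization
    ensure that competitors have finite scores. *)
Lemma score_sub_abse_fin a (s e : R) : `|score_sub a s%:E| <= e%:E ->
  exists2 r : R, a = r%:E & (`|r - s| <= e)%R.
Proof. by case: a => [r| |]//= ; rewrite /score_sub/= ?lee_fin; exists r. Qed.

Lemma score_subC_abse a b : `|score_sub a b| = `|score_sub b a|.
Proof. by case: a b => [r| |] [s| |]//; rewrite /score_sub/= distrC. Qed.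

End ScoreSub.

Section Splicing.
Context {R : realType} {d : nat}.
Local Notation V := 'rV[R]_d.

Lemma splice_atoms (K : topologicalType) (B : set V) (psi psi' : config R d K) z k :
  atoms (splice B psi psi') (z, k) <->
  (B z /\ atoms psi (z, k)) \/ (~ B z /\ atoms psi' (z, k)).
Proof.
split; first by case=> -[pa Bz]; [left|right].
by case=> -[Bz pa]; [left|right].
Qed.

Lemma config_eqP (K : topologicalType) (psi psi' : config R d K) :
  (forall z k, atoms psi (z, k) <-> atoms psi' (z, k)) -> psi = psi'.
Proof. by move=> e; apply: config_ext; apply/seteqP; split => -[z k] /e. Qed.

Lemma splice_setC (K : topologicalType) (B : set V) (psi psi' : config R d K) :
  splice (~` B) psi psi' = splice B psi' psi.
Proof.
apply: config_eqP => z k; rewrite !splice_atoms; split => -[[h pa]|[h pa]].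
- by right.
- by left; split => //; exact: contrapT.
- by right; split => // nB.
- by left.
Qed.

Lemma locations_atoms (K : topologicalType) (psi : config R d K) z :
  locations psi z <-> exists k, atoms psi (z, k).
Proof. by split => [[[y k] pa /= <-]|[k pa]]; [exists k|exists (z, k)]. Qed.

Lemma configs_at0_shift (K : topologicalType) (psi : config R d K) x :
  locations psi x -> configs_at0 (shift x psi).
Proof.
move=> /locations_atoms[k pa]; apply: (iffRL (card_eq1P _)); exists (0%R, k).
apply/seteqP; split => [[y l] [/atoms_shift pa' /= y0]|_ ->].
  by rewrite {}y0 add0r in pa' *; rewrite (config_ground pa pa').
by split => //; apply/atoms_shift; rewrite add0r.
Qed.

Context {M M' : topologicalType}.
Local Notation NM := (config R d M).
Local Notation NMM := (config R d (M * M')%type).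

Lemma forget_shift x (psi : NMM) : forget (shift x psi) = shift x (forget psi).
Proof.
apply: config_eqP => z m; split.
  move=> /forget_atomsP[m' /atoms_shift pa]; apply/atoms_shift.
  exact: (forget_atoms pa).
move=> /atoms_shift/forget_atomsP[m' pa].
exact: (@forget_atoms _ _ _ _ _ (z, (m, m'))) ((atoms_shift _ _ _ _).2 pa).
Qed.

Lemma locations_forget (psi : NMM) : locations (forget psi) = locations psi.
Proof.
apply/seteqP; split => x /locations_atoms.
  by move=> [m /forget_atomsP[m' pa]]; apply/locations_atoms; exists (m, m').
move=> [[m m'] pa]; apply/locations_atoms; exists m; exact: (forget_atoms pa).
Qed.

Lemma forget_atomsE (psi : NMM) x m :
  atoms (forget psi) (x, m) <-> exists m', atoms psi (x, (m, m')).
Proof.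
split; first exact: forget_atomsP.
by move=> [m' pa]; exact: (forget_atoms pa).
Qed.

Lemma forget_splice (phi : NM) B (psi psi' : NMM) :
  forget psi = phi -> forget psi' = phi -> forget (splice B psi psi') = phi.
Proof.
move=> <- ff; apply: config_eqP => x m; rewrite forget_atomsE; split.
  move=> [m' /splice_atoms[[Bx pa]|[Bx pa]]]; first exact: (forget_atoms pa).
  by rewrite -ff; exact: (forget_atoms pa).
have [Bx|Bx] := pselect (B x).
  by move=> /forget_atomsP[m' pa]; exists m'; apply/splice_atoms; left.
by rewrite -ff => /forget_atomsP[m' pa]; exists m'; apply/splice_atoms; right.
Qed.

Lemma marking_locations (phi : NM) (psi : NMM) :
  forget psi = phi -> locations psi = locations phi.
Proof. by move=> <-; rewrite locations_forget. Qed.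

(** Only the trace of [W] on the locations matters, so a bounded region can be replaced by the
    finite list of its points and changed one point at a time. *)
Lemma splice_locations (phi : NM) (W : set V) (psi1 psi2 : NMM) :
  forget psi1 = phi -> forget psi2 = phi ->
  splice (locations phi `&` W) psi1 psi2 = splice W psi1 psi2.
Proof.
move=> f1 f2; apply: config_eqP => z k; rewrite !splice_atoms.
have pz psi : forget psi = phi -> atoms psi (z, k) -> locations phi z.
  by move=> fp pa; rewrite -(marking_locations fp); apply/locations_atoms; exists k.
split => -[[Wz pa]|[nWz pa]].
- by left; split => //; case: Wz.
- by right; split => // Wz; apply: nWz; split => //; exact: pz f2 pa.
- by left; split => //; split => //; exact: pz f1 pa.
- by right; split => // -[].
Qed.

Lemma splice_cons (phi : NM) y (Y : seq V) (psi1 psi2 : NMM) :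
  forget psi1 = phi -> forget psi2 = phi -> ~ (locations phi y /\ y \notin Y) ->
  splice [set` y :: Y] psi1 psi2 = splice [set` Y] psi1 psi2.
Proof.
move=> f1 f2 nyY; rewrite -(splice_locations [set` y :: Y] f1 f2).
rewrite -(splice_locations [set` Y] f1 f2); congr (splice _ psi1 psi2).
apply/seteqP; split => z [pz]; rewrite /= ?in_cons => zY; split => //=.
  move: zY => /predU1P[zy|//]; subst z.
  by apply: contrapT => /negP yY; apply: nyY.
by rewrite zY orbT.
Qed.

End Splicing.

Section Stability.
Context {R : realType} {d : nat} {M M' : topologicalType}.
Local Notation V := 'rV[R]_d.
Local Notation NM := (config R d M).
Local Notation NMM := (config R d (M * M')%type).
Variables (xi : NMM -> \bar R) (radius_of : NMM -> R) (eps : R).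
Hypothesis eps_gt0 : 0 < eps.
Local Open Scope ereal_scope.

(* The conditions of [stabilizing_radii] at the realization [phi]. *)
Definition stable_at (phi : NM) : Prop :=
  [/\ (forall psi psi', marking phi psi -> marking phi psi' ->
         restriction psi [set 0%R] = restriction psi' [set 0%R] ->
         radius_of psi = radius_of psi'),
      (forall psi psi', marking phi psi -> marking phi psi' ->
         restriction psi (cube (radius_of psi)) =
           restriction psi' (cube (radius_of psi)) ->
         `|score_sub (xi psi) (xi psi')| <= eps%:E) &
      (forall psi psi', marking phi psi -> marking phi psi' ->
         restriction psi (~` [set 0%R]) =
           restriction psi' (~` [set 0%R]) ->
         \esum_(x in locations phi `\` cube (radius_of psi))
           `|score_diff xi x psi' psi| <= eps%:E)].

Variable phi : NM.
Hypothesis stable : forall x, locations phi x -> stable_at (shift x phi).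

Lemma marking_shift x (psi : NMM) : forget psi = phi -> marking (shift x phi) (shift x psi).
Proof. by move=> <-; exact: forget_shift. Qed.

Lemma restriction_shift (K : topologicalType) x (psi psi' : config R d K) (B : set V) :
  (forall z k, B (z - x)%R -> atoms psi (z, k) <-> atoms psi' (z, k)) ->
  restriction (shift x psi) B = restriction (shift x psi') B.
Proof.
move=> e; apply/seteqP; split => -[z k] [/atoms_shift pa /= Bz]; split => //;
apply/atoms_shift.
  by apply/(e (z + x)%R k) => //; rewrite addrK.
by apply/(e (z + x)%R k) => //; rewrite addrK.
Qed.

Lemma radius_eq x (psi psi' : NMM) : locations phi x ->
  forget psi = phi -> forget psi' = phi ->
  (forall k, atoms psi (x, k) <-> atoms psi' (x, k)) ->
  radius_of (shift x psi) = radius_of (shift x psi').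
Proof.
move=> px fp fp' e; have [same _ _] := stable px.
apply: same; try exact: marking_shift.
by apply: restriction_shift => z k /= /eqP; rewrite subr_eq0 => /eqP ->.
Qed.

Lemma internal_bound x (psi psi' : NMM) (W : set V) : locations phi x ->
  forget psi = phi -> forget psi' = phi ->
  (forall z k, W z -> atoms psi (z, k) <-> atoms psi' (z, k)) ->
  (forall z, cube (radius_of (shift x psi)) (z - x)%R -> W z) ->
  `|score_diff xi x psi psi'| <= eps%:E.
Proof.
move=> px fp fp' e W_; have [_ int _] := stable px.
apply: int; try exact: marking_shift.
by apply: restriction_shift => z k /W_; exact: e.
Qed.

Lemma external_step y (psi psi' : NMM) (O : set V) : locations phi y ->
  forget psi = phi -> forget psi' = phi ->
  (forall z k, z <> y -> atoms psi (z, k) <-> atoms psi' (z, k)) ->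
  (forall x, O x -> ~ cube (radius_of (shift y psi)) (x - y)%R) ->
  \esum_(x in locations phi `&` O) `|score_diff xi x psi' psi| <= eps%:E.
Proof.
move=> py fp fp' e Oy; have [_ _ ext] := stable py.
have := ext (shift y psi) (shift y psi') (marking_shift _ fp) (marking_shift _ fp').
have -> : restriction (shift y psi) (~` [set 0%R]) = restriction (shift y psi') (~` [set 0%R]).
  apply: restriction_shift => z k nz; apply: e => zy; apply: nz => /=.
  by rewrite zy subrr.
move=> /(_ erefl); apply: le_trans.
have inj : set_inj [set: V] (fun z : V => (z + y)%R) by move=> a b _ _ /addIr.
have -> : locations phi `&` O =
    (fun z : V => (z + y)%R) @` [set z | (locations phi `&` O) (z + y)%R].
  apply/seteqP; split => [x Ox|_ [z Oz <-]//].
  by exists (x - y)%R; rewrite /= subrK.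
rewrite esum_image; last by move=> a b _ _ /addIr.
set A := [set z | _]; set B := _ `\` _.
have AB : A `<=` B.
  move=> z [pz Oz]; split; first exact/locations_shift.
  by have := Oy _ Oz; rewrite addrK.
rewrite [leRHS](esumID A) // (setIidr AB) .
apply: (@le_trans _ _ (\esum_(i in A) `|score_diff xi i (shift y psi') (shift y psi)|)).
  by apply: le_esum => z _; rewrite /score_diff !shift_shift.
by rewrite leeDl//; apply: esum_ge0.
Qed.

(** One mark is changed at a time, at a cost of [eps] each. The radius at [y] depends on the mark at
    [y] alone, still that of [psi2] when the turn of [y] comes; hence the hypothesis on radii
    concerns [psi2] only, not the intermediate markings. *)
Lemma external_chain (Y : seq V) (psi1 psi2 : NMM) (O : set V) :
  forget psi1 = phi -> forget psi2 = phi ->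
  (forall x, locations phi x -> xi (shift x psi2) <> +oo) ->
  (forall y x, y \in Y -> locations phi y -> O x ->
     ~ cube (radius_of (shift y psi2)) (x - y)%R) ->
  \esum_(x in locations phi `&` O)
     `|score_diff xi x (splice [set` Y] psi1 psi2) psi2| <= ((size Y)%:R * eps)%:E.
Proof.
move=> f1 f2 fin; elim: Y => [|y Y IH] far.
  rewrite mul0r (_ : splice _ _ _ = psi2); last first.
    by apply: config_eqP => z k; rewrite splice_atoms; split => [[[]|[]]|]//; right.
  by rewrite esum1// => x [px _]; rewrite /score_diff score_subxx ?abse0//; exact: fin.
have {}IH : \esum_(x in locations phi `&` O)
     `|score_diff xi x (splice [set` Y] psi1 psi2) psi2| <= ((size Y)%:R * eps)%:E.
  by apply: IH => z x zY; apply: far; rewrite in_cons zY orbT.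
have mono : ((size Y)%:R * eps <= (size (y :: Y))%:R * eps)%R.
  by rewrite ler_pM2r// ler_nat.
(* A repeated entry, or one that is no location, leaves the marking unchanged while the bound
   grows. *)
have [[py yY]|nyY] := pselect (locations phi y /\ y \notin Y); last first.
  rewrite (splice_cons f1 f2 nyY).
  by apply: le_trans IH _; rewrite lee_fin.
set psiY := splice [set` Y] psi1 psi2 in IH *.
set psiyY := splice _ psi1 psi2.
have fY : forget psiY = phi by exact: forget_splice.
have fyY : forget psiyY = phi by exact: forget_splice.
have step : \esum_(x in locations phi `&` O) `|score_diff xi x psiyY psiY| <= eps%:E.
  apply: (external_step (y := y)) => //.
    move=> z k zy; rewrite !splice_atoms /= in_cons.
    by rewrite (negbTE (introN eqP zy)).
  move=> x Ox; rewrite (radius_eq (psi' := psi2))//; first by apply: far => //; rewrite mem_head.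
  move=> k; rewrite splice_atoms /= (negbTE yY); split => [[[]//|[]//]|pa].
  by right.
rewrite -natr1 mulrDl mul1r EFinD addeC.
apply: le_trans (leeD step IH); rewrite -esumD//.
by apply: le_esum => x _; exact: score_sub_triangle.
Qed.

Lemma external_splice (W : set V) (psi1 psi2 : NMM) (O : set V) :
  bounded_set W -> forget psi1 = phi -> forget psi2 = phi ->
  (forall x, locations phi x -> xi (shift x psi2) <> +oo) ->
  (forall y x, W y -> locations phi y -> O x ->
     ~ cube (radius_of (shift y psi2)) (x - y)%R) ->
  \esum_(x in locations phi `&` O)
     `|score_diff xi x (splice W psi1 psi2) psi2| <=
  eps%:E * card_sum (locations phi `&` W).
Proof.
move=> bW f1 f2 fin far; have fW := finite_locations phi bW.
rewrite card_sum_fset// -EFinM mulrC.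
rewrite (_ : splice W psi1 psi2 = splice [set` fset_set (locations phi `&` W)] psi1 psi2).
  apply: external_chain => // y x; rewrite in_fset_set// inE => -[_ Wy].
  exact: far.
by rewrite fset_setK// splice_locations.
Qed.

End Stability.

Section Optimality.
Context {R : realType} {d : nat} {M M' : topologicalType}.
Local Notation V := 'rV[R]_d.
Local Notation NM := (config R d M).
Local Notation NMM := (config R d (M * M')%type).
Variables (xi : NMM -> \bar R).
Local Open Scope ereal_scope.

Lemma esum_mkfset (T : choiceType) (F A : set T) (f : T -> R) : finite_set F ->
  (forall x, F x -> A x -> (0 <= f x)%R) ->
  \esum_(x in F `&` A) (f x)%:E =
  (\sum_(x <- fset_set F) (if x \in A then f x else 0))%:E.
Proof.
move=> fF f0; rewrite esum_mkcondr esum_fset// ?fsbig_finite//=.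
  by rewrite -sumEFin; apply: eq_bigr => x _; case: ifP.
by move=> x /set_mem Fx; case: ifPn => // /set_mem Ax; rewrite lee_fin f0.
Qed.

(** Bookkeeping common to both signs of the score. By local optimality, the sum of the differences
    [s] over [W] is at most the losses outside, that is [e] per point of [W]; the lower bounds on
    [s] lose another [e] per point. For nonnegative scores [u] and [v] are the scores of the
    competitor and of the optimal marking, and [w] is 0; for nonpositive scores they are the
    absolute values in the opposite order, and [w] is the majorant. *)
Lemma local_optimality_bound (psi psin : NMM) (W W0 : set V) (e : R)
    (s u v w : V -> R) :
  locally_optimal xi psi -> forget psin = forget psi ->
  finite_set (atoms psin `\` atoms psi) ->
  bounded_set W -> W0 `<=` W ->
  diff_pos xi psin psi < +oo ->
  \esum_(x in locations psi `&` ~` W) Order.max 0 (- score_diff xi x psin psi)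
    <= e%:E * card_sum (locations psi `&` W) ->
  (forall x, locations psi x -> W x -> score_diff xi x psin psi = (s x)%:E) ->
  (forall x, locations psi x -> W0 x -> (0 <= u x)%R) ->
  (forall x, locations psi x -> W x -> (0 <= v x)%R) ->
  (forall x, locations psi x -> W x -> (0 <= w x)%R) ->
  (forall x, locations psi x -> W0 x -> (u x - v x - e <= s x)%R) ->
  (forall x, locations psi x -> W x -> ~ W0 x -> (- v x - e - w x <= s x)%R) ->
  \esum_(x in locations psi `&` W0) (u x)%:E <=
  \esum_(x in locations psi `&` W) (v x)%:E +
  \esum_(x in locations psi `&` (W `\` W0)) (w x)%:E +
  (e + e)%:E * card_sum (locations psi `&` W).
Proof.
move=> lo fp fin bW W0W dpos neg sE u0 v0 w0 W0b Wb.
have fF := finite_locations psi bW.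
set F := locations psi `&` W in fF neg *.
have inF x : x \in fset_set F -> locations psi x /\ W x.
  by rewrite in_fset_set// => /set_mem[].
have -> : locations psi `&` W0 = F `&` W0.
  by rewrite /F -setIA (setIidr W0W).
have -> : locations psi `&` (W `\` W0) = F `&` ~` W0 by rewrite /F -setIA.
have -> : \esum_(x in F) (v x)%:E = \esum_(x in F `&` setT) (v x)%:E by rewrite setIT.
rewrite !esum_mkfset//; do ?by move=> x [] *; auto.
rewrite card_sum_fset// -EFinM -!EFinD lee_fin.
have := lo psin fp fin dpos; rewrite /total_diff.
have Fneg : \esum_(x in F) Order.max 0 (- score_diff xi x psin psi) =
    (\sum_(x <- fset_set F) Order.max 0 (- s x))%:E.
  rewrite esum_fset//; last by move=> x _; rewrite le_max lexx.
  rewrite fsbig_finite//= -sumEFin; apply: eq_big_seq => x /inF[px Wx].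
  by rewrite sE// -EFinN -EFin_max.
have Fpos : \esum_(x in F) Order.max 0 (score_diff xi x psin psi) =
    (\sum_(x <- fset_set F) Order.max 0 (s x))%:E.
  rewrite esum_fset//; last by move=> x _; rewrite le_max lexx.
  rewrite fsbig_finite//= -sumEFin; apply: eq_big_seq => x /inF[px Wx].
  by rewrite sE// -EFin_max.
have negE : diff_neg xi psin psi <= (\sum_(x <- fset_set F) Order.max 0 (- s x) +
     e * (#|` fset_set F|)%:R)%:E.
  rewrite /diff_neg (esumID W); last by move=> x _; rewrite le_max lexx.
  by rewrite -/F Fneg EFinD leeD2l// EFinM -card_sum_fset.
have posE : (\sum_(x <- fset_set F) Order.max 0 (s x))%:E <= diff_pos xi psin psi.
  rewrite -Fpos /diff_pos [leRHS](esumID W); last by move=> x _; rewrite le_max lexx.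
  by rewrite leeDl//; apply: esum_ge0 => x _; rewrite le_max lexx.
have nfin : diff_neg xi psin psi \is a fin_num.
  rewrite ge0_fin_numE; first by rewrite (le_lt_trans negE)// ltry.
  by apply: esum_ge0 => x _; rewrite le_max lexx.
rewrite sube_le0 => pn.
have := le_trans posE (le_trans pn negE); rewrite lee_fin => spn.
have sumE : (\sum_(x <- fset_set F) e = e * (#|` fset_set F|)%:R)%R.
  by rewrite big_const_seq count_predT iter_addr_0 mulr_natr.
have sumS : (\sum_(x <- fset_set F) s x <= e * (#|` fset_set F|)%:R)%R.
  rewrite (eq_bigr (fun x => Num.max 0 (s x) - Num.max 0 (- s x))%R); last first.
    move=> x _; have [s0|s0] := leP 0%R (s x).
      by rewrite max_l ?subr0// oppr_le0.
    by rewrite max_r ?sub0r ?opprK// ?oppr_ge0 ltW.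
  by rewrite sumrB lerBlDl.
rewrite mulrDl addrA.
apply: le_trans (lerD (lerD (lexx _) (lexx _)) sumS).
apply: (@le_trans _ _ (\sum_(x <- fset_set F)
   (((if x \in setT then v x else 0) + (if x \in ~` W0 then w x else 0) + e) + s x))%R).
  rewrite big_seq [leRHS]big_seq; apply: ler_sum => x /inF[px Wx].
  rewrite in_setT in_setC; case: (boolP (x \in W0)) => [/set_mem W0x|/negP nW0] /=.
    have := W0b x px W0x; rewrite lerBlDr lerBlDr => /le_trans; apply.
    by rewrite addr0 addrC addrAC addrA.
  by have := Wb x px Wx (fun h => nW0 (mem_set h)); lra.
rewrite !big_split/= sumE lerD2r.
by rewrite !lexx.
Qed.

Lemma diff_pos_fin (psi psin : NMM) (W : set V) : bounded_set W ->
  (forall x, locations psi x -> W x -> score_diff xi x psin psi < +oo) ->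
  \esum_(x in locations psi `&` ~` W) `|score_diff xi x psin psi| < +oo ->
  diff_pos xi psin psi < +oo.
Proof.
move=> bW fin out; rewrite /diff_pos (esumID W); last by move=> x _; rewrite le_max lexx.
apply: lte_add_pinfty.
  have fF := finite_locations psi bW.
  rewrite esum_fset//; last by move=> x _; rewrite le_max lexx.
  rewrite fsbig_finite//= big_seq; apply: lte_sum_pinfty => x; rewrite in_fset_set// => /set_mem[px Wx].
  by rewrite gt_max ltry fin.
apply: le_lt_trans out; apply: le_esum => x _.
by rewrite ge_max abse_ge0 lee_abs.
Qed.

End Optimality.

(** * Nested cubes and the deterministic comparison *)

Section Boxes.
Context {R : realType} {d : nat}.
Local Notation V := 'rV[R]_d.

(** Half-open with integer corners, so that translates of [box 0 1] tile these cubes exactly. *)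
Definition box (lo hi : nat) : set V :=
  [set x | forall i, lo%:R <= x ord0 i < hi%:R].

Lemma box_subset lo hi lo' hi' : (lo' <= lo)%N -> (hi <= hi')%N ->
  box lo hi `<=` box lo' hi'.
Proof.
move=> ll hh x bx i; have /andP[lx xh] := bx i; apply/andP; split.
  by apply: le_trans lx; rewrite ler_nat.
by apply: lt_le_trans xh _; rewrite ler_nat.
Qed.

Lemma box_window lo hi : box lo hi `<=` window hi.+1.
Proof.
move=> x bx; suff : ball (0 : V) hi.+1%:R x by rewrite -ball_normE /window /= sub0r normrN.
split => // i j; rewrite ord1 mxE -ball_normE /= sub0r normrN.
have /andP[lx xh] := bx j; rewrite ger0_norm; last by apply: le_trans lx; rewrite ler0n.
by apply: lt_trans xh _; rewrite ltr_nat.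
Qed.

Lemma bounded_box lo hi : bounded_set (box lo hi).
Proof.
have [r [rr rW]] := window_bounded (R := R) (d := d) hi.+1.
by exists r; split => // M rM x /box_window; exact: rW.
Qed.

Lemma borel_closed (A : set V) : closed A -> <<s open >> A.
Proof.
move=> cA; rewrite -(setCK A); apply: sigma_algebra_setC; apply: sub_gen_smallest.
exact: closed_openC.
Qed.

Lemma borel_box lo hi : <<s open >> (box lo hi).
Proof.
have cc (i : 'I_d) : continuous (fun x : V => x ord0 i) by exact: coord_continuous.
apply: sigma_algebra_forall => i.
rewrite (_ : (fun p : V => _) = [set x : V | lo%:R <= x ord0 i] `&` ~` [set x : V | hi%:R <= x ord0 i]).
  apply: sigma_algebra_setI; [|apply: sigma_algebra_setC]; apply: borel_closed;
  [apply: (preimage_closed (f := fun x : V => x ord0 i) _ (@closed_ge _ lo%:R)) => x _; exact: cc|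
   apply: (preimage_closed (f := fun x : V => x ord0 i) _ (@closed_ge _ hi%:R)) => x _; exact: cc].
apply/seteqP; split => x /=; first by move=> /andP[-> h]; split => //; apply/negP; rewrite -ltNge.
by move=> [-> /negP]; rewrite -ltNge.
Qed.

(** [cube r] has half-side [r / 2], so a radius of at most [2 * k] does not reach beyond the gap
    [k]. *)
Lemma box_enlarge lo hi lo' hi' k (x z : V) r : r <= (2 * k)%:R ->
  (lo' + k <= lo)%N -> (hi + k <= hi')%N ->
  box lo hi x -> cube r (z - x) -> box lo' hi' z.
Proof.
rewrite -!(ler_nat R) natrM !natrD => rk ll hh bx cz i.
move: (bx i) (cz i); rewrite !mxE; lra.
Qed.

End Boxes.

Section LocalBound.
Context {R : realType} {d : nat} {M M' : topologicalType}.
Local Notation V := 'rV[R]_d.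
Local Notation NM := (config R d M).
Local Notation NMM := (config R d (M * M')%type).
Variables (xi : NMM -> \bar R) (radius_of : NMM -> R) (eps : R).
Hypothesis eps_gt0 : 0 < eps.
Variable phi : NM.
Hypothesis stable : forall x, locations phi x -> stable_at xi radius_of eps (shift x phi).
Variables (k m : nat).
(** Four cubes with consecutive gaps [k]. The competing scores are collected in [W0], the radii are
    controlled in [W2], and [W1] separates the two; [W3] serves to make the total gain finite for
    nonnegative scores. *)
Local Notation W3 := (@box R d 0 (6 * k + m)).
Local Notation W2 := (@box R d k (5 * k + m)).
Local Notation W1 := (@box R d (2 * k) (4 * k + m)).
Local Notation W0 := (@box R d (3 * k) (3 * k + m)).
Variables psi psi' : NMM.
Hypothesis fpsi : forget psi = phi.
Hypothesis fpsi' : forget psi' = phi.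
Hypothesis adm : admissible xi psi.
Hypothesis adm' : admissible xi psi'.
Hypothesis small : forall y, locations phi y -> W2 y -> radius_of (shift y psi) <= (2 * k)%:R.
Hypothesis small' : forall y, locations phi y -> W2 y -> radius_of (shift y psi') <= (2 * k)%:R.
Hypothesis optimal : locally_optimal xi psi.
Local Open Scope ereal_scope.

Let W01 : W0 `<=` W1. Proof. by apply: box_subset; lia. Qed.
Let W12 : W1 `<=` W2. Proof. by apply: box_subset; lia. Qed.
Let W02 : W0 `<=` W2. Proof. by move=> x /W01/W12. Qed.
Let lpsi : locations psi = locations phi. Proof. exact: marking_locations. Qed.
Let lpsi' : locations psi' = locations phi. Proof. exact: marking_locations. Qed.

Let near0 x z r : (r <= (2 * k)%:R)%R -> W0 x -> cube r (z - x)%R -> W1 z.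
Proof. by move=> rk; apply: (box_enlarge rk); lia. Qed.
Let near1 x z r : (r <= (2 * k)%:R)%R -> W1 x -> cube r (z - x)%R -> W2 z.
Proof. by move=> rk; apply: (box_enlarge rk); lia. Qed.
Let near2 x z r : (r <= (2 * k)%:R)%R -> W2 x -> cube r (z - x)%R -> W3 z.
Proof. by move=> rk; apply: (box_enlarge rk); lia. Qed.

Lemma nonpos_local_bound (xib : NM -> R) :
  nonpos_score xi ->
  (forall x, locations phi x -> 0 <= xib (shift x phi))%R ->
  (forall psi psi' (B : set V) x, marking phi psi -> marking phi psi' ->
     admissible xi psi -> admissible xi psi' ->
     <<s @open V >> B -> (locations phi `&` B) x ->
     `|score_diff xi x psi (splice B psi psi')| <= (xib (shift x phi))%:E) ->
  \esum_(x in locations psi `&` W0) (- xi (shift x psi)) <=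
  \esum_(x in locations psi' `&` W2) (- xi (shift x psi')) +
  \esum_(x in locations phi `&` (W2 `\` W0)) (xib (shift x phi))%:E +
  (eps + eps)%:E * card_sum (locations phi `&` W2).
Proof.
move=> npos xib0 maj.
(* The majorant bounds the score differences of [psin] against [psi'] in [W1] and
   against [psi] outside [W1], which yields both admissibility and the layer term. *)
pose psin := splice W1 psi' psi.
have fpsin : forget psin = phi by exact: forget_splice.
have xi_fin (ps : NMM) x : forget ps = phi -> admissible xi ps -> locations phi x ->
    exists2 r : R, xi (shift x ps) = r%:E & (r <= 0)%R.
  move=> fp ap px; rewrite -(marking_locations fp) in px.
  have := npos _ (configs_at0_shift px); have := ap x px.
  by case: (xi _) => [r| |]//= _; rewrite lee_fin => r0; exists r.
have maj' x : locations phi x -> W1 x -> `|score_diff xi x psi' psin| <= (xib (shift x phi))%:E.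
  by move=> px W1x; apply: maj => //; exact: borel_box.
have maj_out x : locations phi x -> ~ W1 x -> `|score_diff xi x psi psin| <= (xib (shift x phi))%:E.
  move=> px W1x; rewrite /psin -splice_setC; apply: maj => //.
  by apply: sigma_algebra_setC; exact: borel_box.
have sd x : locations phi x -> score_diff xi x psin psi =
    (fine (xi (shift x psin)) - fine (xi (shift x psi)))%:E /\
    xi (shift x psin) = (fine (xi (shift x psin)))%:E.
  move=> px; have [r rE _] := xi_fin _ _ fpsi adm px.
  have [r' rE' _] := xi_fin _ _ fpsi' adm' px.
  have [W1x|W1x] := pselect (W1 x).
    have := maj' x px W1x; rewrite /score_diff score_subC_abse rE' => /score_sub_abse_fin[t tE _].
    by rewrite tE rE.
  have := maj_out x px W1x; rewrite /score_diff score_subC_abse rE => /score_sub_abse_fin[t tE _].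
  by rewrite tE.
(* The marks differ from those of [psi] in [W1] only, and their stabilization cubes stay inside
   [W2]. *)
have out : \esum_(x in locations psi `&` ~` W2) `|score_diff xi x psin psi| <=
    eps%:E * card_sum (locations psi `&` W2).
  rewrite lpsi; apply: (@le_trans _ _ (eps%:E * card_sum (locations phi `&` W1))).
    apply: (external_splice eps_gt0 stable) => //.
    - exact: bounded_box.
    - by move=> x px; have [r -> _] := xi_fin _ _ fpsi adm px.
    - move=> y x W1y py nW2 cx; apply: nW2; apply: (near1 _ W1y cx).
      by apply: small => //; exact: W12.
  rewrite lee_pmul2l// ?lte_fin//.
  by apply: card_sum_subset => x [px /W12].
have outfin : \esum_(x in locations psi `&` ~` W2) `|score_diff xi x psin psi| < +oo.
  apply: le_lt_trans out _; rewrite card_sum_fset ?ltry//.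
  by apply: finite_locations; exact: bounded_box.
have := @local_optimality_bound R d M M' xi psi psin W2 W0 eps
  (fun x => fine (xi (shift x psin)) - fine (xi (shift x psi)))%R
  (fun x => - fine (xi (shift x psi)))%R (fun x => - fine (xi (shift x psi')))%R
  (fun x => xib (shift x phi)) optimal.
rewrite fpsi fpsin => /(_ erefl).
rewrite lpsi lpsi' => bound.
rewrite (eq_esum (b := fun x => (- fine (xi (shift x psi)))%:E)); last first.
  by move=> x [px _]; have [r -> _] := xi_fin _ _ fpsi adm px.
rewrite [in leRHS](eq_esum (a := fun x => - xi (shift x psi')) (b := fun x => (- fine (xi (shift x psi')))%:E)); last first.
  by move=> x [px _]; have [r -> _] := xi_fin _ _ fpsi' adm' px.
apply: bound.
- apply: sub_finite_set (config_locfin psi' (bounded_box (2 * k) (4 * k + m))).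
  by move=> [z l] [/splice_atoms[[W1z pa]|[_ pa]] npa]; [split|].
- exact: bounded_box.
- exact: W02.
- apply: (diff_pos_fin (bounded_box k (5 * k + m))) => //.
  by move=> x; rewrite lpsi => px _; have [-> _] := sd x px; rewrite ltry.
- move: out; rewrite lpsi; apply: le_trans; apply: le_esum => x _.
  by rewrite ge_max abse_ge0 -abseN lee_abs.
- by move=> x px _; have [] := sd x px.
- by move=> x px _; have [r -> r0] := xi_fin _ _ fpsi adm px; rewrite /= oppr_ge0.
- by move=> x px _; have [r -> r0] := xi_fin _ _ fpsi' adm' px; rewrite /= oppr_ge0.
- by move=> x px _; exact: xib0.
- move=> x px W0x.
  (* Around a point of [W0] the stabilization cube stays in [W1], where [psin] coincides with
     [psi']. *)
  have : `|score_diff xi x psi' psin| <= eps%:E.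
    apply: (internal_bound stable (W := W1)) => //.
      by move=> z l W1z; rewrite splice_atoms; split => [pa|[[]|[]]]//; left.
    by move=> z; apply: near0 => //; apply: small' => //; exact: W02.
  have [r rE r0] := xi_fin _ _ fpsi adm px; have [r' rE' r'0] := xi_fin _ _ fpsi' adm' px.
  have [_ nE] := sd x px.
  by rewrite /score_diff nE rE rE' score_sub_fin /= lee_fin ler_norml; lra.
(* In [W1] the majorant compares [psin] with [psi'], and the nonpositive score of [psi] is dropped;
   outside [W1] it compares [psin] with [psi] directly. *)
- move=> x px W2x nW0.
  have [r rE r0] := xi_fin _ _ fpsi adm px; have [r' rE' r'0] := xi_fin _ _ fpsi' adm' px.
  have [_ nE] := sd x px.
  have [W1x|W1x] := pselect (W1 x).
    have := maj' x px W1x; rewrite /score_diff nE rE rE' score_sub_fin /= lee_fin ler_norml.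
    by move: eps_gt0; lra.
  have := maj_out x px W1x; rewrite /score_diff nE rE rE' score_sub_fin /= lee_fin ler_norml.
  by move: eps_gt0; lra.
Qed.

Definition neutral_config (mo : M') (ph : NM) : NMM.
Proof.
exists [set a : V * (M * M') | atoms ph (drop_mark a) /\ a.2.2 = mo].
- move=> B bB; apply: sub_finite_set (finite_image (fun a => (a.1, (a.2, mo)))
    (config_locfin ph bB)).
  by move=> [x [l l']] [[/= pa ->] Bx]; exists (x, l).
- move=> x [l l'] [n n'] [/= pa ->] [/= pa' ->].
  by have -> : l = n by exact: config_ground pa pa'.
Defined.

Lemma forget_neutral_config mo (ph : NM) : forget (neutral_config mo ph) = ph.
Proof.
apply: config_eqP => x l; rewrite forget_atomsE; split => [[l' [pa _]]//|pa].
by exists mo.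
Qed.

(** [neutral_mark] concerns a single replacement. Each further replacement can only raise the scores
    at points already made neutral and at points not yet touched, so both properties persist. *)
Lemma neutral_chain mo (Y : seq V) (ps : NMM) : neutral_mark xi mo -> forget ps = phi ->
  let psY := splice [set` Y] (neutral_config mo phi) ps in
  (forall y, locations phi y -> y \in Y -> 0 <= xi (shift y psY)) /\
  (forall y, locations phi y -> y \notin Y -> xi (shift y ps) <= xi (shift y psY)).
Proof.
move=> neu fp; elim: Y => [|y Y [IH1 IH2]].
  split => // y py _; rewrite (_ : splice _ _ _ = ps)//.
  by apply: config_eqP => z k0; rewrite splice_atoms; split => [[[]|[]]|]//; right.
set psY := splice [set` Y] _ _ in IH1 IH2; set psyY := splice [set` y :: Y] _ _.
have fY : forget psY = phi by apply: forget_splice => //; exact: forget_neutral_config.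
have [[py yY]|nyY] := pselect (locations phi y /\ y \notin Y); last first.
  have -> : psyY = psY by apply: (splice_cons _ fp nyY); exact: forget_neutral_config.
  split => [z pz|z pz]; rewrite in_cons.
    move=> /predU1P[zy|zY]; last exact: IH1.
    by apply: IH1 => //; apply: contrapT => /negP zY; apply: nyY; rewrite -zy.
  by rewrite negb_or => /andP[_ zY]; exact: IH2.
have [[l l'] pa] : exists kk, atoms psY (y, kk).
  by apply/locations_atoms; rewrite (marking_locations fY).
have eqa : atoms psyY = (y, (l, mo)) |` (atoms psY `\ (y, (l, l'))).
  have pl : atoms phi (y, l) by rewrite -fY; exact: (forget_atoms pa).
  apply/seteqP; split => -[z [n n']].
    move=> /splice_atoms[[/= zY [/= pn ->]]|[/= zY pn]].
      move: zY; rewrite in_cons => /predU1P[zy|zY].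
        by left; subst z; have -> : n = l by exact: config_ground pn pl.
      right; split; first by apply/splice_atoms; left.
      by move=> [zy _ _]; subst z; move: yY; rewrite zY.
    move: zY; rewrite in_cons => /negP; rewrite negb_or => /andP[zy zY].
    right; split; first by apply/splice_atoms; right; split => //; apply/negP.
    by move=> [zy' _ _]; subst z; move: zy; rewrite eqxx.
  move=> [[-> -> ->]|[/splice_atoms pn nz]].
    by apply/splice_atoms; left; split => //=; rewrite mem_head.
  have zy : z != y.
    apply/eqP => zy; subst z; apply: nz => /=.
    by rewrite (config_ground ((splice_atoms _ _ _ _ _).2 pn) pa).
  apply/splice_atoms; rewrite /= in_cons (negbTE zy) /=; exact: pn.
have [y0 other] := neu _ _ _ _ _ pa eqa.
split => z pz; rewrite in_cons.
  have [->//|zy /= zY] := eqVneq z y.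
  apply: le_trans (IH1 z pz zY) _; apply: score_sub_ge0; apply: other; last exact/eqP.
  by rewrite (marking_locations fY).
rewrite negb_or => /andP[zy zY].
apply: le_trans (IH2 z pz zY) _; apply: score_sub_ge0; apply: other; last exact/eqP.
by rewrite (marking_locations fY).
Qed.

Lemma neutral_splice mo (W : set V) (ps : NMM) : bounded_set W ->
  neutral_mark xi mo -> forget ps = phi ->
  let psW := splice W (neutral_config mo phi) ps in
  (forall y, locations phi y -> W y -> 0 <= xi (shift y psW)) /\
  (forall y, locations phi y -> ~ W y -> xi (shift y ps) <= xi (shift y psW)).
Proof.
move=> bW neu fp; have fW := finite_locations phi bW.
have := neutral_chain (fset_set (locations phi `&` W)) neu fp.
rewrite (_ : splice _ _ _ = splice W (neutral_config mo phi) ps) => [[h1 h2]|].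
  split => y py Wy; [apply: h1|apply: h2] => //; rewrite in_fset_set//.
    by rewrite inE.
  by apply/negP => /set_mem[].
by rewrite fset_setK// splice_locations//; exact: forget_neutral_config.
Qed.

Lemma nonneg_local_bound mo : nonneg_or_ninfty_score xi -> neutral_mark xi mo ->
  \esum_(x in locations psi' `&` W0) (xi (shift x psi')) <=
  \esum_(x in locations psi `&` W2) (xi (shift x psi)) +
  (eps + eps)%:E * card_sum (locations phi `&` W2).
Proof.
move=> nneg neu.
(* [psin] agrees with [psi'] in [W0], with [psi] outside [W2], and is neutral in
   between; neutral marks can only increase the scores of the other points. *)
pose N := neutral_config mo phi; pose L := W2 `\` W0.
have fN : forget N = phi by exact: forget_neutral_config.
have bL : bounded_set L.
  have [r [rr rW]] := bounded_box (R := R) (d := d) k (5 * k + m).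
  by exists r; split => // t tM x [Wx _]; exact: (rW t tM).
(* [psin] agrees with [psi2] in [W2] and with [psi3] outside [W0]. Stabilization compares [psin]
   with these two, and neutrality compares them with [psi'] and [psi] off the layer. *)
pose psi2 := splice L N psi'; pose psi3 := splice L N psi.
pose psin := splice W0 psi' psi3.
have f2 : forget psi2 = phi by exact: forget_splice.
have f3 : forget psi3 = phi by exact: forget_splice.
have fn : forget psin = phi by exact: forget_splice.
have psinE : psin = splice L N (splice W0 psi' psi).
  apply: config_eqP => z l; rewrite !splice_atoms.
  split => [[[W0z pa]|[W0z [[Lz pa]|[Lz pa]]]]|[[Lz pa]|[Lz [[W0z pa]|[W0z pa]]]]].
  - by right; split; [move=> []|left].
  - by left.
  - by right; split => //; right.
  - by right; split; [case: Lz|left].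
  - by left.
  - by right; split => //; right.
have fmix : forget (splice W0 psi' psi) = phi by exact: forget_splice.
have [_ up2] := neutral_splice bL neu fpsi'.
have [_ up3] := neutral_splice bL neu fpsi.
have [pos_n _] := neutral_splice bL neu fmix.
have lty (ps : NMM) x : forget ps = phi -> locations phi x -> xi (shift x ps) < +oo.
  move=> fp px; rewrite -(marking_locations fp) in px.
  by case: (nneg _ (configs_at0_shift px)) => [->|/andP[]]; rewrite ?ltNyy.
have fin_ge (a b : \bar R) : a < +oo -> b <= a -> b <> -oo -> a = (fine a)%:E.
  by case: a b => [a| |] [b| |].
have xi_fin (ps : NMM) x : forget ps = phi -> admissible xi ps -> locations phi x ->
    exists2 r : R, xi (shift x ps) = r%:E & (0 <= r)%R.
  move=> fp ap px; have pl := px; rewrite -(marking_locations fp) in px.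
  have := nneg _ (configs_at0_shift px); have := ap x px.
  case: (xi _) => [r| |]//= _ [//|/andP[]//]; rewrite lee_fin => r0 _; by exists r.
have inner x : locations phi x -> W0 x -> exists2 t : R, xi (shift x psin) = t%:E &
    xi (shift x psi') <= (t + eps)%:E.
  move=> px W0x; have nL : ~ L x by case.
  have [r' rE' r'0] := xi_fin _ _ fpsi' adm' px.
  have := up2 x px nL; rewrite -/N -/psi2 => le2.
  have e2 : xi (shift x psi2) = (fine (xi (shift x psi2)))%:E.
    by apply: fin_ge (lty _ _ f2 px) le2 _; rewrite rE'.
  have : `|score_diff xi x psi2 psin| <= eps%:E.
    apply: (internal_bound stable (W := W2)) => //.
      move=> z l W2z; rewrite !splice_atoms.
      have [W0z|W0z] := pselect (W0 z).
        by split => [[[[]]//|[_ pa]]|[[_ pa]|[]]]//; [left|right; split => // -[]].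
      split => [[[Lz pa]|[[]]]//|[[]|[_ [[Lz pa]|[[]]]]]]//; last by left.
      by right; split => //; left.
    move=> z cz; apply: W12; apply: (near0 _ W0x cz).
    rewrite (radius_eq stable (psi' := psi'))//; first by apply: small' => //; exact: W02.
    by move=> l; rewrite splice_atoms; split => [[[]|[]]//|pa]; right.
  rewrite /score_diff score_subC_abse e2 => /score_sub_abse_fin[t tE te]; exists t => //.
  apply: le_trans le2 _; rewrite e2 lee_fin.
  by move: te; rewrite ler_norml; lra.
have pos_L x : locations phi x -> L x -> 0 <= xi (shift x psin).
  by move=> px Lx; rewrite psinE; exact: pos_n.
have nfin x : locations phi x -> W2 x -> xi (shift x psin) = (fine (xi (shift x psin)))%:E.
  move=> px W2x; have [W0x|W0x] := pselect (W0 x).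
    by have [t -> _] := inner x px W0x.
  by apply: fin_ge (lty _ _ fn px) (pos_L x px _) _.
have bound := @local_optimality_bound R d M M' xi psi psin W2 W0 eps
  (fun x => fine (xi (shift x psin)) - fine (xi (shift x psi)))%R
  (fun x => fine (xi (shift x psi')))%R (fun x => fine (xi (shift x psi)))%R
  (fun=> 0%R) optimal.
move: bound; rewrite fpsi fn => /(_ erefl).
rewrite lpsi lpsi' => bound.
rewrite (eq_esum (b := fun x => (fine (xi (shift x psi')))%:E)); last first.
  by move=> x [px _]; have [r -> _] := xi_fin _ _ fpsi' adm' px.
rewrite [in leRHS](eq_esum (a := fun x => xi (shift x psi)) (b := fun x => (fine (xi (shift x psi)))%:E)); last first.
  by move=> x [px _]; have [r -> _] := xi_fin _ _ fpsi adm px.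
have agree z l : ~ W2 z -> atoms psin (z, l) <-> atoms psi (z, l).
  move=> nW2; rewrite !splice_atoms.
  have nW0 : ~ W0 z by move=> /W02.
  have nL : ~ L z by case.
  by split => [[[]|[_ [[]|[]]]]|pa]//; right; split => //; right.
have psin_splice : splice W2 psin psi = psin.
  apply: config_eqP => z l; rewrite splice_atoms; split => [[[_ //]|[nW2 /(agree _ _ nW2)//]]|pa].
  have [W2z|W2z] := pselect (W2 z); [by left|right; split => //; exact/agree].
(* Only finiteness matters here, to make local optimality applicable; the quantitative bound outside
   [W2] comes from [psi3]. *)
have out3 : \esum_(x in locations psi `&` ~` W3) `|score_diff xi x psin psi| < +oo.
  rewrite lpsi -psin_splice; apply: (@le_lt_trans _ _ (eps%:E * card_sum (locations phi `&` W2))).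
    apply: (external_splice eps_gt0 stable) => //.
    - exact: bounded_box.
    - by move=> x px; have [r -> _] := xi_fin _ _ fpsi adm px.
    - move=> y x W2y py nW3 cx; apply: nW3; apply: (near2 _ W2y cx).
      exact: small.
  by rewrite card_sum_fset ?ltry//; apply: finite_locations; exact: bounded_box.
apply: le_trans (bound _ _ _ _ _ _ _ _ _ _ _) _.
- apply: sub_finite_set (config_locfin psin (bounded_box k (5 * k + m))).
  move=> [z l] [pa npa]; split => //=; apply: contrapT => nW2; apply: npa.
  exact/(agree _ _ nW2).
- exact: bounded_box.
- exact: W02.
- apply: (diff_pos_fin (bounded_box 0 (6 * k + m))) => //.
  move=> x; rewrite lpsi => px _; have [r rE _] := xi_fin _ _ fpsi adm px.
  rewrite /score_diff rE; have := lty _ _ fn px.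
  by case: (xi (shift x psin)) => [t| |]//= _; rewrite /score_sub/= ltry.
(* Outside [W2] the scores of [psi3] are at least those of [psi], so the loss against [psi] is at
   most that against [psi3], from which [psin] differs in [W0] only. *)
- apply: (@le_trans _ _ (eps%:E * card_sum (locations phi `&` W0))); last first.
    by rewrite lee_pmul2l// ?lte_fin//; apply: card_sum_subset => x [px /W02].
  apply: (@le_trans _ _ (\esum_(x in locations phi `&` ~` W2) `|score_diff xi x psin psi3|)).
    apply: le_esum => x [px nW2]; rewrite ge_max abse_ge0/=.
    have [r rE r0] := xi_fin _ _ fpsi adm px.
    have nL : ~ L x by case.
    have := up3 x px nL; rewrite -/N -/psi3 => le3.
    have e3 : xi (shift x psi3) = (fine (xi (shift x psi3)))%:E.
      by apply: fin_ge (lty _ _ f3 px) le3 _; rewrite rE.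
    move: le3; rewrite /score_diff e3 rE lee_fin => le3.
    have := lty _ _ fn px; case: (xi (shift x psin)) => [t| |]// _.
    rewrite !score_sub_fin /= lee_fin; have := ler_norm (- (t - fine (xi (shift x psi3)))).
    by rewrite normrN; lra.
  apply: (external_splice eps_gt0 stable) => //.
  - exact: bounded_box.
  - by move=> x px; apply/eqP; rewrite -ltey; exact: lty.
  - move=> y x W0y py nW2 cx; apply: nW2; apply: W12; apply: (near0 _ W0y cx).
    rewrite (radius_eq stable (psi' := psi))//; first by apply: small => //; exact: W02.
    by move=> l; rewrite splice_atoms; split => [[[[]]|[]]//|pa]; right; split => // -[].
- move=> x px W2x; rewrite /score_diff nfin//.
  by have [r -> _] := xi_fin _ _ fpsi adm px.
- by move=> x px _; have [r -> r0] := xi_fin _ _ fpsi' adm' px.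
- by move=> x px _; have [r -> r0] := xi_fin _ _ fpsi adm px.
- by move=> x px _.
- move=> x px W0x; have [t tE] := inner x px W0x.
  have [r rE r0] := xi_fin _ _ fpsi adm px; have [r' rE' r'0] := xi_fin _ _ fpsi' adm' px.
  by rewrite rE' rE tE lee_fin /=; lra.
(* A neutral point has a nonnegative score, so at most the score of [psi] is lost in the layer. *)
- move=> x px W2x nW0.
  have := pos_L x px (conj W2x nW0); rewrite nfin// lee_fin.
  have [r rE r0] := xi_fin _ _ fpsi adm px; rewrite rE /=.
  by move: eps_gt0; lra.
by rewrite [X in _ + X + _]esum1 ?adde0.
Qed.

End LocalBound.

(** * Stationarity *)

Section Stationarity.
Context {R : realType} {d : nat} {K : topologicalType}.
Local Notation V := 'rV[R]_d.
Local Notation conf := (config R d K).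
Local Open Scope ereal_scope.

Definition shift_sum (h : conf -> \bar R) (W : set V) : conf -> \bar R :=
  location_sum W (fun x psi => h (shift x psi)).

Lemma shift_sum_ge0 h W psi : (forall c, 0 <= h c) -> 0 <= shift_sum h W psi.
Proof. by move=> h0; apply: esum_ge0. Qed.

Lemma shift_sum_shift h W y psi :
  shift_sum h W (shift y psi) = shift_sum h [set x | W (x - y)%R] psi.
Proof.
rewrite /shift_sum /location_sum.
rewrite (_ : locations psi `&` _ = (fun z => z + y)%R @` (locations (shift y psi) `&` W)).
  rewrite esum_image; last by move=> a b _ _ /addIr.
  by apply: eq_esum => x _; rewrite shift_shift.
apply/seteqP; split => [x [px Wx]|_ [x [/locations_shift px Wx] <-]].
  by exists (x - y)%R; rewrite ?subrK//; split => //; apply/locations_shift; rewrite subrK.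
by split => //=; rewrite addrK.
Qed.

Lemma shift_sum_subset h (W W' : set V) psi : (forall c, 0 <= h c) -> W `<=` W' ->
  shift_sum h W psi <= shift_sum h W' psi.
Proof.
move=> h0 WW'; rewrite /shift_sum /location_sum [leRHS](esumID W)//.
rewrite -setIA (setIidr WW') leeDl//; exact: esum_ge0.
Qed.

Lemma measurable_shift_sum h W N : <<s open >> W -> W `<=` window N ->
  measurable_fun setT h -> (forall c, 0 <= h c) -> measurable_fun setT (shift_sum h W).
Proof. by move=> mW WN mh h0; exact: (measurable_sum_shift mW WN). Qed.

Lemma measurable_shift_sum_box h lo hi :
  measurable_fun setT h -> (forall c, 0 <= h c) ->
  measurable_fun setT (shift_sum h (box lo hi)).
Proof.
by apply: (measurable_shift_sum (borel_box lo hi)); exact: box_window.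
Qed.

Lemma iter_adde_ge0 (a : \bar R) n : 0 <= a -> iter n (+%E a) 0 = n%:R%:E * a.
Proof.
move=> a0; elim: n => [|n IH]; first by rewrite mul0e.
by rewrite iterS IH -natr1 EFinD ge0_muleDl ?lee_fin// mul1e addeC.
Qed.

Section Cells.
Variables lo m : nat.
Local Notation index := {ffun 'I_d -> 'I_m}.

Definition corner (f : index) : V := \row_j (lo + f j)%:R.

(** The cell is read off the integer parts of the coordinates; the equivalence records its existence
    and uniqueness at once. *)
Lemma box_cells (x : V) : box lo (lo + m) x ->
  exists f : index, forall g : index, box 0 1 (x - corner g)%R <-> g = f.
Proof.
move=> bx.
have xj j : (Num.trunc (x ord0 j) - lo < m)%N.
  have /andP[h1 h2] := bx j.
  have x0 : (0 <= x ord0 j)%R by apply: le_trans h1; rewrite ler0n.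
  have := truncn_itv x0 => /andP[t1 t2].
  have : ((Num.trunc (x ord0 j))%:R < (lo + m)%:R :> R)%R by exact: le_lt_trans t1 h2.
  rewrite ltr_nat => t3.
  have : (lo%:R < (Num.trunc (x ord0 j)).+1%:R :> R)%R by exact: le_lt_trans h1 t2.
  by rewrite ltr_nat; lia.
exists [ffun j => Ordinal (xj j)] => g; split => [bg|-> j].
  apply/ffunP => j; apply/val_inj; rewrite ffunE /=.
  have := bg j; rewrite !mxE => /andP[g0 g1].
  rewrite (_ : Num.trunc _ = (lo + g j)%N) ?addKn//.
  by apply: truncn_def; rewrite -natr1; apply/andP; split; lra.
have /andP[h1 h2] := bx j.
have x0 : (0 <= x ord0 j)%R by apply: le_trans h1; rewrite ler0n.
have := truncn_itv x0 => /andP[t1 t2].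
have : (lo%:R < (Num.trunc (x ord0 j)).+1%:R :> R)%R by exact: le_lt_trans h1 t2.
rewrite ltr_nat ltnS => lt.
rewrite !mxE ffunE /= subnKC//; move: t2; rewrite -natr1 => t2.
by apply/andP; split; lra.
Qed.

Lemma box_cell_subset (f : index) (x : V) : box 0 1 (x - corner f)%R -> box lo (lo + m) x.
Proof.
move=> bx j; have := bx j; rewrite !mxE => /andP[h0 h1].
have : ((lo + f j).+1%:R <= (lo + m)%:R :> R)%R by rewrite ler_nat ltn_add2l.
have : (lo%:R <= (lo + f j)%:R :> R)%R by rewrite ler_nat leq_addr.
by rewrite -natr1 => *; apply/andP; split; lra.
Qed.

Lemma shift_sum_cells h psi : (forall c, 0 <= h c) ->
  shift_sum h (box lo (lo + m)) psi =
  \sum_(f : index) shift_sum h (box 0 1) (shift (corner f) psi).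
Proof.
move=> h0; under eq_bigr do rewrite shift_sum_shift.
rewrite /shift_sum /location_sum.
transitivity (\esum_(x in locations psi `&` box lo (lo + m)) \sum_(f : index)
    (if x \in [set x : V | box 0 1 (x - corner f)%R] then h (shift x psi) else 0)).
  apply: eq_esum => x [px /box_cells[f fP]].
  rewrite (bigD1 f)//= mem_set; last by rewrite /=; apply/fP.
  rewrite big1 ?adde0// => g gf; rewrite memNset//= => /fP gf'.
  by rewrite gf' eqxx in gf.
rewrite esum_sum; last by move=> x f _ _; case: ifP.
apply: eq_bigr => f _; rewrite -esum_mkcondr; congr esum.
apply/seteqP; split => [x [[px _] bx]//|x [px bx]]; split => //; split => //.
exact: box_cell_subset bx.
Qed.

End Cells.

Variable Q : probability conf R.
Hypothesis stat : stationary Q.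

Lemma integral_shift (y : V) h : measurable_fun setT h -> (forall c, 0 <= h c) ->
  \int[Q]_c h (shift y c) = \int[Q]_c h c.
Proof.
move=> mh h0; transitivity (\int[pushforward Q (shift y)]_c h c).
  by rewrite (ge0_integral_pushforward (measurable_shift y)) ?preimage_setT.
apply: eq_measure_integral; first exact: measurable_shift.
by move=> mS A mA _; exact: stat.
Qed.

Lemma integral_shift_sum_box h lo m : measurable_fun setT h -> (forall c, 0 <= h c) ->
  \int[Q]_c shift_sum h (box lo (lo + m)) c =
  (m ^ d)%:R%:E * \int[Q]_c shift_sum h (box 0 1) c.
Proof.
move=> mh h0.
under eq_integral do rewrite (shift_sum_cells _ _ _ h0).
have mh1 := measurable_shift_sum_box 0 1 mh h0.
rewrite ge0_integral_sum//; last 2 first.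
- by move=> f; apply: measurableT_comp => //; exact: measurable_shift.
- by move=> f c _; exact: shift_sum_ge0.
rewrite (eq_bigr (fun=> \int[Q]_c shift_sum h (box 0 1) c)); last first.
  by move=> f _; apply: integral_shift => // c; exact: shift_sum_ge0.
rewrite big_const card_ffun !card_ord.
by apply: iter_adde_ge0; apply: integral_ge0 => c _; exact: shift_sum_ge0.
Qed.

Lemma ae_shift (P : set conf) : {ae Q, forall c, P c} ->
  forall y : V, {ae Q, forall c, P (shift y c)}.
Proof.
move=> [N [mN QN PN]] y; exists (shift y @^-1` N); split => //.
- by rewrite -[X in measurable X]setTI; exact: (measurable_shift y).
- by have := stat y mN; rewrite /pushforward => ->.
- by move=> c /= nP; exact: PN.
Qed.

Lemma unit_cube_window : @unit_cube R d `<=` window 2.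
Proof.
move=> x ux; suff : ball (0%R : V) 2%:R x by rewrite -ball_normE /window /= sub0r normrN.
split => // i j; rewrite ord1 mxE -ball_normE /= sub0r normrN.
have /andP[x0 x1] := ux j; rewrite ger0_norm//; lra.
Qed.

Lemma borel_unit_cube : <<s open >> (@unit_cube R d).
Proof.
have cc (i : 'I_d) : continuous (fun x : V => x ord0 i) by exact: coord_continuous.
apply: sigma_algebra_forall => i.
rewrite (_ : (fun p : V => _) = [set x : V | 0 <= x ord0 i]%R `&` [set x : V | x ord0 i <= 1]%R).
  apply: sigma_algebra_setI; apply: borel_closed;
  [apply: (preimage_closed (f := fun x : V => x ord0 i) _ (@closed_ge _ 0%R)) => x _; exact: cc|
   apply: (preimage_closed (f := fun x : V => x ord0 i) _ (@closed_le _ 1%R)) => x _; exact: cc].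
by apply/seteqP; split => x /= => [/andP[]|[-> ->]].
Qed.

(** The unit cube is treated first. Every other point is brought there by one of countably many
    integer translations, each of which preserves the law. *)
Lemma ae_points (N : set conf) : measurable N ->
  \int[Q]_c shift_sum (fun c => (\1_N c)%:E) (@unit_cube R d) c = 0 ->
  {ae Q, forall c, forall x, locations c x -> ~ N (shift x c)}.
Proof.
move=> mN int0.
have mI : measurable_fun setT (fun c : conf => (\1_N c)%:E : \bar R).
  by apply/measurable_EFinP; exact: measurable_indic.
have I0 c : 0 <= (\1_N c)%:E :> \bar R by rewrite lee_fin.
have mS := measurable_shift_sum borel_unit_cube unit_cube_window mI I0.
have ae0 : {ae Q, forall c, forall x, (locations c `&` @unit_cube R d) x -> ~ N (shift x c)}.
  have : ae_eq Q setT (shift_sum (fun c => (\1_N c)%:E) (@unit_cube R d)) (cst 0).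
    apply/ae_eq_integral_abs => //; rewrite -[RHS]int0.
    by apply: eq_integral => c _; rewrite gee0_abs// shift_sum_ge0.
  apply: filterS => c /(_ I) /= c0 x [px ux] Nx.
  have : (1 : \bar R) <= 0.
    rewrite -c0 /shift_sum /location_sum (esumID [set x])//.
    have -> : locations c `&` @unit_cube R d `&` [set x] = [set x].
      by apply/seteqP; split => [z []//|z ->].
    rewrite esum_set1 ?indicE ?mem_set// leeDl//.
    by apply: esum_ge0 => z _; rewrite lee_fin.
  by rewrite lee_fin ler10.
have : {ae Q, forall c, forall v : 'rV[int]_d, forall x,
    (locations (shift (map_mx intr v) c) `&` @unit_cube R d) x -> ~ N (shift x (shift (map_mx intr v) c))}.
  have neg : Q.-negligible (\bigcup_n (if choice.unpickle n is Some v then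
     [set c | ~ forall x, (locations (shift (map_mx intr (v : 'rV[int]_d)) c) `&` @unit_cube R d) x ->
       ~ N (shift x (shift (map_mx intr v) c))] else set0)).
    apply: negligible_bigcup => n; case: choice.unpickle => [v|]; last exact: negligible_set0.
    exact: (ae_shift ae0 (map_mx intr v)).
  apply: negligibleS neg => c /= /existsNP[v nv].
  by exists (choice.pickle v) => //; rewrite choice.pickleK.
apply: filterS => c cN x px.
pose v : 'rV[int]_d := \row_j Num.floor (x ord0 j).
have := cN v (x - map_mx intr v)%R; rewrite shift_shift subrK; apply; split.
  by apply/locations_shift; rewrite subrK.
move=> j; rewrite !mxE; have := floor_itv (x ord0 j).
by move=> /andP[h1 h2]; move: h2; rewrite intrD => h2; apply/andP; split; lra.
Qed.

Lemma card_locations_ge_iter (W : set V) (B : nat -> set V) (c : conf) :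
  trivIset setT B -> (forall n, B n `<=` W) ->
  \sum_(0 <= n <oo) card_sum (R := R) (locations c `&` B n) <= card_sum (locations c `&` W).
Proof.
move=> tB BW; rewrite -card_sum_bigcup; last exact: trivIset_setIl.
by apply: card_sum_subset => x [n _ [px Bx]]; split => //; exact: BW Bx.
Qed.

Lemma shift_sum_cst W c : shift_sum (cst 1) W c = card_sum (locations c `&` W).
Proof. by []. Qed.

(* Small translates of a face are disjoint subsets of the cube with equal expected
   numbers of points, so that faces carry no points. *)
Lemma ae_unit_cube_box :
  \int[Q]_c card_sum (R := R) (locations c `&` @unit_cube R d) < +oo ->
  {ae Q, forall c, locations c `&` @unit_cube R d = locations c `&` box 0 1}.
Proof.
move=> fin.
have cc (i : 'I_d) : continuous (fun x : V => x ord0 i) by exact: coord_continuous.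
pose face (j : 'I_d) := @unit_cube R d `&` [set x : V | x ord0 j = 1%R].
have mface j : <<s open >> (face j).
  apply: sigma_algebra_setI; first exact: borel_unit_cube.
  apply: borel_closed; apply: (preimage_closed (f := fun x : V => x ord0 j) _ (@closed_eq _ 1%R)) => x _.
  exact: cc.
have face2 j : face j `<=` window 2 by move=> x [/unit_cube_window].
have m1 : measurable_fun setT (cst 1 : conf -> \bar R) by exact: measurable_cst.
have e0 c : 0 <= cst (1 : \bar R) (c : conf) by [].
have mcf j := measurable_shift_sum (mface j) (face2 j) m1 e0.
have int0 j : \int[Q]_c shift_sum (cst 1) (face j) c = 0.
  (* The translates lie at height [1 - 1 / (n + 1)], hence in the cube and at distinct heights. *)
  pose e (n : nat) : V := (- n.+1%:R^-1 *: delta_mx ord0 j)%R.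
  have ej n : (e n ord0 j = - n.+1%:R^-1)%R by rewrite !mxE !eqxx mulr1.
  have ei n i : i != j -> (e n ord0 i = 0)%R by move=> ij; rewrite !mxE eqxx (negbTE ij) mulr0.
  pose B n := [set x : V | face j (x - e n)%R].
  have inv1 n : (0 < (n.+1%:R^-1 : R) <= 1)%R by rewrite invr_gt0 ltr0n/= invf_le1 ?ler1n ?ltr0n.
  have BW n : B n `<=` @unit_cube R d.
    have subE (x : V) i : ((x - e n) ord0 i = x ord0 i - e n ord0 i)%R by rewrite !mxE.
    move=> x [ux xj] i; have := ux i; have := inv1 n; rewrite /= subE in xj *.
    rewrite subE; have [->|ij] := eqVneq i j.
      by move: xj (ej n); move: (n.+1%:R^-1)%R (e n ord0 j) => t s; lra.
    by rewrite ei//; lra.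
  have tB : trivIset setT B.
    move=> n n' _ _ [x [[_ xn] [_ xn']]]; move: xn xn'; rewrite /= !mxE !eqxx !mulr1.
    move=> xn xn'; have : (n.+1%:R^-1 = n'.+1%:R^-1 :> R)%R.
      by move: xn xn'; move: (n.+1%:R^-1)%R (n'.+1%:R^-1)%R => s t; lra.
    by move=> /invr_inj/eqP; rewrite eqr_nat => /eqP[].
  have shE n c : shift_sum (cst 1) (face j) (shift (e n) c) = card_sum (locations c `&` B n).
    by rewrite shift_sum_shift.
  have intE n : \int[Q]_c card_sum (R := R) (locations c `&` B n) = \int[Q]_c shift_sum (cst 1) (face j) c.
    by rewrite -(integral_shift (e n) (mcf j)); [apply: eq_integral => c _; rewrite shE|move=> c; exact: shift_sum_ge0].
  have : \sum_(0 <= n <oo) \int[Q]_c shift_sum (cst 1) (face j) c < +oo.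
    apply: le_lt_trans fin.
    rewrite (eq_eseriesr (g := fun n => \int[Q]_c card_sum (R := R) (locations c `&` B n))); last first.
      by move=> n _; rewrite intE.
    have mBn n : measurable_fun setT (fun c : conf => card_sum (R := R) (locations c `&` B n)).
      rewrite (_ : (fun c => _) = shift_sum (cst 1) (face j) \o shift (e n)).
        by apply: measurableT_comp => //; exact: measurable_shift.
      by apply/funext => c; rewrite /= shE.
    rewrite -integral_nneseries//; last by move=> n c _; exact: card_sum_ge0.
    apply: ge0_le_integral => //.
    - by move=> c _; apply: nneseries_ge0 => n _ _; exact: card_sum_ge0.
    - by apply: ge0_emeasurable_sum => // n *; exact: card_sum_ge0.
    - exact: (measurable_shift_sum borel_unit_cube unit_cube_window m1 e0).
    - by move=> c _; exact: card_locations_ge_iter.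
  set a := \int[Q]_c _; have a0 : 0 <= a by apply: integral_ge0 => c _; exact: shift_sum_ge0.
  (* Infinitely many copies of [a] have a finite sum, so [a] is 0 by the Archimedean property. *)
  have parts n : n%:R%:E * a <= \sum_(0 <= n <oo) a.
    apply: le_trans (nneseries_lim_ge n _) => //.
    by rewrite big_const_nat subn0 iter_adde_ge0.
  have : 0 <= \sum_(0 <= n <oo) a by exact: nneseries_ge0.
  move: parts; case: (\sum_(0 <= n <oo) a) => [s| |]// parts s0 _.
  have := parts 1%N; rewrite mul1e; move: a0 parts; case: a => [r| |]//=.
  rewrite !lee_fin => r0 parts _; congr (_%:E); apply/eqP; rewrite eq_le r0 andbT leNgt.
  apply/negP => rpos; have := parts (Num.trunc (s / r)).+1.
  rewrite -EFinM lee_fin leNgt -ltr_pdivrMr// => /negP; apply.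
  exact: truncnS_gt.
have : {ae Q, forall c, forall j, shift_sum (cst 1) (face j) c = 0}.
  have neg : Q.-negligible (\bigcup_n (if choice.unpickle n is Some j then
     [set c | ~ shift_sum (cst 1) (face (j : 'I_d)) c = 0] else set0)).
    apply: negligible_bigcup => n; case: choice.unpickle => [j|]; last exact: negligible_set0.
    have : ae_eq Q setT (shift_sum (cst 1) (face j)) (cst 0).
      apply/ae_eq_integral_abs => //; rewrite -[RHS](int0 j).
      by apply: eq_integral => c _; rewrite gee0_abs// shift_sum_ge0.
    by apply: negligibleS => c /= nc; apply: contra_not nc; exact.
  apply: negligibleS neg => c /= /existsNP[j nj].
  by exists (choice.pickle j) => //; rewrite choice.pickleK.
apply: filterS => c c0; apply/seteqP; split => [x [px ux]|x [px bx]]; split => // i.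
  have := ux i => /andP[u0 u1]; rewrite u0 /= lt_neqAle u1 andbT.
  apply/negP => /eqP x1.
  have := c0 i; rewrite shift_sum_cst => cf0.
  have : (1 : \bar R) <= card_sum (locations c `&` face i).
    apply/card_sum_gt0; last by exists x.
    apply: finite_locations; have [r [rr rW]] := window_bounded (R := R) (d := d) 2.
    by exists r; split => // t tM z /face2; exact: (rW t tM).
  by rewrite cf0 lee_fin ler10.
by have /andP[-> /ltW] := bx i.
Qed.

End Stationarity.

Lemma integral_le_markings (R : realType) (d : nat) (M M' : topologicalType)
  (M_sc : @second_countable M) (M'_hausdorff : hausdorff_space M')
  (M'_lc : locally_compact [set: M']) (M'_sc : @second_countable M')
  (Q Q' : probability (config R d (M * M')%type) R)
  (f g : config R d (M * M')%type -> \bar R) (A A' : set (config R d (M * M')%type)) :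
  measurable_fun setT f -> measurable_fun setT g ->
  (forall c, 0 <= f c)%E -> (forall c, 0 <= g c)%E ->
  (forall E, measurable E -> Q (@forget R d M M' @^-1` E) = Q' (@forget R d M M' @^-1` E)) ->
  {ae Q, forall c, A c} -> {ae Q', forall c, A' c} ->
  (forall c c', forget c = forget c' -> A c -> A' c' -> f c <= g c')%E ->
  (\int[Q]_c f c <= \int[Q']_c g c)%E.
Proof.
have [VM [oVM bVM]] := second_countable_seq M_sc.
have [V [oV bV0]] := second_countable_seq M'_sc.
have bV := locally_compact_regular_base M'_hausdorff M'_lc bV0.
apply: (integral_le_fiberwise measurable_forget (measurable_mark_code oV)
  (decided_code_range V) (code_range_coded oV bV) (code_range_exists oV bV M'_hausdorff)).
exact: (mark_code_generates oVM bVM).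
Qed.

Lemma powR_nat_unbounded (R : realType) (a x : R) : 0 < a ->
  exists2 k : nat, (0 < k)%N & x <= k%:R `^ a.
Proof.
move=> a0; exists (Num.trunc (`|x| `^ a^-1)).+1 => //.
apply: le_trans (ler_norm x) _.
rewrite -[X in X <= _]powRr1// -[X in _ `^ X](mulVf (lt0r_neq0 a0)) powRrM.
apply: ge0_ler_powR; rewrite ?nnegrE ?powR_ge0 ?ler0n//; first exact: ltW.
exact/ltW/truncnS_gt.
Qed.

(** [(1 + 4 / j) ^+ d] is the volume ratio of the cubes of side [(j + 4) k] and [j k]. As [C] may
    depend on [j] and [eps] but not on [k], for fixed [j] one picks [eps] and then [k]; only
    afterwards does [j] grow. *)
Lemma le_of_scaled_bounds (R : realType) (d : nat) (a U v w c : R) :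
  0 < a -> 0 <= c ->
  (forall (j : nat) (eps : R), (0 < j)%N -> 0 < eps -> exists C : R,
     0 <= C /\ forall k : nat, (0 < k)%N ->
       U <= (1 + 4 / j%:R) ^+ d * v + ((1 + 4 / j%:R) ^+ d - 1) * w +
            (eps + eps) * ((1 + 4 / j%:R) ^+ d * c) + C / (k%:R `^ a)) ->
  U <= v.
Proof.
move=> a0 c0 bound.
have bound_j (j : nat) : (0 < j)%N ->
    U <= (1 + 4 / j%:R) ^+ d * v + ((1 + 4 / j%:R) ^+ d - 1) * w.
  move=> j0; set s := (1 + 4 / j%:R) ^+ d.
  have s0 : 0 <= s by rewrite exprn_ge0// addr_ge0// divr_ge0.
  apply/ler_addgt0Pr => eta eta0.
  have sc0 : 0 <= s * c by rewrite mulr_ge0.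
  (* Chosen so that the term in [eps] is at most [eta / 2]; [k] then makes the last term at most
     [eta / 2]. *)
  pose eps := eta / (4 * (s * c + 1)).
  have eps0 : 0 < eps by rewrite divr_gt0// mulr_gt0// ltr_wpDl.
  have [C [C0 Cb]] := bound j eps j0 eps0.
  have [k k0 kb] := powR_nat_unbounded (2 * C / eta) a0.
  have ka0 : 0 < k%:R `^ a by rewrite powR_gt0// ltr0n.
  apply: le_trans (Cb k k0) _; rewrite -/s -addrA lerD2l.
  have h1 : (eps + eps) * (s * c) <= eta / 2.
    rewrite -mulr2n -[X in X * _]mulr_natr /eps invfM.
    have : (s * c) / (s * c + 1) <= 1 by rewrite ler_pdivrMr ?mul1r ?lerDl// ltr_wpDl.
    move=> h; have := ler_wpM2l (ltW eta0) h; rewrite mulr1 => h'.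
    rewrite (_ : _ * _ = (eta * (s * c / (s * c + 1))) / 2); last by field; rewrite gt_eqF// ltr_wpDl.
    by rewrite ler_pM2r// invr_gt0.
  have h2 : C / (k%:R `^ a) <= eta / 2.
    rewrite ler_pdivrMr//; move: kb; rewrite ler_pdivrMr// => kb.
    by move: kb; move: (k%:R `^ a) => X; nra.
  by rewrite [leRHS]splitr lerD.
have cvgs : (fun n : nat => 1 + 4 / n.+1%:R : R) @ \oo --> (1 + 4 * 0 : R).
  apply: cvgD; first exact: cvg_cst.
  apply: cvgM; [exact: cvg_cst|exact: cvg_harmonic].
have cvgd : (fun n : nat => (1 + 4 / n.+1%:R) ^+ d : R) @ \oo --> (1 : R).
  rewrite -[X in _ --> X](_ : (1 + 4 * 0) ^+ d = 1 :> R); last by rewrite mulr0 addr0 expr1n.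
  by elim: d {bound bound_j} => [|e IH]; [exact: cvg_cst|under eq_fun do rewrite exprS; rewrite exprS; exact: cvgM].
have cvgu : (fun n : nat => (1 + 4 / n.+1%:R) ^+ d * v + ((1 + 4 / n.+1%:R) ^+ d - 1) * w) @ \oo
    --> (1 * v + (1 - 1) * w : R).
  apply: cvgD; first by apply: cvgM => //; exact: cvg_cst.
  apply: cvgM; last exact: cvg_cst.
  by apply: cvgB => //; exact: cvg_cst.
rewrite -[leRHS](_ : 1 * v + (1 - 1) * w = v); last by rewrite subrr mul0r mul1r addr0.
rewrite -(cvg_lim _ cvgu)//; apply: limr_ge; first by apply/cvg_ex; eexists; exact: cvgu.
by apply: nearW => n; exact: bound_j.
Qed.

(** * The volume limit *)

Section Limit.
Context {R : realType} {d : nat} {M M' : topologicalType}.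
Hypothesis M_sc : @second_countable M.
Hypothesis M'_hausdorff : hausdorff_space M'.
Hypothesis M'_lc : locally_compact [set: M'].
Hypothesis M'_sc : @second_countable M'.
Local Notation NM := (config R d M).
Local Notation NMM := (config R d (M * M')%type).
Local Open Scope ereal_scope.
Variables Q Q' : probability NMM R.
Hypothesis statQ : stationary Q.
Hypothesis statQ' : stationary Q'.
Hypothesis same_base : forall E, measurable E ->
  Q (@forget R d M M' @^-1` E) = Q' (@forget R d M M' @^-1` E).
(** In the applications [u] and [v] are the same positive or negative part of the score, and [w] is
    0 or the majorant charged to the layer. *)
Variables u v w : NMM -> \bar R.
Hypothesis mu_ : measurable_fun setT u.
Hypothesis mv : measurable_fun setT v.
Hypothesis mw : measurable_fun setT w.
Hypothesis u0 : forall c, 0 <= u c.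
Hypothesis v0 : forall c, 0 <= v c.
Hypothesis w0 : forall c, 0 <= w c.
Variable a : R.
Hypothesis a0 : (0 < a)%R.

Section Bad.
Variable rho : NMM -> R.
Hypothesis mrho : measurable_fun setT rho.
Hypothesis rho0 : forall c, (0 <= rho c)%R.
Local Notation rhos := (fun c => (rho c `^ (d%:R + a))%:E).
Variables j k : nat.
Hypothesis j0 : (0 < j)%N.
Hypothesis k0 : (0 < k)%N.
Local Notation m := (j * k)%N.
Local Notation W0 := (@box R d (3 * k) (3 * k + m)).
Local Notation W2 := (@box R d k (5 * k + m)).

Let exceed : NMM -> \bar R := fun c => (\1_[set c | ((2 * k)%:R < rho c)%R] c)%:E.

Let mexceed : measurable_fun setT exceed.
Proof.
apply/measurable_EFinP; apply: measurable_indic.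
rewrite -[X in measurable X]setTI (_ : [set c | _] = rho @^-1` `](2 * k)%:R, +oo[%classic).
  exact: mrho.
by apply/seteqP; split => c /=; rewrite in_itv/= andbT.
Qed.

Let exceed0 c : 0 <= exceed c. Proof. by rewrite lee_fin. Qed.

(** Some point of [W2] has a radius above [2 * k], phrased as a point count so that measurability
    and Markov's inequality apply. *)
Definition bad : set NMM := [set c | 1 <= shift_sum exceed W2 c].

Lemma measurable_bad : measurable bad.
Proof.
rewrite -[X in measurable X]setTI; apply: emeasurable_fun_c_infty => //.
exact: measurable_shift_sum_box.
Qed.

Lemma not_bad c y : ~ bad c -> locations c y -> W2 y -> (rho (shift y c) <= (2 * k)%:R)%R.
Proof.
move=> nb py Wy; rewrite leNgt; apply/negP => ry; apply: nb; rewrite /bad /=.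
rewrite /shift_sum /location_sum (esumID [set y]); last by move=> x _; exact: exceed0.
have -> : locations c `&` W2 `&` [set y] = [set y].
  by apply/seteqP; split => [z []//|z ->].
rewrite esum_set1//= {1}/exceed indicE mem_set//= leeDl//.
by apply: esum_ge0 => x _; exact: exceed0.
Qed.

(* The exponent [d + a] beats the volume of [W2], of order [k ^ d]. *)
Lemma probability_bad (P : probability NMM R) : stationary P ->
  P bad <= (((j + 4) ^ d)%:R / (k%:R `^ a))%:E * \int[P]_c shift_sum rhos (box 0 1) c.
Proof.
move=> statP.
have rhos0 c : 0 <= (rho c `^ (d%:R + a))%:E by rewrite lee_fin powR_ge0.
have mrhos : measurable_fun setT rhos.
  apply/measurable_EFinP; apply: (measurableT_comp (measurable_powR _) mrho).
have kR : (0 < k%:R :> R)%R by rewrite ltr0n.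
have kd0 : (0 < k%:R ^+ d :> R)%R by rewrite exprn_gt0.
have ka0 : (0 < k%:R `^ a :> R)%R by rewrite powR_gt0.
have ks : (k%:R `^ (d%:R + a) = k%:R ^+ d * k%:R `^ a :> R)%R.
  by rewrite powRD ?powR_mulrn ?ler0n//; apply/implyP => _; rewrite gt_eqF.
(* A radius above [2 * k] exceeds [k], so its quotient by [k], raised to the power [d + a], is at
   least 1. *)
have exceed_le c : exceed c <= (k%:R `^ (d%:R + a))^-1%:E * (rho c `^ (d%:R + a))%:E.
  rewrite -EFinM lee_fin /exceed indicE; have [/set_mem /= h|_] := boolP (_ \in _); last first.
    by rewrite mulr_ge0 ?powR_ge0// invr_ge0 powR_ge0.
  rewrite mulrC ler_pdivlMr ?powR_gt0// mul1r; apply: ge0_ler_powR; rewrite ?nnegrE ?ler0n ?rho0//.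
    by rewrite addr_ge0 ?ler0n// ltW.
  by apply: le_trans (ltW h); rewrite ler_nat; lia.
have bE : \int[P]_c shift_sum exceed (box 0 1) c <=
    (k%:R `^ (d%:R + a))^-1%:E * \int[P]_c shift_sum rhos (box 0 1) c.
  have mV := measurable_shift_sum_box 0 1 mrhos rhos0.
  rewrite -ge0_integralZl//; last by move=> c _; exact: shift_sum_ge0.
  apply: ge0_le_integral => //.
  - by move=> c _; exact: shift_sum_ge0.
  - exact: measurable_shift_sum_box.
  - by apply: measurable_funeM.
  - move=> c _; rewrite /shift_sum /location_sum.
    have fW : finite_set (locations c `&` box 0 1) by apply: finite_locations; exact: bounded_box.
    rewrite !esum_fset//.
    rewrite !fsbig_finite//= ge0_sume_distrr//.
    by apply: lee_sum => x _; exact: exceed_le.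
have : P bad <= \int[P]_c shift_sum exceed W2 c.
  have mB := measurable_bad.
  rewrite -[X in P X](setIT bad) -integral_indic//.
  apply: ge0_le_integral => //.
  - by apply/measurable_EFinP; exact: measurable_indic.
  - exact: measurable_shift_sum_box.
  - move=> c _; rewrite indicE; have [/set_mem h|_] := boolP (c \in bad); first exact: h.
    exact: shift_sum_ge0.
move=> /le_trans; apply.
rewrite (_ : 5 * k + m = k + (j + 4) * k)%N; last by lia.
rewrite integral_shift_sum_box//.
apply: (@le_trans _ _ ((((j + 4) * k) ^ d)%:R%:E * ((k%:R `^ (d%:R + a))^-1%:E * \int[P]_c shift_sum rhos (box 0 1) c))).
  by apply: lee_wpmul2l => //; rewrite lee_fin.
rewrite muleA -EFinM ks expnMn natrM natrX invfM.
by rewrite natrX mulrA mulfK// gt_eqF.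
Qed.

End Bad.

(** The outer cube minus the inner one, by a subtraction that finiteness of the integral makes
    legitimate. *)
Lemma integral_shift_sum_shell (P : probability NMM R) (j k : nat) : stationary P ->
  \int[P]_c shift_sum w (box 0 1) c < +oo ->
  \int[P]_c shift_sum w (box k (5 * k + j * k) `\` box (3 * k) (3 * k + j * k)) c =
  ((((j + 4) * k) ^ d)%:R - ((j * k) ^ d)%:R)%:E * \int[P]_c shift_sum w (box 0 1) c.
Proof.
move=> statP finw.
have W2E : (5 * k + j * k = k + (j + 4) * k)%N by lia.
have W02 : @box R d (3 * k) (3 * k + j * k) `<=` box k (5 * k + j * k).
  by apply: box_subset; lia.
have : \int[P]_c shift_sum w (box k (5 * k + j * k)) c =
    \int[P]_c shift_sum w (box (3 * k) (3 * k + j * k)) c +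
    \int[P]_c shift_sum w (box k (5 * k + j * k) `\` box (3 * k) (3 * k + j * k)) c.
  rewrite -ge0_integralD//.
  - apply: eq_integral => c _; rewrite /shift_sum /location_sum.
    rewrite (esumID (box (3 * k) (3 * k + j * k)))//.
    by rewrite -setIA (setIidr W02) -setIA -setDE.
  - by move=> c _; exact: shift_sum_ge0.
  - exact: measurable_shift_sum_box.
  - by move=> c _; exact: shift_sum_ge0.
  - apply: (measurable_shift_sum (N := (5 * k + j * k).+1)) => //.
      by rewrite setDE; apply: sigma_algebra_setI; [exact: borel_box|apply: sigma_algebra_setC; exact: borel_box].
    by move=> z [+ _]; exact: box_window.
rewrite W2E (integral_shift_sum_box statP k ((j + 4) * k) mw w0).
rewrite (integral_shift_sum_box statP (3 * k) (j * k) mw w0).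
have : 0 <= \int[P]_c shift_sum w (box 0 1) c.
  by apply: integral_ge0 => c _; exact: shift_sum_ge0.
case: (\int[P]_c shift_sum w (box 0 1) c) finw => [r| |]// _ _.
case: (\int[P]_c _) => [s| |]//; rewrite -!EFinM -EFinD => -[h]; congr (_%:E); lra.
Qed.

(** Truncating each unit cell at [t] bounds the sum over the inner cube by [t (j k)^d], so the bad
    event of either law costs at most this constant times its probability. Off both bad events the
    deterministic comparison applies. *)
Lemma truncated_limit_step (rho : NMM -> R) (A A' : set NMM) (j k t : nat) (eps : R) :
  measurable_fun setT rho -> (forall c, (0 <= rho c)%R) ->
  (0 < j)%N -> (0 < k)%N -> (0 <= eps)%R ->
  {ae Q, forall c, A c} -> {ae Q', forall c, A' c} ->
  (forall psi psi', forget psi = forget psi' -> A psi -> A' psi' ->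
     ~ bad rho j k psi -> ~ bad rho j k psi' ->
     shift_sum u (box (3 * k) (3 * k + j * k)) psi <=
     shift_sum v (box k (5 * k + j * k)) psi' +
     shift_sum w (box k (5 * k + j * k) `\` box (3 * k) (3 * k + j * k)) psi' +
     (eps + eps)%:E * card_sum (locations psi' `&` box k (5 * k + j * k))) ->
  \int[Q']_c shift_sum w (box 0 1) c < +oo ->
  ((j * k) ^ d)%:R%:E * \int[Q]_c Order.min (shift_sum u (box 0 1) c) t%:R%:E <=
  (((j + 4) * k) ^ d)%:R%:E * \int[Q']_c shift_sum v (box 0 1) c +
  ((((j + 4) * k) ^ d)%:R - ((j * k) ^ d)%:R)%:E * \int[Q']_c shift_sum w (box 0 1) c +
  (eps + eps)%:E * ((((j + 4) * k) ^ d)%:R%:E * \int[Q']_c card_sum (R := R) (locations c `&` box 0 1)) +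
  (t * (j * k) ^ d)%:R%:E * (Q (bad rho j k) + Q' (bad rho j k)).
Proof.
move=> mrho rho0 j0 k0 eps0 aeA aeA' det finw.
have W2E : (5 * k + j * k = k + (j + 4) * k)%N by lia.
set W0 := box (3 * k) _ in det *; set W2 := box k _ in det *.
set B := bad rho j k in det *.
have mB : measurable B by exact: measurable_bad.
pose V c : \bar R := Order.min (shift_sum u (box 0 1) c) t%:R%:E.
have t0 : 0 <= (t%:R%:E : \bar R) by rewrite lee_fin ler0n.
have V0 c : 0 <= V c by rewrite /V le_min t0 andbT; exact: shift_sum_ge0.
have mV : measurable_fun setT V.
  by apply: measurable_mine => //; exact: measurable_shift_sum_box.
pose S c := \sum_(g : {ffun 'I_d -> 'I_(j * k)}) V (shift (corner (3 * k) g) c).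
have S0 c : 0 <= S c by apply: sume_ge0 => g _; exact: V0.
have mS : measurable_fun setT S.
  by apply: emeasurable_sum => g; apply: measurableT_comp => //; exact: measurable_shift.
have mIB : measurable_fun setT (fun c => (\1_B c)%:E : \bar R).
  by apply/measurable_EFinP; exact: measurable_indic.
have mIBC : measurable_fun setT (fun c => (\1_(~` B) c)%:E : \bar R).
  by apply/measurable_EFinP; apply: measurable_indic; exact: measurableC.
have IB0 c : 0 <= (\1_B c)%:E :> \bar R by rewrite lee_fin.
have SU c : S c <= shift_sum u W0 c.
  rewrite /W0 shift_sum_cells//; apply: lee_sum => g _.
  by rewrite /V ge_min lexx.
have St c : S c <= (t * (j * k) ^ d)%:R%:E.
  apply: (@le_trans _ _ (\sum_(g : {ffun 'I_d -> 'I_(j * k)}) t%:R%:E)).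
    by apply: lee_sum => g _; rewrite /V ge_min lexx orbT.
  by rewrite big_const card_ffun !card_ord iter_adde_ge0// -EFinM lee_fin -natrM mulnC.
(* The indicator removes the bad configurations of [Q]; those of [Q'] are paid for by [z] below.
   Thus the two bad events may differ above the same base configuration. *)
pose f c := (\1_(~` B) c)%:E * S c.
pose T : \bar R := (t * (j * k) ^ d)%:R%:E.
have T0 : 0 <= T by rewrite lee_fin ler0n.
have eps2 : 0 <= ((eps + eps)%:E : \bar R) by rewrite lee_fin addr_ge0.
pose e (c : NMM) := (eps + eps)%:E * shift_sum (cst 1) W2 c.
have c10 (c : NMM) : 0 <= cst (1 : \bar R) c by [].
have m1 : measurable_fun setT (cst 1 : NMM -> \bar R) by exact: measurable_cst.
have e0 c : 0 <= e c by rewrite mule_ge0// shift_sum_ge0.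
have me1 := measurable_shift_sum_box k (5 * k + j * k) m1 c10.
have me : measurable_fun setT e by exact: measurable_funeM.
pose x (c : NMM) := shift_sum v W2 c; pose y (c : NMM) := shift_sum w (W2 `\` W0) c.
have x0 c : 0 <= x c by exact: shift_sum_ge0.
have y0 c : 0 <= y c by exact: shift_sum_ge0.
have mx : measurable_fun setT x by exact: measurable_shift_sum_box.
have my : measurable_fun setT y.
  apply: (measurable_shift_sum (N := (5 * k + j * k).+1)) => //.
    by rewrite setDE; apply: sigma_algebra_setI; [exact: borel_box|apply: sigma_algebra_setC; exact: borel_box].
  by move=> z [+ _]; exact: box_window.
pose z (c : NMM) := T * (\1_B c)%:E.
have z0 c : 0 <= z c by rewrite mule_ge0.
have mz : measurable_fun setT z by exact: measurable_funeM.
have intz (P : probability NMM R) : \int[P]_c z c = T * P B.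
  by rewrite ge0_integralZl// integral_indic// setIT.
have fg : \int[Q]_c f c <= \int[Q']_c (x c + y c + e c + z c).
  apply: (integral_le_markings M_sc M'_hausdorff M'_lc M'_sc (A := A) (A' := A')) => //.
  - exact: emeasurable_funM.
  - by apply: emeasurable_funD => //; apply: emeasurable_funD => //; apply: emeasurable_funD.
  - by move=> c; rewrite mule_ge0// lee_fin.
  - by move=> c; rewrite !adde_ge0.
  - move=> c c' cc' Ac Ac'; rewrite /f indicE.
    have [/set_mem nBc|_] := boolP (c \in ~` B); last by rewrite mul0e !adde_ge0.
    rewrite mul1e; have [Bc'|nBc'] := pselect (B c').
      apply: (le_trans (St c)); rewrite /z indicE mem_set// mule1 leeDr//.
      by rewrite !adde_ge0.
    apply: (le_trans (SU c)); apply: (le_trans (det _ _ cc' Ac Ac' nBc nBc')).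
    by rewrite leeDl.
have SE : \int[Q]_c S c = ((j * k) ^ d)%:R%:E * \int[Q]_c V c.
  rewrite ge0_integral_sum//; last first.
    by move=> g; apply: measurableT_comp => //; exact: measurable_shift.
  rewrite (eq_bigr (fun=> \int[Q]_c V c)); last by move=> g _; exact: integral_shift.
  rewrite big_const card_ffun !card_ord; apply: iter_adde_ge0.
  exact: integral_ge0.
rewrite -SE; apply: (@le_trans _ _ (\int[Q]_c (f c + z c))).
  apply: ge0_le_integral => //.
  - by apply: emeasurable_funD => //; exact: emeasurable_funM.
  - move=> c _; rewrite /f /z !indicE; have [Bc|nBc] := pselect (B c).
      by rewrite (mem_set Bc) memNset ?mul0e ?add0e ?mule1// => /(_ Bc).
    by rewrite (memNset nBc) mem_set// mul1e mule0 adde0.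
rewrite ge0_integralD//; last 2 first.
- by move=> c _; rewrite mule_ge0// lee_fin.
- exact: emeasurable_funM.
rewrite intz -/T (_ : T * (Q B + Q' B) = T * Q B + T * Q' B); last by rewrite ge0_muleDr.
rewrite [X in _ <= _ + X]addeC addeA; apply: leeD => //.
apply: (le_trans fg).
rewrite ge0_integralD//; last 2 first.
- by move=> c _; rewrite !adde_ge0.
- by apply: emeasurable_funD => //; exact: emeasurable_funD.
rewrite intz; apply: leeD => //.
rewrite ge0_integralD//; last 2 first.
- by move=> c _; rewrite !adde_ge0.
- exact: emeasurable_funD.
rewrite ge0_integralD//.
apply: leeD; last first.
  rewrite /e ge0_integralZl//; last by move=> c _; exact: shift_sum_ge0.
  by rewrite /W2 W2E (integral_shift_sum_box statQ' k ((j + 4) * k) m1 c10).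
apply: leeD; first by rewrite /x /W2 W2E (integral_shift_sum_box statQ' k ((j + 4) * k) mv v0).
by rewrite /y /W2 /W0 integral_shift_sum_shell.
Qed.

End Limit.

Lemma integral_min_le (R : realType) (disp : measure_display) (T : measurableType disp)
  (mu : {measure set T -> \bar R}) (f : T -> \bar R) (a : \bar R) :
  measurable_fun setT f -> (forall x, 0 <= f x)%E ->
  (forall t : nat, \int[mu]_x Order.min (f x) t%:R%:E <= a)%E ->
  (\int[mu]_x f x <= a)%E.
Proof.
move=> mf f0 fa.
pose g (n : nat) x := Order.min (f x) n%:R%:E.
have ndg x : nondecreasing_seq (g^~ x).
  move=> n n' nn'; rewrite /g le_min ge_min lexx /= ge_min lee_fin ler_nat nn' orbT.
  by [].
have g0 n x : (0 <= g n x)%E by rewrite /g le_min f0 lee_fin ler0n.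
have mg n : measurable_fun setT (g n) by exact: measurable_mine.
have glim x : g n x @[n --> \oo] --> f x.
  have := ereal_nondecreasing_cvgn (ndg x); congr (_ --> _).
  apply/eqP; rewrite eq_le; apply/andP; split.
    by apply: ge_ereal_sup => _ [n _ <-]; rewrite /g ge_min lexx.
  case E : (f x) (f0 x) => [r| |] // r0.
    apply: le_trans (ereal_sup_ubound _); last by exists (Num.trunc r).+1.
    by rewrite /g E le_min lexx lee_fin; exact/ltW/truncnS_gt.
  rewrite leye_eq; apply/eqP/eqyP => s s0.
  apply: le_trans (ereal_sup_ubound _); last by exists (Num.trunc s).+1.
  by rewrite /g E le_min leey lee_fin; exact/ltW/truncnS_gt.
rewrite (eq_integral (fun x => limn (g^~ x))); last first.
  by move=> x _; apply/esym/cvg_lim => //; exact: glim.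
rewrite (monotone_convergence mu measurableT mg); last 2 first.
- by [].
- by move=> x _; exact: ndg.
apply: lime_le; last by apply: nearW => n; exact: fa.
apply: ereal_nondecreasing_is_cvgn => n n' nn'; apply: ge0_le_integral => //.
by move=> x _; exact: ndg.
Qed.

Lemma scaled_bound_real (R : realFieldType) (d j k t : nat) (U v w c e X b b' Cf Cg : R) :
  (0 < j)%N -> (0 < k)%N -> 
  ((j * k) ^ d)%:R * U <= (((j + 4) * k) ^ d)%:R * v +
    ((((j + 4) * k) ^ d)%:R - ((j * k) ^ d)%:R) * w +
    e * ((((j + 4) * k) ^ d)%:R * c) + (t * (j * k) ^ d)%:R * (b + b') ->
  b <= ((j + 4) ^ d)%:R / X * Cf -> b' <= ((j + 4) ^ d)%:R / X * Cg ->
  U <= (1 + 4 / j%:R) ^+ d * v + ((1 + 4 / j%:R) ^+ d - 1) * w +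
       e * ((1 + 4 / j%:R) ^+ d * c) + (t * (j + 4) ^ d)%:R * (Cf + Cg) / X.
Proof.
move=> j0 k0.
have jR : 0 < j%:R :> R by rewrite ltr0n.
have -> : (((j + 4) * k) ^ d)%:R = ((j * k) ^ d)%:R * (1 + 4 / j%:R) ^+ d :> R.
  rewrite !natrX -exprMn; congr (_ ^+ d); rewrite !natrM natrD.
  by field; rewrite gt_eqF.
have m0 : 0 < ((j * k) ^ d)%:R :> R by rewrite ltr0n expn_gt0 muln_gt0 j0 k0.
rewrite !natrM; move: ((j * k) ^ d)%:R m0 ((j + 4) ^ d)%:R => m m0 A.
move: ((1 + 4 / j%:R) ^+ d) => s h hb hb'.
rewrite -(ler_pM2l m0); apply: (le_trans h).
have h1 : t%:R * m * (b + b') <= t%:R * m * (A / X * (Cf + Cg)).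
  by apply: ler_wpM2l; [rewrite mulr_ge0 ?ler0n// ltW|rewrite mulrDr lerD].
move: h1; rewrite -(lerD2l (m * s * v + (m * s - m) * w + e * (m * s * c))).
move=> /le_trans; apply; rewrite le_eqVlt; apply/orP; left; apply/eqP; ring.
Qed.

(** Both signs of the score enter through the deterministic comparison in the last hypothesis. The
    optimal law plays the role of [Q'] for nonnegative scores and that of [Q] for nonpositive
    ones. *)
Lemma integral_le_of_local_bounds (R : realType) (d : nat) (M M' : topologicalType)
  (M_sc : @second_countable M) (M'_hausdorff : hausdorff_space M')
  (M'_lc : locally_compact [set: M']) (M'_sc : @second_countable M')
  (Q Q' : probability (config R d (M * M')%type) R)
  (u v w : config R d (M * M')%type -> \bar R) (a : R) :
  stationary Q -> stationary Q' ->
  (forall E, measurable E -> Q (@forget R d M M' @^-1` E) = Q' (@forget R d M M' @^-1` E)) ->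
  measurable_fun setT u -> measurable_fun setT v -> measurable_fun setT w ->
  (forall c, 0 <= u c)%E -> (forall c, 0 <= v c)%E -> (forall c, 0 <= w c)%E ->
  (0 < a) ->
  (\int[Q']_c card_sum (R := R) (locations c `&` box 0 1) < +oo)%E ->
  (\int[Q']_c shift_sum w (box 0 1) c < +oo)%E ->
  (forall eps : R, 0 < eps -> exists (rho : config R d (M * M')%type -> R) A A',
    [/\ measurable_fun setT rho, (forall c, 0 <= rho c),
        (\int[Q]_c shift_sum (fun c => (rho c `^ (d%:R + a))%:E) (box 0 1) c < +oo)%E /\
        (\int[Q']_c shift_sum (fun c => (rho c `^ (d%:R + a))%:E) (box 0 1) c < +oo)%E,
        {ae Q, forall c, A c} /\ {ae Q', forall c, A' c} &
        forall psi psi' j k, forget psi = forget psi' -> A psi -> A' psi' ->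
        (forall y, locations psi y -> box k (5 * k + j * k) y -> rho (shift y psi) <= (2 * k)%:R) ->
        (forall y, locations psi' y -> box k (5 * k + j * k) y -> rho (shift y psi') <= (2 * k)%:R) ->
        (shift_sum u (box (3 * k) (3 * k + j * k)) psi <=
         shift_sum v (box k (5 * k + j * k)) psi' +
         shift_sum w (box k (5 * k + j * k) `\` box (3 * k) (3 * k + j * k)) psi' +
         (eps + eps)%:E * card_sum (locations psi' `&` box k (5 * k + j * k)))%E]) ->
  (\int[Q]_c shift_sum u (box 0 1) c <= \int[Q']_c shift_sum v (box 0 1) c)%E.
Proof.
move=> statQ statQ' same_base mu_ mv mw u0 v0 w0 a0 finc finw hyp.
have v10 : (0 <= \int[Q']_c shift_sum v (box 0 1) c)%E.
  by apply: integral_ge0 => c _; exact: shift_sum_ge0.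
have w10 : (0 <= \int[Q']_c shift_sum w (box 0 1) c)%E.
  by apply: integral_ge0 => c _; exact: shift_sum_ge0.
have c10 : (0 <= \int[Q']_c card_sum (R := R) (locations c `&` box 0 1))%E.
  by apply: integral_ge0 => c _; exact: card_sum_ge0.
apply: integral_min_le; [exact: measurable_shift_sum_box|by move=> c; exact: shift_sum_ge0|move=> t].
case vE : (\int[Q']_c shift_sum v (box 0 1) c)%E v10 => [v1| |]// v10; last by rewrite leey.
have : (\int[Q]_c Order.min (shift_sum u (box 0 1) c) t%:R%:E <= t%:R%:E)%E.
  apply: (@le_trans _ _ (\int[Q]_c cst t%:R%:E c)%E); last first.
    by rewrite integral_cst//= probability_setT mule1.
  apply: ge0_le_integral => //.
  - by move=> c _; rewrite le_min lee_fin ler0n shift_sum_ge0.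
  - by apply: measurable_mine => //; exact: measurable_shift_sum_box.
  - by move=> c _; rewrite ge_min lexx orbT.
have : (0 <= \int[Q]_c Order.min (shift_sum u (box 0 1) c) t%:R%:E)%E.
  by apply: integral_ge0 => c _; rewrite le_min lee_fin ler0n shift_sum_ge0.
case wE : (\int[Q']_c shift_sum w (box 0 1) c)%E w10 finw => [w1| |]// w10 finw.
case cE : (\int[Q']_c card_sum _)%E c10 finc => [c1| |]// c10 _.
case UE : (\int[Q]_c Order.min _ _)%E => [U| |]// _ _.
rewrite lee_fin; apply: (@le_of_scaled_bounds R d a U v1 w1 c1 a0) => //.
move=> j eps j0 eps0.
have [rho [A [A' [mrho rho0 [finQ finQ'] [aeA aeA'] det]]]] := hyp eps eps0.
have [Cf CfE Cf0] : exists2 Cf : R, (\int[Q]_c shift_sum (fun c => (rho c `^ (d%:R + a))%:E) (box 0 1) c)%E = Cf%:E & 0 <= Cf.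
  have : (0 <= \int[Q]_c shift_sum (fun c => (rho c `^ (d%:R + a))%:E) (box 0 1) c)%E.
    by apply: integral_ge0 => c _; apply: shift_sum_ge0 => c'; rewrite lee_fin powR_ge0.
  by move: finQ; case: (\int[Q]_c _)%E => [r| |]// _ r0; exists r.
have [Cg CgE Cg0] : exists2 Cf : R, (\int[Q']_c shift_sum (fun c => (rho c `^ (d%:R + a))%:E) (box 0 1) c)%E = Cf%:E & 0 <= Cf.
  have : (0 <= \int[Q']_c shift_sum (fun c => (rho c `^ (d%:R + a))%:E) (box 0 1) c)%E.
    by apply: integral_ge0 => c _; apply: shift_sum_ge0 => c'; rewrite lee_fin powR_ge0.
  by move: finQ'; case: (\int[Q']_c _)%E => [r| |]// _ r0; exists r.
(* Independent of [k]: the truncation level, a volume factor and the two moments of the radii. *)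
exists ((t * (j + 4) ^ d)%:R * (Cf + Cg)); split.
  by rewrite mulr_ge0 ?ler0n ?addr_ge0.
move=> k k0.
have bQ := probability_bad a0 mrho rho0 j0 k0 statQ.
have bQ' := probability_bad a0 mrho rho0 j0 k0 statQ'.
rewrite -wE in finw.
have step := truncated_limit_step M_sc M'_hausdorff M'_lc M'_sc statQ statQ' same_base mu_ mv mw
  u0 v0 w0 a0 t mrho rho0 j0 k0 (ltW eps0) aeA aeA' _ finw.
have mB : measurable (bad rho j k) by exact: measurable_bad.
have f1 : (Q (bad rho j k) = (fine (Q (bad rho j k)))%:E)%E by rewrite fineK// fin_num_measure.
have f2 : (Q' (bad rho j k) = (fine (Q' (bad rho j k)))%:E)%E by rewrite fineK// fin_num_measure.
move: bQ bQ'; rewrite CfE CgE f1 f2 -!EFinM !lee_fin => bQ bQ'.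
apply: (scaled_bound_real (b := fine (Q (bad rho j k))) (b' := fine (Q' (bad rho j k))) j0 k0 _ bQ bQ').
move: step; rewrite UE vE wE cE f1 f2 -!EFinM -!EFinD lee_fin; apply.
move=> psi psi' same Apsi Apsi' nb nb'; apply: det => // y.
- exact: not_bad.
- exact: not_bad.
Qed.

(** * Palm expectations and score intensities *)

Section Intensities.
Context {R : realType} {d : nat} {K : topologicalType}.
Local Notation V := 'rV[R]_d.
Local Notation conf := (config R d K).
Local Notation U := (@unit_cube R d).
Local Open Scope ereal_scope.

Lemma measurable_configs_at0 : measurable (configs_at0 : set conf).
Proof.
apply: sub_gen_smallest; exists (fst @^-1` [set 0%R : V]), 1%N; split => //.
rewrite -[X in <<s _ >> X]setCK; apply: sigma_algebra_setC; apply: sub_gen_smallest.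
apply: closed_openC; apply: (preimage_closed (f := @fst V K)) => [x _|].
  exact: cvg_fst.
exact: (accessible_closed_set1 (hausdorff_accessible (@norm_hausdorff _ _))).
Qed.

Lemma finite_unit_cube (psi : conf) : finite_set (locations psi `&` U).
Proof.
apply: finite_locations; have [r [rr rW]] := window_bounded (R := R) (d := d) 2.
by exists r; split => // t tM z /unit_cube_window; exact: rW.
Qed.

Lemma point_sum_restrict (f h : conf -> \bar R) psi :
  (forall c, configs_at0 c -> f c = h c) -> point_sum f psi = point_sum h psi.
Proof.
move=> fh; apply: eq_fsbigr => x /set_mem[px _]; apply: fh.
exact: configs_at0_shift.
Qed.

Lemma point_sumE (h : conf -> \bar R) psi : (forall c, 0 <= h c) ->
  point_sum h psi = shift_sum h U psi.
Proof.
by move=> h0; rewrite /shift_sum /location_sum esum_fset//; exact: finite_unit_cube.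
Qed.

(** Extension by 0 makes [f] a function on all configurations without changing the sum, as a
    configuration shifted to one of its points has a point at the origin. *)
Lemma point_sum_ge0E (f : conf -> \bar R) psi : (forall c, configs_at0 c -> 0 <= f c) ->
  point_sum f psi = shift_sum (f \_ configs_at0) U psi.
Proof.
move=> f0; rewrite -point_sumE.
  by apply: point_sum_restrict => c c0; rewrite patchE mem_set.
by move=> c; rewrite patchE; case: ifPn => // /set_mem; exact: f0.
Qed.

Lemma point_sum_funeposneg (f : conf -> \bar R) psi :
  point_sum f psi =
  shift_sum (f \_ configs_at0)^\+ U psi - shift_sum (f \_ configs_at0)^\- U psi.
Proof.
rewrite -!point_sumE//.
rewrite (@point_sum_restrict f (f \_ configs_at0)); last first.
  by move=> c c0; rewrite patchE mem_set.
have fU := finite_unit_cube psi.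
rewrite /point_sum !fsbig_finite//=.
rewrite -sumeN; last by move=> i j _ _; rewrite ge0_adde_def// inE.
rewrite -big_split /=; apply: eq_bigr => x _.
exact: (congr1 (@^~ (shift x psi)) (funeposneg (f \_ configs_at0))).
Qed.

Lemma counting_card_sum (T : choiceType) (A : set T) : finite_set A ->
  counting A = card_sum A :> \bar R.
Proof. by move=> fA; rewrite card_sum_fset// /counting asboolT. Qed.

Lemma intensityE (Q : probability conf R) :
  intensity Q = \int[Q]_c card_sum (R := R) (locations c `&` U).
Proof.
apply: eq_integral => c _; rewrite counting_card_sum.
  rewrite card_locations; congr card_sum; apply/seteqP.
  by split => [a [pa Ua]|a [pa [Ua _]]]; split.
apply: config_locfin; have [r [rr rW]] := window_bounded (R := R) (d := d) 2.
by exists r; split => // t tM z /unit_cube_window; exact: rW.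
Qed.

Lemma box_unit_cube : box 0 1 `<=` U.
Proof. by move=> x bx i; have /andP[-> /ltW] := bx i. Qed.

Variable Q : probability conf R.
Hypothesis Q_intensity : 0 < intensity Q < +oo.

Lemma integral_card_box_lty :
  \int[Q]_c card_sum (R := R) (locations c `&` box 0 1) < +oo.
Proof.
have /andP[_] := Q_intensity; rewrite intensityE; apply: le_lt_trans.
have m1 : measurable_fun setT (cst 1 : conf -> \bar R) by exact: measurable_cst.
have c10 (c : conf) : 0 <= cst (1 : \bar R) c by [].
apply: ge0_le_integral => //.
- by move=> c _; exact: card_sum_ge0.
- exact: (measurable_shift_sum_box 0 1 m1 c10).
- exact: (measurable_shift_sum borel_unit_cube unit_cube_window m1 c10).
- by move=> c _; apply: card_sum_subset => x [px /box_unit_cube].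
Qed.

Lemma palm_expectationE (f : conf -> \bar R) : (forall c, configs_at0 c -> 0 <= f c) ->
  palm_expectation Q f =
  ((fine (intensity Q))^-1)%:E * \int[Q]_c shift_sum (f \_ configs_at0) U c.
Proof.
by move=> f0; congr (_ * _); apply: eq_integral => c _; rewrite point_sum_ge0E.
Qed.

Let inv_intensity_gt0 : (0 < (fine (intensity Q))^-1)%R.
Proof. by rewrite invr_gt0 fine_gt0. Qed.

Lemma palm_expectation_lty (f : conf -> \bar R) :
  measurable_fun configs_at0 f -> (forall c, configs_at0 c -> 0 <= f c) ->
  palm_expectation Q f < +oo ->
  \int[Q]_c shift_sum (f \_ configs_at0) (box 0 1) c < +oo.
Proof.
move=> mf f0; rewrite palm_expectationE// => fin.
have f0' c : 0 <= (f \_ configs_at0) c.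
  by rewrite patchE; case: ifPn => // /set_mem; exact: f0.
have mf' : measurable_fun setT (f \_ configs_at0).
  by apply/measurable_restrict; rewrite ?setTI//; exact: measurable_configs_at0.
apply: (@le_lt_trans _ _ (\int[Q]_c shift_sum (f \_ configs_at0) U c)).
  apply: ge0_le_integral => //.
  - by move=> c _; exact: shift_sum_ge0.
  - exact: measurable_shift_sum_box.
  - exact: (measurable_shift_sum borel_unit_cube unit_cube_window).
  - by move=> c _; apply: shift_sum_subset => //; exact: box_unit_cube.
have : 0 <= \int[Q]_c shift_sum (f \_ configs_at0) U c.
  by apply: integral_ge0 => c _; exact: shift_sum_ge0.
by move: fin; case: (\int[Q]_c _) => [r| |]//; rewrite ?ltry// gt0_muley ?lte_fin.
Qed.

(** This turns stabilization, assumed under the Palm measure, into a property seen from every point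
    of almost every realization. *)
Lemma ae_palm (stat : stationary Q) (P : set conf) : {ae palm Q, forall c, P c} ->
  {ae Q, forall c, forall x, locations c x -> P (shift x c)}.
Proof.
move=> [N [mN QN PN]].
have : {ae Q, forall c, forall x, locations c x -> ~ N (shift x c)}.
  apply: (ae_points stat mN).
  have I0 (c : conf) : 0 <= (\1_N c)%:E :> \bar R by rewrite lee_fin.
  move/eqP: QN; rewrite /palm /palm_expectation mule_eq0 => /orP[|/eqP <-].
    by rewrite eqe gt_eqF.
  by apply: eq_integral => c _; rewrite point_sumE.
apply: filterS => c cN x px; apply: contrapT => nP.
by apply: (cN x px); apply: PN.
Qed.

End Intensities.

Section ScoreIntensity.
Context {R : realType} {d : nat} {M M' : topologicalType}.
Local Notation NM := (config R d M).
Local Notation NMM := (config R d (M * M')%type).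
Local Notation U := (@unit_cube R d).
Local Open Scope ereal_scope.
Variable xi : NMM -> \bar R.
Hypothesis mxi : measurable_fun (configs_at0 : set NMM) xi.
Local Notation xi0 := (xi \_ (configs_at0 : set NMM)).

Lemma measurable_score_restrict : measurable_fun setT xi0.
Proof. by apply/measurable_restrict; rewrite ?setTI//; exact: measurable_configs_at0. Qed.

Local Notation mxi0 := measurable_score_restrict.
Let mpos : measurable_fun setT xi0^\+ := measurable_funepos mxi0.
Let mneg : measurable_fun setT xi0^\- := measurable_funeneg mxi0.
Let mSpos := measurable_shift_sum borel_unit_cube unit_cube_window mpos (funepos_ge0 xi0).
Let mSneg := measurable_shift_sum borel_unit_cube unit_cube_window mneg (funeneg_ge0 xi0).

Variable Q : probability NMM R.
Hypothesis stat : stationary Q.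
Hypothesis Q_intensity : 0 < intensity Q < +oo.

Lemma xi_intensityE :
  xi_intensity xi Q = \int[Q]_c (shift_sum xi0^\+ U c - shift_sum xi0^\- U c).
Proof. by apply: eq_integral => c _; rewrite point_sum_funeposneg. Qed.

(* A score [-oo] at a point of the cube makes the negative part of the sum infinite. *)
Lemma ae_admissible_of_intensity :
  xi_intensity xi Q != -oo -> {ae Q, forall psi, admissible xi psi}.
Proof.
rewrite xi_intensityE; set f := fun c => _ - _ => intf.
have mf : measurable_fun setT f by exact: emeasurable_funB.
(* With an infinite negative part the integral is [-oo], whatever the positive part. *)
have negf : \int[Q]_c f^\- c < +oo.
  rewrite ltey; apply: contra_neq intf => negE.
  by rewrite integralE negE addeNy.
have aef : {ae Q, forall c, f c != -oo}.
  have : Q.-integrable setT f^\-.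
    apply/integrableP; split; first exact: measurable_funeneg.
    by under eq_integral do rewrite gee0_abs//.
  move/(integrable_ae measurableT); apply: filterS => c /(_ I).
  by apply: contraTneq => fc; rewrite funenegE fc.
pose N := [set c : NMM | xi0 c = -oo].
have mN : measurable N.
  rewrite -[X in measurable X]setTI; exact: (mxi0 measurableT (emeasurable_set1 -oo)).
have : {ae Q, forall c, forall x, locations c x -> ~ N (shift x c)}.
  apply: (ae_points stat mN).
  have mI : measurable_fun setT (fun c : NMM => (\1_N c)%:E : \bar R).
    by apply/measurable_EFinP; exact: measurable_indic.
  have I0 c : 0 <= (\1_N c)%:E :> \bar R by rewrite lee_fin.
  have mS := measurable_shift_sum borel_unit_cube unit_cube_window mI I0.
  rewrite -(integral0 Q setT); apply: ae_eq_integral => //.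
  apply: filterS aef => c fc _.
  rewrite /shift_sum /location_sum; apply: esum1 => x [px Ux].
  rewrite indicE memNset// => Nx; move/negP: fc; apply; rewrite /f.
  rewrite (_ : shift_sum xi0^\- U c = +oo).
    by rewrite addeNy.
  apply/eqP; rewrite -leye_eq /shift_sum /location_sum (esumID [set x])//.
  have -> : locations c `&` U `&` [set x] = [set x].
    by apply/seteqP; split => [z []//|z ->].
  rewrite esum_set1 ?funeneg_ge0// {1}funenegE Nx /= maxye.
  by rewrite leeDl// esum_ge0.
apply: filterS => c cN x px xix; apply: (cN x px); rewrite /N /= patchE mem_set//.
exact: configs_at0_shift.
Qed.

(** Intensities use the closed unit cube, tilings the half-open one; they differ by faces that carry
    no points. *)
Let integral_box (h : NMM -> \bar R) : measurable_fun setT h -> (forall c, 0 <= h c) ->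
  \int[Q]_c shift_sum h U c = \int[Q]_c shift_sum h (box 0 1) c.
Proof.
move=> mh h0; apply: ae_eq_integral => //.
- exact: (measurable_shift_sum borel_unit_cube unit_cube_window).
- exact: measurable_shift_sum_box.
- have : \int[Q]_c card_sum (R := R) (locations c `&` U) < +oo.
    by rewrite -intensityE; have /andP[] := Q_intensity.
  by move/(ae_unit_cube_box stat); apply: filterS => c cU _; rewrite /shift_sum /location_sum cU.
Qed.

Lemma xi_intensity_nonpos : nonpos_score xi ->
  xi_intensity xi Q = - \int[Q]_c shift_sum xi0^\- (box 0 1) c.
Proof.
move=> npos; rewrite xi_intensityE -integral_box//.
rewrite -integral_ge0N; last by move=> c _; exact: shift_sum_ge0.
apply: eq_integral => c _; rewrite (_ : shift_sum xi0^\+ U c = 0) ?add0e//.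
apply: esum1 => x _; apply/eqP; rewrite eq_le funepos_ge0 andbT funeposE ge_max lexx andbT.
by rewrite patchE; case: ifPn => // /set_mem/npos.
Qed.

Lemma xi_intensity_nonneg : nonneg_or_ninfty_score xi -> {ae Q, forall psi, admissible xi psi} ->
  xi_intensity xi Q = \int[Q]_c shift_sum xi0^\+ (box 0 1) c.
Proof.
move=> nneg adm; rewrite xi_intensityE -integral_box//; apply: ae_eq_integral => //.
  exact: emeasurable_funB.
apply: filterS adm => c adm _; rewrite (_ : shift_sum xi0^\- U c = 0) ?sube0//.
apply: esum1 => x [px _]; have cx := configs_at0_shift px.
rewrite funenegE patchE mem_set//; apply/max_idPr.
by rewrite leeNl oppe0; case: (nneg _ cx) => [|/andP[]//]; have := adm x px.
Qed.

End ScoreIntensity.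

Section Markings.
Context {R : realType} {d : nat} {M M' : topologicalType}.
Local Notation NM := (config R d M).
Local Notation NMM := (config R d (M * M')%type).
Local Open Scope ereal_scope.

Section Scores.
Variable xi : NMM -> \bar R.
Local Notation xi0 := (xi \_ (configs_at0 : set NMM)).

Lemma shift_sum_score_pos W psi : nonneg_or_ninfty_score xi -> admissible xi psi ->
  shift_sum xi0^\+ W psi = \esum_(x in locations psi `&` W) xi (shift x psi).
Proof.
move=> nneg adm; apply: eq_esum => x [px _]; have cx := configs_at0_shift px.
rewrite funeposE patchE mem_set//; apply/max_idPl.
by case: (nneg _ cx) => [|/andP[]//]; have := adm x px.
Qed.

Lemma shift_sum_score_neg W psi : nonpos_score xi ->
  shift_sum xi0^\- W psi = \esum_(x in locations psi `&` W) - xi (shift x psi).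
Proof.
move=> npos; apply: eq_esum => x [px _]; have cx := configs_at0_shift px.
by rewrite funenegE patchE mem_set//; apply/max_idPl; rewrite oppe_ge0; exact: npos.
Qed.

End Scores.

Lemma shift_sum_forget (h : NM -> \bar R) W (psi : NMM) :
  shift_sum (h \o @forget R d M M') W psi = shift_sum h W (forget psi).
Proof.
rewrite /shift_sum /location_sum locations_forget.
by apply: eq_esum => x _; rewrite /= forget_shift.
Qed.

Variables (mu : probability NM R) (Q : probability NMM R).
Hypothesis Q_marking : stationary_markings mu Q.

Lemma integral_forget (g : NM -> \bar R) : measurable_fun setT g -> (forall c, 0 <= g c) ->
  \int[Q]_c g (forget c) = \int[mu]_c g c.
Proof.
move=> mg g0; transitivity (\int[pushforward Q (@forget R d M M')]_c g c).
  by rewrite (ge0_integral_pushforward (@measurable_forget R d M M')) ?preimage_setT.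
apply: eq_measure_integral; first exact: measurable_forget.
by move=> mF A mA _; have [_] := Q_marking; apply.
Qed.

Lemma intensity_marking : intensity Q = intensity mu.
Proof.
rewrite !intensityE -integral_forget; last 2 first.
- apply: (measurable_shift_sum borel_unit_cube unit_cube_window (h := cst 1)) => //.
- by move=> c; exact: card_sum_ge0.
by apply: eq_integral => c _; rewrite locations_forget.
Qed.

Lemma ae_forget (P : set NM) : {ae mu, forall c, P c} -> {ae Q, forall c, P (forget c)}.
Proof.
move=> [N [mN muN PN]]; exists (@forget R d M M' @^-1` N); split => //.
- by rewrite -[X in measurable X]setTI; exact: measurable_forget.
- by have [_ /(_ N mN)] := Q_marking; rewrite /pushforward => ->.
- by move=> c /= nP; exact: PN.
Qed.

End Markings.

(** * Comparison of score intensities and conclusion *)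

Section Optimality.
Context {R : realType} {d : nat} {M M' : topologicalType}.
Hypothesis d_gt0 : (0 < d)%N.
Hypothesis M_sc : @second_countable M.
Hypothesis M'_hausdorff : hausdorff_space M'.
Hypothesis M'_lc : locally_compact [set: M'].
Hypothesis M'_sc : @second_countable M'.
Local Notation NM := (config R d M).
Local Notation NMM := (config R d (M * M')%type).
Variable mu : probability NM R.
Hypothesis mu_stat : stationary mu.
Hypothesis mu_intensity : (0 < intensity mu < +oo)%E.
Variable xi : NMM -> \bar R.
Hypothesis mxi : measurable_fun (configs_at0 : set NMM) xi.
Variable Rad : R -> NMM -> R.
Hypothesis xi_stab : stabilizing_radii mu xi Rad.
Variable p : R.
Hypothesis p_gt1 : 1 < p.
Hypothesis Rad_moment : forall (eps : R) (Q : probability NMM R), 0 < eps ->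
  admissible_markings mu xi Q ->
  (palm_expectation Q (fun psi => (Rad eps psi `^ (d%:R * p / (p - 1)))%:E) < +oo)%E.
Local Notation xi0 := (xi \_ (configs_at0 : set NMM)).
Local Notation rho eps := (Rad eps \_ (configs_at0 : set NMM)).
Local Notation a := (d%:R / (p - 1)).
Local Open Scope ereal_scope.

Let a_gt0 : (0 < a)%R. Proof. by rewrite divr_gt0 ?ltr0n// subr_gt0. Qed.

(** The moment order exceeds the dimension by [a], which becomes the decay exponent of the bad
    events. *)
Let exponent : (d%:R * p / (p - 1) = d%:R + a)%R.
Proof. by field; rewrite subr_eq0 gt_eqF. Qed.

Lemma measurable_rho eps : (0 < eps)%R -> measurable_fun setT (rho eps).
Proof.
move=> /xi_stab[mR _ _]; apply/measurable_restrict; rewrite ?setTI//.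
exact: measurable_configs_at0.
Qed.

Lemma rho_ge0 eps c : (0 < eps)%R -> (0 <= rho eps c)%R.
Proof.
by move=> /xi_stab[_ R0 _]; rewrite patchE; case: ifPn => // /set_mem; exact: R0.
Qed.

Lemma rho_shift eps psi x : locations psi x -> rho eps (shift x psi) = Rad eps (shift x psi).
Proof. by move=> px; rewrite patchE mem_set//; exact: configs_at0_shift. Qed.

Lemma rho_moment eps (Q : probability NMM R) : (0 < eps)%R -> admissible_markings mu xi Q ->
  \int[Q]_c shift_sum (fun c => (rho eps c `^ (d%:R + a))%:E) (box 0 1) c < +oo.
Proof.
move=> eps0 admQ; have := Rad_moment eps0 admQ; rewrite exponent.
have [mR R0 _] := xi_stab eps0.
have intQ : 0 < intensity Q < +oo by rewrite (intensity_marking admQ.1).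
move=> /(palm_expectation_lty intQ) => fin.
rewrite (_ : (fun c => _) = (fun psi => (Rad eps psi `^ (d%:R + a))%:E) \_ configs_at0).
  apply: fin.
    by apply/measurable_EFinP; apply: (measurableT_comp (measurable_powR _) mR).
  by move=> c _; rewrite lee_fin powR_ge0.
apply/funext => c; rewrite !patchE; case: ifPn => // _.
by rewrite powR0// gt_eqF// ltr_wpDl.
Qed.

Lemma ae_stable eps (Q : probability NMM R) : (0 < eps)%R -> stationary_markings mu Q ->
  {ae Q, forall psi, forall x, locations psi x -> stable_at xi (Rad eps) eps (shift x (forget psi))}.
Proof.
move=> /xi_stab[_ _ st] QT; have := ae_palm mu_intensity mu_stat st.
move/(ae_forget QT); apply: filterS => psi h x px; apply: h.
by rewrite locations_forget.
Qed.

Variables Q Q' : probability NMM R.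
Hypothesis Q_adm : admissible_markings mu xi Q.
Hypothesis Q_opt : {ae Q, forall psi, locally_optimal xi psi}.
Hypothesis Q'_adm : admissible_markings mu xi Q'.

Let card_lty (P : probability NMM R) : stationary_markings mu P ->
  \int[P]_c card_sum (R := R) (locations c `&` box 0 1) < +oo.
Proof. by move=> TP; apply: integral_card_box_lty; rewrite (intensity_marking TP). Qed.

Let same_base (P P' : probability NMM R) : stationary_markings mu P ->
  stationary_markings mu P' -> forall E, measurable E ->
  P (@forget R d M M' @^-1` E) = P' (@forget R d M M' @^-1` E).
Proof.
move=> [_ TP] [_ TP'] E mE; have := TP E mE; have := TP' E mE.
by rewrite /pushforward => -> ->.
Qed.

Let mxi0 := measurable_score_restrict mxi.

Lemma nonneg_intensity_le (mo : M') : nonneg_or_ninfty_score xi -> neutral_mark xi mo ->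
  \int[Q']_c shift_sum xi0^\+ (box 0 1) c <= \int[Q]_c shift_sum xi0^\+ (box 0 1) c.
Proof.
move=> nneg neu.
have mpos : measurable_fun setT xi0^\+ by exact: measurable_funepos.
have [TQ aeQ] := Q_adm; have [TQ' aeQ'] := Q'_adm.
apply: (integral_le_of_local_bounds M_sc M'_hausdorff M'_lc M'_sc TQ'.1 TQ.1
  (same_base TQ' TQ) mpos mpos (@measurable_cst _ _ _ _ _ (0 : \bar R))
  (funepos_ge0 xi0) (funepos_ge0 xi0) _ a_gt0) => //.
- exact: card_lty.
- by rewrite (eq_integral (cst 0)) ?integral0// => c _; exact: esum1.
(* Stability is a property of the base configuration, so requiring it of one of the two markings
   covers both. *)
move=> eps eps0; exists (rho eps), [set psi | admissible xi psi],
  [set psi | [/\ admissible xi psi, locally_optimal xi psi &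
    forall x, locations psi x -> stable_at xi (Rad eps) eps (shift x (forget psi))]].
split.
- exact: measurable_rho.
- by move=> c; exact: rho_ge0.
- by split; exact: rho_moment.
- split => //; move: aeQ Q_opt (ae_stable eps0 TQ); apply: filterS3.
  by move=> psi *; split.
move=> psi' psi j k same /= adm' [adm opt st] small' small.
have lpsi : locations psi = locations (forget psi) by rewrite locations_forget.
have lpsi' : locations psi' = locations (forget psi) by rewrite -same locations_forget.
rewrite !shift_sum_score_pos// lpsi.
rewrite (_ : shift_sum (cst 0) _ psi = 0) ?adde0; last by apply: esum1.
rewrite -lpsi [in X in _ + X]lpsi.
apply: (nonneg_local_bound eps0 _ erefl same adm adm' _ _ opt nneg neu).
- by move=> x px; apply: st; rewrite lpsi.
- by move=> y py Wy; rewrite -rho_shift ?lpsi//; apply: small; rewrite ?lpsi.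
- by move=> y py Wy; rewrite -rho_shift ?lpsi'//; apply: small'; rewrite ?lpsi'.
Qed.

Lemma nonpos_intensity_le (xib : NM -> R) : nonpos_score xi ->
  score_difference_majorant mu xi xib ->
  palm_expectation mu (fun phi => (xib phi `^ p)%:E) < +oo ->
  \int[Q]_c shift_sum xi0^\- (box 0 1) c <= \int[Q']_c shift_sum xi0^\- (box 0 1) c.
Proof.
move=> npos [[mxib xib0] maj] xib_mom.
have mneg : measurable_fun setT xi0^\- by exact: measurable_funeneg.
have [TQ aeQ] := Q_adm; have [TQ' aeQ'] := Q'_adm.
pose b : NM -> \bar R := (EFin \o xib) \_ configs_at0.
have b0 c : 0 <= b c.
  by rewrite /b patchE; case: ifPn => // /set_mem; rewrite lee_fin; exact: xib0.
have mb : measurable_fun setT b.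
  apply/measurable_restrict; rewrite ?setTI//; first exact: measurable_configs_at0.
  exact/measurable_EFinP.
have bw (psi : NMM) W : shift_sum (b \o @forget R d M M') W psi =
    \esum_(x in locations (forget psi) `&` W) (xib (shift x (forget psi)))%:E.
  rewrite shift_sum_forget; apply: eq_esum => x [px _].
  by rewrite /b patchE mem_set//; exact: configs_at0_shift.
have mbf : measurable_fun setT (b \o @forget R d M M').
  by apply: measurableT_comp => //; exact: measurable_forget.
apply: (integral_le_of_local_bounds M_sc M'_hausdorff M'_lc M'_sc TQ.1 TQ'.1
  (same_base TQ TQ') mneg mneg mbf
  (funeneg_ge0 xi0) (funeneg_ge0 xi0) _ a_gt0) => //.
- by move=> c; exact: b0.
- exact: card_lty.
- under eq_integral do rewrite shift_sum_forget.
  rewrite (integral_forget TQ' (g := shift_sum b (box 0 1))); last 2 first.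
  + exact: measurable_shift_sum_box.
  + by move=> c; exact: shift_sum_ge0.
  pose b' : NM -> \bar R := (fun phi => (xib phi `^ p)%:E) \_ configs_at0.
  have b'0 c : 0 <= b' c by rewrite /b' patchE; case: ifPn => // _; rewrite lee_fin powR_ge0.
  have mxibp : measurable_fun configs_at0 (fun phi => (xib phi `^ p)%:E).
    by apply/measurable_EFinP; apply: (measurableT_comp (measurable_powR _) mxib).
  have mb' : measurable_fun setT b'.
    by apply/measurable_restrict; rewrite ?setTI//; exact: measurable_configs_at0.
  have fin' : \int[mu]_c shift_sum b' (box 0 1) c < +oo.
    by apply: palm_expectation_lty => // c _; rewrite lee_fin powR_ge0.
  have finc := integral_card_box_lty mu_intensity.
  have m1 : measurable_fun setT (cst 1 : NM -> \bar R) by exact: measurable_cst.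
  have c10 (c : NM) : 0 <= cst (1 : \bar R) c by [].
  (* The majorant is at most 1 plus its [p]-th power, and the expected number of points in the cell
     is finite. *)
  apply: (@le_lt_trans _ _ (\int[mu]_c (card_sum (R := R) (locations c `&` box 0 1) +
      shift_sum b' (box 0 1) c))).
    apply: ge0_le_integral => //.
    * by move=> c _; exact: shift_sum_ge0.
    * exact: measurable_shift_sum_box.
    * by apply: emeasurable_funD; [exact: (measurable_shift_sum_box 0 1 m1 c10)|
        exact: measurable_shift_sum_box].
    * move=> c _; rewrite /shift_sum /location_sum /card_sum -esumD//.
      apply: le_esum => x [px _]; rewrite /b /b' !patchE mem_set; last exact: configs_at0_shift.
      rewrite /= -EFinD lee_fin; have [x1|/ltW x1] := leP 1%R (xib (shift x c)).
        by apply: (le_trans (le1r_powR x1 (ltW p_gt1))); rewrite lerDr.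
      by apply: (le_trans x1); rewrite lerDl powR_ge0.
  rewrite ge0_integralD//.
  + exact: lte_add_pinfty.
  + by move=> c _; exact: card_sum_ge0.
  + exact: (measurable_shift_sum_box 0 1 m1 c10).
  + by move=> c _; exact: shift_sum_ge0.
  + exact: measurable_shift_sum_box.
move=> eps eps0; pose goodmaj (psi : NMM) := forall psi1 psi2 (B : set 'rV[R]_d) x,
     marking (forget psi) psi1 -> marking (forget psi) psi2 ->
     admissible xi psi1 -> admissible xi psi2 ->
     <<s @open 'rV[R]_d >> B -> (locations (forget psi) `&` B) x ->
     `|score_diff xi x psi1 (splice B psi1 psi2)| <= (xib (shift x (forget psi)))%:E.
exists (rho eps), [set psi | [/\ admissible xi psi, locally_optimal xi psi &
    (forall x, locations psi x -> stable_at xi (Rad eps) eps (shift x (forget psi))) /\ goodmaj psi]],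
  [set psi | admissible xi psi].
split.
- exact: measurable_rho.
- by move=> c; exact: rho_ge0.
- by split; exact: rho_moment.
- split => //; have aegm : {ae Q, forall psi, goodmaj psi} := ae_forget TQ maj.
  have : {ae Q, forall psi, admissible xi psi /\ locally_optimal xi psi}.
    by move: aeQ Q_opt; apply: filterS2 => psi; split.
  move: (ae_stable eps0 TQ) aegm; apply: filterS3.
  by move=> psi st gm [adm opt]; split.
move=> psi psi' j k same /= [adm opt [st gm]] adm' small small'.
have lpsi : locations psi = locations (forget psi) by rewrite locations_forget.
have lpsi' : locations psi' = locations (forget psi) by rewrite same locations_forget.
rewrite !shift_sum_score_neg// bw -same [in X in _ + X]lpsi'.
apply: (nonpos_local_bound eps0 _ erefl (esym same) adm adm' _ _ opt npos) => //.
- by move=> x px; apply: st; rewrite lpsi.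
- by move=> y py Wy; rewrite -rho_shift ?lpsi//; apply: small; rewrite ?lpsi.
- by move=> y py Wy; rewrite -rho_shift ?lpsi'//; apply: small'; rewrite ?lpsi'.
- by move=> x px; apply: xib0; exact: configs_at0_shift.
Qed.

End Optimality.

Theorem theorem2p3 (R : realType) (d : nat) (d_gt0 : (0 < d)%N)
  (M M' : topologicalType)
  (M_hausdorff : hausdorff_space M) (M_lc : locally_compact [set: M])
  (M_sc : @second_countable M)
  (M'_hausdorff : hausdorff_space M') (M'_lc : locally_compact [set: M'])
  (M'_sc : @second_countable M')
  (disp : measure_display) (Omega : measurableType disp)
  (P : probability Omega R) (Phi : {RV P >-> config R d M})
  (Phi_stationary : stationary (distribution P Phi))
  (Phi_intensity : (0 < intensity (distribution P Phi) < +oo)%E)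
  (xi : config R d (M * M')%type -> \bar R)
  (xi_measurable : measurable_fun (@configs_at0 R d (M * M')%type) xi)
  (Rad : R -> config R d (M * M')%type -> R)
  (xi_stabilizing : stabilizing_radii (distribution P Phi) xi Rad)
  (xib : config R d M -> R)
  (xi_case :
     [/\ nonneg_or_ninfty_score xi,
         (exists mo : M', neutral_mark xi mo) &
         integrable_majorant (distribution P Phi) xi xib]
     \/
     (nonpos_score xi /\
      score_difference_majorant (distribution P Phi) xi xib))
  (p : R) (p_gt1 : 1 < p)
  (xib_moment :
     (palm_expectation (distribution P Phi)
        (fun phi => (xib phi `^ p)%:E) < +oo)%E)
  (Rad_moment : forall (eps : R) (Q : probability (config R d (M * M')%type) R),
     0 < eps -> admissible_markings (distribution P Phi) xi Q ->
     (palm_expectation Q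
        (fun psi => (Rad eps psi `^ (d%:R * p / (p - 1)))%:E) < +oo)%E) :
  forall Q : probability (config R d (M * M')%type) R,
    admissible_markings (distribution P Phi) xi Q ->
    {ae Q, forall psi, locally_optimal xi psi} ->
    intensity_optimal (distribution P Phi) xi Q.
Proof.
move=> Q Q_adm Q_opt; have [TQ aeQ] := Q_adm; split => //.
have intensity_bounds (Q' : probability (config R d (M * M')%type) R) :
    stationary_markings (distribution P Phi) Q' -> (0 < intensity Q' < +oo)%E.
  by move=> TQ'; rewrite (intensity_marking TQ').
apply/eqP; rewrite eq_le; apply/andP; split.
  by apply: ereal_sup_ubound; exists Q.
apply: ge_ereal_sup => _ [Q' TQ' <-].
(* A competitor of intensity [-oo] is beaten trivially; any other is almost surely admissible, so
   the radius moments apply to it. *)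
have [->|/ae_admissible_of_intensity aeQ'] := eqVneq (xi_intensity xi Q') -oo%E.
  exact: leNye.
have {}aeQ' := aeQ' xi_measurable TQ'.1.
have Q'_adm : admissible_markings (distribution P Phi) xi Q' by [].
have iQ := intensity_bounds _ TQ; have iQ' := intensity_bounds _ TQ'.
case: xi_case => [[nneg [mo neu] _]|[npos maj]].
  rewrite !xi_intensity_nonneg//; last 2 first.
  - exact: TQ.1.
  - exact: TQ'.1.
  exact: (nonneg_intensity_le d_gt0 M_sc M'_hausdorff M'_lc M'_sc Phi_stationary
    Phi_intensity xi_measurable xi_stabilizing p_gt1 Rad_moment Q_adm Q_opt Q'_adm nneg neu).
rewrite !xi_intensity_nonpos//; last 2 first.
- exact: TQ.1.
- exact: TQ'.1.
rewrite leeN2.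
exact: (nonpos_intensity_le d_gt0 M_sc M'_hausdorff M'_lc M'_sc Phi_stationary
  Phi_intensity xi_measurable xi_stabilizing p_gt1 Rad_moment Q_adm Q_opt Q'_adm npos maj).
Qed.
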